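(* Let $f\in\mathbb H^{-s}(\Omega)$, $z_\delta\in L^2(\Omega)$, $q^*\in L^2(\Omega)$ and $\rho>0$. A coefficient $q^\ddagger\in\mathcal Q$ is a local solution of the extended identification problem $\min_{q\in\mathcal Q}\mathcal J_{\delta,\rho}(q)$ if and only if $q^\ddagger$ is a local solution of the fractional identification problem $\min_{q\in\mathcal Q}J_{\delta,\rho}(q)$. In addition, $\operatorname{tr}E(q^\ddagger)=U(q^\ddagger)$ in $\Omega$.
   Context: Setting: $d\in\{2,3\}$; $\Omega\subset\mathbb R^d$ is an open bounded convex polytope; $A\in C^{0,1}(\Omega;\mathrm{GL}(\mathbb R^d))$ is symmetric and uniformly positive definite; $\bar q>0$ and $\mathcal Q=\{q\in L^\infty(\Omega): 0\le q\le\bar q \text{ a.e.}\}$; $s\in(0,1)$, $\alpha=1-2s$, $d_s=2^{1-2s}\Gamma(1-s)/\Gamma(s)$. For $q\in\mathcal Q$ let $\mathcal L=\mathcal L_q$, $\mathcal L w=-\mathrm{div}_{x'}(A\nabla_{x'}w)+qw$ with homogeneous Dirichlet conditions, and let $(\lambda_k,\varphi_k)_{k\ge1}$ be its eigenpairs, $(\varphi_k)$ orthonormal in $L^2(\Omega)$. For $r\ge 0$, $\mathbb H^r(\Omega)=\{w=\sum_k w_k\varphi_k:\|w\|_{\mathbb H^r(\Omega)}^2=\sum_k\lambda_k^r w_k^2<\infty\}$, and $\mathbb H^{-r}(\Omega)$ is its dual, with pairing $\langle\cdot,\cdot\rangle$. For $r\in[0,1]$ different $q\in\mathcal Q$ give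 the same space with equivalent norms. The spectral fractional power is $\mathcal L^s w=\sum_k\lambda_k^s w_k\varphi_k$, $\mathcal L^s:\mathbb H^s(\Omega)\to\mathbb H^{-s}(\Omega)$. $U(q)\in\mathbb H^s(\Omega)$ denotes the unique solution $u$ of $\langle\mathcal L^su,v\rangle=\langle f,v\rangle$ for all $v\in\mathbb H^s(\Omega)$. Extension: $\mathcal C=\Omega\times(0,\infty)$ with points $x=(x',y)$; $\mathbf A=\mathrm{diag}\{A,1\}$; $\mathring H^1_L(y^\alpha,\mathcal C)$ is the space of $w\in L^2(y^\alpha,\mathcal C)$ with $\nabla w\in L^2(y^\alpha,\mathcal C)$ and $w=0$ on $\partial\Omega\times(0,\infty)$, where $L^2(y^\alpha,\cdot)$ is the $L^2$ space for the measure $y^\alpha dx$; $\operatorname{tr}:\mathring H^1_L(y^\alpha,\mathcal C)\to\mathbb H^s(\Omega)$ is the (bounded, surjective) trace onto $\Omega\times\{0\}$. Let $a_{\mathcal C}(w,\phi)(q)=\int_{\mathcal C}y^\alpha(\mathbf A\nabla w\cdot\nabla\phi+qw\phi)\,dx'\,dy$. $E(q)\in\mathring H^1_L(y^\alpha,\mathcal C)$ is the unique solution of $a_{\mathcal C}(E(q),\phi)(q)=d_s\langle f,\operatorname{tr}\phi\rangle$ for all $\phi\in\mathring H^1_L(y^\alpha,\mathcal C)$. Cost functionals: $J_{\delta,\rho}(q)=\frac12\|U(q)-z_\delta\|_{L^2(\Omega)}^2+\frac\rho2\|q-q^*\|_{L^2(\Omega)}^2$ and $\mathcal J_{\delta,\rho}(q)=\frac12\|\operatorname{tr}E(q)-z_\delta\|_{L^2(\Omega)}^2+\frac\rho2\|q-q^*\|_{L^2(\Omega)}^2$.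 Local solution: $\tilde q\in\mathcal Q$ is a local solution of $\min_{\mathcal Q}\mathcal F$ if there is $\epsilon>0$ with $\mathcal F(\tilde q)\le\mathcal F(q)$ for all $q\in\mathcal Q$ with $\|q-\tilde q\|_{L^2(\Omega)}<\epsilon$. *)

(* Defs.v *)
From HB Require Import structures.
From mathcomp Require Import all_boot all_order all_algebra.
From mathcomp Require Import all_classical all_reals all_analysis.
Import Order.TTheory GRing.Theory Num.Theory.
Import numFieldNormedType.Exports.

Set Implicit Arguments.
Unset Strict Implicit.
Unset Printing Implicit Defensive.

Local Open Scope classical_set_scope.
Local Open Scope ring_scope.

Definition rV_display : measure_display -> measure_display.
Proof. exact. Qed.

Section measurable_rV.
Context {d : measure_display} {T : sigmaRingType d} (n : nat).

Let coord (i : 'I_n) (x : 'rV[T]_n) : T := x ord0 i.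

Let rV_set0 : g_sigma_preimage coord set0.
Proof. exact: sigma_algebra0. Qed.

Let rV_setC A : g_sigma_preimage coord A -> g_sigma_preimage coord (~` A).
Proof. exact: sigma_algebraC. Qed.

Let rV_bigcup (F : (set 'rV[T]_n)^nat) :
  (forall i, g_sigma_preimage coord (F i)) ->
  g_sigma_preimage coord (\bigcup_i F i).
Proof. exact: sigma_algebra_bigcup. Qed.

HB.instance Definition _ := @isMeasurable.Build (rV_display d) 'rV[T]_n
  (g_sigma_preimage coord) rV_set0 rV_setC rV_bigcup.

End measurable_rV.

Section lebesgue_rV.
Variable R : realType.

Definition rV_cons n (p : 'rV[R]_n * measurableTypeR R) : 'rV[R]_n.+1 :=
  row_mx (p.2 : R)%:M p.1 : 'rV[R]_(1 + n).

Lemma rV_consE n p (i : 'I_n.+1) :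
  rV_cons p ord0 i = if unlift ord0 i is Some j then p.1 ord0 j else (p.2 : R).
Proof.
rewrite /rV_cons [LHS]mxE; case: unliftP => [j|] ->; case: splitP => k /= kE.
- by move: kE; rewrite /bump /= ord1.
- by congr (p.1 _ _); apply/val_inj; move: kE => /= [].
- by rewrite mxE [k]ord1 mulr1n.
- by move: kE.
Qed.

Lemma measurable_coord n (i : 'I_n) :
  measurable_fun setT (fun x : 'rV[R]_n => x ord0 i).
Proof.
move=> _ Y mY; rewrite setTI; apply: sub_sigma_algebra => /=.
rewrite -bigcup_seq/=; exists i => /=; first by rewrite mem_index_enum.
by exists Y => //; rewrite setTI.
Qed.

Lemma measurable_rV_cons n : measurable_fun setT (@rV_cons n).
Proof.
suff H : preimage_set_system setT (@rV_cons n) (@measurable _ 'rV[R]_n.+1)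
    `<=` measurable by move=> _ A mA; apply: H; exists A.
rewrite -(g_sigma_preimage_comp (fun i (x : 'rV[R]_n.+1) => x ord0 i)).
apply: smallest_sub; first exact: sigma_algebra_measurable.
rewrite -bigcup_mkord_ord; apply: bigcup_sub => k _ A [B mB <-].
set i := inord k.
have -> : (fun x : 'rV[R]_n.+1 => x ord0 i) \o @rV_cons n =
    fun p => if unlift ord0 i is Some j then p.1 ord0 j else p.2 : R.
  by apply/funext => p /=; rewrite rV_consE.
have H : measurable_fun setT (fun p : 'rV[R]_n * measurableTypeR R =>
    if unlift ord0 i is Some j then p.1 ord0 j else p.2).
  case: (unlift ord0 i) => [j|]; last exact: measurable_snd.
  exact: measurableT_comp (measurable_coord j) measurable_fst.
exact: H.
Qed.

Definition lebesgue_rV_step n (mu : {measure set 'rV[R]_n -> \bar R}) :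
    set 'rV[R]_n.+1 -> \bar R :=
  pushforward (mu \x (@lebesgue_measure R))%E (@rV_cons n).

Section step.
Variables (n : nat) (mu : {measure set 'rV[R]_n -> \bar R}).

Let step0 : lebesgue_rV_step mu set0 = 0%E.
Proof. by rewrite /lebesgue_rV_step /pushforward preimage_set0 measure0. Qed.

Let step_ge0 A : (0 <= lebesgue_rV_step mu A)%E.
Proof. by rewrite /lebesgue_rV_step /pushforward measure_ge0. Qed.

Let step_sigma_additive : semi_sigma_additive (lebesgue_rV_step mu).
Proof.
move=> F mF tF mUF; rewrite /lebesgue_rV_step /pushforward preimage_bigcup.
have mpre A : measurable A -> measurable (@rV_cons n @^-1` A).
  by move=> mA; rewrite -[X in measurable X]setTI; exact: measurable_rV_cons.
apply: measure_semi_sigma_additive.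
- by move=> k; exact: mpre.
- apply/trivIsetP => /= i j _ _ ij; rewrite -preimage_setI.
  by move/trivIsetP : tF => /(_ _ _ _ _ ij) ->//; rewrite preimage_set0.
- by rewrite -preimage_bigcup; exact: mpre.
Qed.

HB.instance Definition _ := isMeasure.Build _ _ _ (lebesgue_rV_step mu)
  step0 step_ge0 step_sigma_additive.

End step.

Fixpoint lebesgue_rV n : {measure set 'rV[R]_n -> \bar R} :=
  match n with
  | 0 => \d_(0 : 'rV[R]_0)
  | m.+1 => lebesgue_rV_step (lebesgue_rV m)
  end.

End lebesgue_rV.

Section weighted_L2.
Context {d : measure_display} {T : measurableType d} {R : realType}.
Variables (mu : {measure set T -> \bar R}) (D : set T) (omega : T -> R).
Local Open Scope ereal_scope.

Definition sqnorm (f : T -> R) : \bar R :=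
  \int[mu]_(x in D) (omega x * f x ^+ 2)%:E.

Definition L2 : set (T -> R) :=
  [set f : T -> R | measurable_fun D f /\ sqnorm f < +oo].

Definition inner (f g : T -> R) : R :=
  (\int[mu]_(x in D) (omega x * f x * g x))%R.

Definition normL2 (f : T -> R) : R := Num.sqrt (fine (sqnorm f)).

End weighted_L2.

Section test_functions.
Context {R : realType} {V : normedModType R}.

Fixpoint Ck (k : nat) (f : V -> R) : Prop :=
  continuous f /\
  if k is m.+1 then
    forall v : V, (forall x, derivable f x v) /\ Ck m (fun x => 'D_v f x)
  else True.

Definition Ccinfty (D : set V) : set (V -> R) :=
  [set f | (forall k, Ck k f) /\
    exists K, [/\ compact K, K `<=` D & forall x, ~ K x -> f x = 0]].

End test_functions.

Section sobolev.
Context {d : measure_display} {T : measurableType d} {R : realType} {n : nat}.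
Variables (mu : {measure set T -> \bar R}) (D : set T) (omega : T -> R).
(* [test] are the functions against which weak derivatives are tested, [core]
   those whose closure is taken, [pd i] the i-th classical partial
   derivative. *)
Variables (test core : set (T -> R)) (pd : 'I_n -> (T -> R) -> (T -> R)).

Definition weak_gradient (w : T -> R) (g : T -> 'rV[R]_n) : Prop :=
  forall i phi, test phi ->
    \int[mu]_(x in D) (w x * pd i phi x) =
    - \int[mu]_(x in D) (g x ord0 i * phi x).

(* Weak gradients are carried along as a representative g, unique up to a null
   set; the bilinear forms below take such representatives as arguments. *)
Definition H1 (w : T -> R) (g : T -> 'rV[R]_n) : Prop :=
  [/\ L2 mu D omega w, forall i, L2 mu D omega (fun x => g x ord0 i)
    & weak_gradient w g].

Definition H1sqnorm (w : T -> R) (g : T -> 'rV[R]_n) : \bar R :=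
  (sqnorm mu D omega w +
   \sum_(i < n) sqnorm mu D omega (fun x => g x ord0 i))%E.

Definition grad (phi : T -> R) (x : T) : 'rV[R]_n := \row_i pd i phi x.

Definition H1approx (w : T -> R) (g : T -> 'rV[R]_n)
    (phi : nat -> T -> R) : Prop :=
  (forall k, core (phi k)) /\
  H1sqnorm (fun x => w x - phi k x) (fun x => g x - grad (phi k) x)
    @[k --> \oo] --> 0%E.

Definition H1core (w : T -> R) (g : T -> 'rV[R]_n) : Prop :=
  H1 w g /\ exists phi, H1approx w g phi.

End sobolev.

Section problem.
Context {R : realType} {d : nat}.
Local Notation V := 'rV[R]_d.

Definition open_bounded_convex_polytope (Omega : set V) : Prop :=
  [/\ Omega !=set0, bounded_set Omega &
    exists m (N : 'M[R]_(d, m)) (b : 'rV[R]_m),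
      Omega = [set x | forall i, (x *m N) ord0 i < b ord0 i]].

Definition dotv n (u v : 'rV[R]_n) : R := (u *m v^T) ord0 ord0.

Definition admissible_matrix (Omega : set V) (A : V -> 'M[R]_d) : Prop :=
  [/\ [lipschitz A x | x in Omega],
      forall x, Omega x -> A x \in unitmx,
      forall x, Omega x -> (A x)^T = A x &
      exists2 c : R, 0 < c &
        forall x, Omega x -> forall xi, c * dotv xi xi <= dotv (xi *m (A x)^T) xi].

Variables (Omega : set V) (A : V -> 'M[R]_d) (qbar s : R).
Local Notation leb := (lebesgue_rV R d).

Definition alpha : R := 1 - 2 * s.

Definition Gamma (x : R) : R :=
  \int[@lebesgue_measure R]_(t in `]0, +oo[) (t `^ (x - 1) * expR (- t)).

Definition d_s : R := 2 `^ (1 - 2 * s) * Gamma (1 - s) / Gamma s.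

Definition coefficients : set (V -> R) :=
  [set q : V -> R | measurable_fun Omega q /\
    {ae leb, forall x, Omega x -> 0 <= q x <= qbar}].

Definition L2Omega := L2 leb Omega (cst 1).
Definition innerOmega := inner leb Omega (cst 1).
Definition normOmega := normL2 leb Omega (cst 1).

Definition pdOmega (i : 'I_d) (phi : V -> R) : V -> R :=
  fun x => 'D_(delta_mx ord0 i) phi x.

(* H^1_0(Omega): closure of C_c^oo(Omega) in H^1(Omega) *)
Definition H10 (w : V -> R) (g : V -> V) : Prop :=
  H1core leb Omega (cst 1) (Ccinfty Omega) (Ccinfty Omega) pdOmega w g.

Local Notation W := (V * measurableTypeR R)%type.
Definition lebW : {measure set W -> \bar R} :=
  (leb \x (@lebesgue_measure R))%E.

Definition cylinder : set W := [set x | Omega x.1 /\ 0 < (x.2 : R)].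

Definition weight (x : W) : R := (x.2 : R) `^ alpha.

Definition pdC (i : 'I_(d + 1)) (phi : V * R -> R) : V * R -> R :=
  fun x => 'D_(match fintype.split i with
               | inl j => (delta_mx ord0 j, 0)
               | inr _ => (0, 1)
               end) phi x.

(* w in H^1(y^alpha, C), with weak gradient g (its last entry is the
   y-derivative), vanishing on the lateral boundary in the sense that it is a
   limit of smooth functions supported away from it; the supports of these
   functions may meet Omega * {0}. *)
Definition H1L (w : W -> R) (g : W -> 'rV[R]_(d + 1)) : Prop :=
  H1core lebW cylinder weight (Ccinfty (cylinder : set (V * R)))
    (Ccinfty (Omega `*` [set: R])) pdC w g.

(* The trace is the H^1(y^alpha, C)-closure of the restriction to y = 0. *)
Definition is_trace (w : W -> R) (u : V -> R) : Prop :=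
  L2Omega u /\ exists g phi,
    [/\ H1L w g,
        H1approx lebW cylinder weight (Ccinfty (Omega `*` [set: R])) pdC w g phi
      & sqnorm leb Omega (cst 1) (fun x => phi k (x, 0) - u x)
          @[k --> \oo] --> 0%E].

(* Eigenpairs of -div(A grad) + q with homogeneous Dirichlet conditions, in weak
   form; completeness says that the family exhausts the spectrum. *)
Definition is_eigensystem (q : V -> R) (lam : nat -> R) (phi : nat -> V -> R)
    : Prop :=
  [/\ forall k, exists2 g, H10 (phi k) g &
        forall v h, H10 v h ->
          \int[leb]_(x in Omega)
            (dotv (g x *m (A x)^T) (h x) + q x * phi k x * v x) =
          lam k * innerOmega (phi k) v,
      forall i j, innerOmega (phi i) (phi j) = (i == j)%:R
    & forall w, L2Omega w -> (forall k, innerOmega w (phi k) = 0) ->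
        {ae leb, forall x, Omega x -> w x = 0}].

Section spectral.
Variables (lam : nat -> R) (phi : nat -> V -> R).
Local Notation coef w k := (innerOmega w (phi k)).

Definition Hsqnorm (r : R) (w : V -> R) : \bar R :=
  (\sum_(0 <= k <oo) (lam k `^ r * coef w k ^+ 2)%:E)%E.

(* for r >= 0 and positive lam, w is the L2-sum of its coordinates, so that
   HH r is the space of all sums of w_k phi_k with Hsqnorm r finite *)
Definition HH (r : R) : set (V -> R) :=
  [set w : V -> R | L2Omega w /\ (Hsqnorm r w < +oo)%E].

(* the dual HH^{-r}(Omega); the pairing <F, v> is F v *)
Definition HHdual (r : R) : set ((V -> R) -> R) :=
  [set F | (forall a v w, HH r v -> HH r w ->
              F (fun x => a * v x + w x) = a * F v + F w) /\
     exists C : R, forall v, HH r v ->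
       `|F v| <= C * Num.sqrt (fine (Hsqnorm r v))].

(* L^r w = sum_k lam_k^r w_k phi_k as an element of HH^{-r}(Omega) *)
Definition frac_power (r : R) (w : V -> R) : (V -> R) -> R :=
  fun v => limn (series (fun k => lam k `^ r * coef w k * coef v k)).

Definition is_fractional_solution (f : (V -> R) -> R) (u : V -> R) : Prop :=
  HH s u /\ forall v, HH s v -> frac_power s u v = f v.

End spectral.

(* A, augmented by 1 in the y-direction *)
Definition Abold (x : W) : 'M[R]_(d + 1) := block_mx (A x.1) 0 0 1%:M.

Definition a_C (q : V -> R) (w phi : W -> R) (gw gphi : W -> 'rV[R]_(d + 1))
    : R :=
  \int[lebW]_(x in cylinder) (weight x *
    (dotv (gw x *m (Abold x)^T) (gphi x) + q x.1 * w x * phi x)).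

Definition is_extension (tr : (W -> R) -> (V -> R)) (f : (V -> R) -> R)
    (q : V -> R) (e : W -> R) : Prop :=
  exists2 ge, H1L e ge & forall phi gphi, H1L phi gphi ->
    a_C q e phi ge gphi = d_s * f (tr phi).

(* the cost of q when the state associated with q is S q *)
Definition cost (z qstar : V -> R) (rho : R) (S : (V -> R) -> (V -> R))
    (q : V -> R) : R :=
  2^-1 * normOmega (fun x => S q x - z x) ^+ 2 +
  rho / 2 * normOmega (fun x => q x - qstar x) ^+ 2.

Definition local_solution (F : (V -> R) -> R) (q0 : V -> R) : Prop :=
  coefficients q0 /\
  exists2 e : R, 0 < e & forall q, coefficients q ->
    normOmega (fun x => q x - q0 x) < e -> F q0 <= F q.

End problem.

(* Main.v *)
(* Fix an eigenpair (lam, phi) and test the extension problem against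
   phi(x') e(y); the Gaussians e(y) = exp(-r y^2) are limits of such functions.
   With w = E(q), pairings in L^2(y^alpha, C) and d = d_s <f, phi> this reads
     lam <w, phi e^(-r y^2)> - 2 r <w_y, phi y e^(-r y^2)> = d.
   Integrating by parts in y, the trace u = <tr w, phi> satisfies
     <w_y, phi y^(-alpha) e^(-r y^2)>
       - 2 r <w, phi y^(1-alpha) e^(-r y^2)> = -u.
   Put r = lam / (4 t) and integrate the first identity against t^(s-1) e^(-t)
   dt and the second against t^(-s) e^(-t) dt: the Gaussians become modified
   Bessel functions, the inversion t -> lam y^2 / (4 t) shows that both identities
   involve the same two moments of w, and eliminating these gives
   Gamma(s) d = 2 (lam/4)^s Gamma(1-s) u, that is <f, phi> = lam^s u. Hence
   tr E(q) and U(q) have the same coordinates and coincide almost everywhere, so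
   that the two cost functionals are equal on the admissible set. *)

Require Import Defs.
From HB Require Import structures.
From mathcomp Require Import all_boot all_order all_algebra.
From mathcomp Require Import all_classical all_reals all_analysis.
From mathcomp Require Import measurable_realfun ring lra.
Import Order.TTheory GRing.Theory Num.Theory.
Import numFieldNormedType.Exports.
Local Open Scope classical_set_scope.
Local Open Scope ring_scope.
Set Implicit Arguments.
Unset Strict Implicit.
Unset Printing Implicit Defensive.

(** The natural profile in y is y^s K_s(sqrt(lam) y), the decaying solution of the separated
    equation. By subordination it is a superposition of the Gaussians exp(-lam y^2 / (4 t)) with
    density t^(s-1) e^(-t), which is the origin of r = lam / (4 t). Working with the Gaussians
    leaves only a cutoff, Fubini and one change of variable, and no theory of Bessel functions. The
    elimination closes for a numerical reason: the factor 2 r lowers the power of t by one, turning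
    -s and s - 1 into -s - 1 and s - 2, while the inversion turns t^p into t^(-p-2), which maps s -
    1 to -s - 1 and -s to s - 2. Two obstacles shape the rest. The eigenvalues come without a sign,
    so lam > 0 is derived from ellipticity and from an identity that bounds a function of [H10] by
    one of its partial derivatives. Traces and weak gradients are relations between representatives,
    and their uniqueness is not given beforehand; traces are therefore identified only through their
    pairings with L^2 functions, which is all that the coordinates, and hence f, can see. *)

(** * Real-valued integrable functions and weighted L^2 spaces *)

Section integrable_EFin.
Context {d : measure_display} {T : measurableType d} {R : realType}.
Variables (mu : {measure set T -> \bar R}) (D : set T).
Hypothesis mD : measurable D.
Implicit Types f g : T -> R.

Lemma integrable_EFinD f g : mu.-integrable D (EFin \o f) ->
  mu.-integrable D (EFin \o g) ->
  mu.-integrable D (EFin \o (fun x => f x + g x)).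
Proof. by move=> fi gi; have := integrableD mD fi gi. Qed.

Lemma integrable_EFinZ c f : mu.-integrable D (EFin \o f) ->
  mu.-integrable D (EFin \o (fun x => c * f x)).
Proof. by move=> fi; have := integrableZl mD c fi. Qed.

Lemma integrable_EFin_le f g : measurable_fun D f ->
  (forall x, D x -> `|f x| <= `|g x|) -> mu.-integrable D (EFin \o g) ->
  mu.-integrable D (EFin \o f).
Proof.
by move=> mf fg; apply: le_integrable => //; exact/measurable_EFinP.
Qed.

Lemma integrable_EFin_measurable f : mu.-integrable D (EFin \o f) ->
  measurable_fun D f.
Proof. by move=> /measurable_int/measurable_EFinP. Qed.

End integrable_EFin.

Section weighted_L2_theory.
Context {d : measure_display} {T : measurableType d} {R : realType}.
Variables (mu : {measure set T -> \bar R}) (D : set T) (omega : T -> R).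
Hypothesis mD : measurable D.
Hypothesis momega : measurable_fun D omega.
Hypothesis omega_ge0 : forall x, D x -> 0 <= omega x.
Local Notation L2 := (L2 mu D omega).
Local Notation inner := (inner mu D omega).
Local Notation sqnorm := (sqnorm mu D omega).
Implicit Types f g h : T -> R.

Lemma L2_integrable_sq f : L2 f ->
  mu.-integrable D (EFin \o (fun x => omega x * f x ^+ 2)).
Proof.
move=> [mf foo]; apply/integrableP; split.
  by apply/measurable_EFinP/measurable_funM => //; exact: measurable_funX.
apply: le_lt_trans foo; rewrite /sqnorm le_eqVlt; apply/orP; left; apply/eqP.
apply: eq_integral => x /set_mem Dx /=.
by rewrite ger0_norm// mulr_ge0 ?sqr_ge0 ?omega_ge0.
Qed.

Lemma integrable_sq_L2 f : measurable_fun D f ->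
  mu.-integrable D (EFin \o (fun x => omega x * f x ^+ 2)) -> L2 f.
Proof.
move=> mf /integrableP[_ foo]; split => //; apply: le_lt_trans foo.
by apply: ge0_le_integral => //=;
  [by move=> x Dx; rewrite lee_fin mulr_ge0 ?sqr_ge0 ?omega_ge0
  |apply/measurable_EFinP/measurable_funM => //; exact: measurable_funX
  |apply/measurable_EFinP/measurableT_comp => //;
   apply: measurable_funM => //; exact: measurable_funX
  |by move=> x Dx; rewrite lee_fin ler_norm].
Qed.

Lemma L2_integrableM f g : L2 f -> L2 g ->
  mu.-integrable D (EFin \o (fun x => omega x * f x * g x)).
Proof.
move=> f2 g2.
have := integrable_EFinD mD (L2_integrable_sq f2) (L2_integrable_sq g2).
apply: integrable_EFin_le => //.
  apply: measurable_funM; last exact: (proj1 g2).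
  by apply: measurable_funM => //; exact: (proj1 f2).
move=> x Dx; rewrite -mulrDr -mulrA !normrM ler_wpM2l// -normrM.
rewrite (ger0_norm (addr_ge0 (sqr_ge0 _) (sqr_ge0 _))).
by rewrite ler_norml; apply/andP; split; nra.
Qed.

Lemma L2_le f g : measurable_fun D f -> L2 g ->
  (forall x, D x -> `|f x| <= `|g x|) -> L2 f.
Proof.
move=> mf g2 fg; split => //; apply: le_lt_trans (proj2 g2).
apply: ge0_le_integral => //=.
- by move=> x Dx; rewrite lee_fin mulr_ge0 ?sqr_ge0 ?omega_ge0.
- by apply/measurable_EFinP/measurable_funM => //; exact: measurable_funX.
- by apply/measurable_EFinP/measurable_funM => //; apply: measurable_funX;
    exact: (proj1 g2).
- move=> x Dx; rewrite lee_fin ler_wpM2l ?omega_ge0//.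
  by rewrite -(real_normK (num_real (f x))) -(real_normK (num_real (g x)))
    ler_sqr ?nnegrE ?fg.
Qed.

Lemma L2D f g : L2 f -> L2 g -> L2 (fun x => f x + g x).
Proof.
move=> f2 g2; apply: integrable_sq_L2.
  by apply: measurable_funD; [exact: (proj1 f2)|exact: (proj1 g2)].
have := integrable_EFinD mD (L2_integrable_sq f2)
  (integrable_EFinD mD (integrable_EFinZ mD 2 (L2_integrableM f2 g2))
    (L2_integrable_sq g2)).
by apply: eq_integrable => // x _ /=; congr EFin; ring.
Qed.

Lemma L2_mulb (b : T -> R) (B : R) f : measurable_fun D b ->
  (forall x, D x -> `|b x| <= B) -> L2 f -> L2 (fun x => b x * f x).
Proof.
move=> mb bB f2; have mf := proj1 f2.
apply: integrable_sq_L2; first exact: measurable_funM.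
have := integrable_EFinZ mD (B ^+ 2) (L2_integrable_sq f2).
apply: integrable_EFin_le => //.
  apply: measurable_funM => //; apply: measurable_funX.
  exact: measurable_funM.
move=> x Dx.
have w0 := omega_ge0 Dx.
have h (a : R) : `|omega x * a ^+ 2| = omega x * a ^+ 2.
  by apply: ger0_norm; apply: mulr_ge0 => //; exact: sqr_ge0.
rewrite [leRHS]normrM !h ger0_norm ?sqr_ge0// exprMn mulrCA ler_wpM2r//.
  by apply: mulr_ge0 => //; exact: sqr_ge0.
have := bB _ Dx; rewrite -(real_normK (num_real (b x))) => bB'.
by rewrite ler_sqr ?nnegrE//; exact: le_trans bB'.
Qed.

Lemma L2Z c f : L2 f -> L2 (fun x => c * f x).
Proof.
by move=> f2; apply: (@L2_mulb (cst c) `|c|) => //; exact: measurable_cst.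
Qed.

Lemma L2B f g : L2 f -> L2 g -> L2 (fun x => f x - g x).
Proof.
move=> f2 g2; rewrite (_ : (fun x => _) = fun x => f x + (-1) * g x).
  by apply: L2D => //; exact: L2Z.
by apply/funext => x; rewrite mulN1r.
Qed.

Lemma L2_0 : L2 (cst 0).
Proof.
split; first exact: measurable_cst.
rewrite /Defs.sqnorm integral0_eq// => x _.
by rewrite expr0n mulr0.
Qed.

Lemma L2_sum n (f : 'I_n -> T -> R) : (forall i, L2 (f i)) ->
  L2 (fun x => \sum_(i < n) f i x).
Proof.
elim: n f => [|n IH] f Hf.
  rewrite (_ : (fun x => _) = cst 0); first exact: L2_0.
  by apply/funext => x; rewrite big_ord0.
rewrite (_ : (fun x => _) =
    fun x => f ord0 x + \sum_(i < n) f (lift ord0 i) x).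
  by apply: L2D => //; exact: IH.
by apply/funext => x; rewrite big_ord_recl.
Qed.

Lemma innerC f g : inner f g = inner g f.
Proof. by apply: eq_Rintegral => x _; rewrite mulrAC. Qed.

Lemma innerDl f g h : L2 f -> L2 g -> L2 h ->
  inner (fun x => f x + g x) h = inner f h + inner g h.
Proof.
move=> f2 g2 h2; rewrite -RintegralD//; [|exact: L2_integrableM..].
by apply: eq_Rintegral => x _; rewrite mulrDr mulrDl.
Qed.

Lemma innerZl c f h : L2 f -> L2 h ->
  inner (fun x => c * f x) h = c * inner f h.
Proof.
move=> f2 h2; rewrite -RintegralZl//; last exact: L2_integrableM.
by apply: eq_Rintegral => x _; ring.
Qed.

Lemma innerBl f g h : L2 f -> L2 g -> L2 h ->
  inner (fun x => f x - g x) h = inner f h - inner g h.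
Proof.
move=> f2 g2 h2; rewrite -RintegralB//; [|exact: L2_integrableM..].
by apply: eq_Rintegral => x _; rewrite mulrBr mulrBl.
Qed.

Lemma inner_ge0 f : 0 <= inner f f.
Proof.
apply: Rintegral_ge0 => x Dx.
by rewrite -mulrA -expr2 mulr_ge0 ?sqr_ge0 ?omega_ge0.
Qed.

Lemma sqnorm_inner f : L2 f -> sqnorm f = (inner f f)%:E.
Proof.
move=> f2; rewrite /Defs.inner /Rintegral fineK.
  by apply: eq_integral => x _; rewrite expr2 mulrA.
by apply: integrable_fin_num => //; exact: L2_integrableM.
Qed.

(** The quadratic polynomial t -> |f + t g|^2 is nonnegative. The form is only semidefinite, so a
    vanishing leading coefficient is treated separately. *)
Lemma inner_CS f g : L2 f -> L2 g ->
  inner f g ^+ 2 <= inner f f * inner g g.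
Proof.
move=> f2 g2.
have H t : 0 <= inner f f + 2 * t * inner f g + t ^+ 2 * inner g g.
  rewrite (_ : _ + _ = inner (fun x => f x + t * g x) (fun x => f x + t * g x)).
    exact: inner_ge0.
  have tg2 : L2 (fun x => t * g x) by exact: L2Z.
  have fg2 : L2 (fun x => f x + t * g x) by exact: L2D.
  rewrite (innerDl f2 tg2 fg2) (innerC f (fun x => _ + _)) (innerDl f2 tg2 f2).
  rewrite (innerZl t g2 fg2) (innerC g (fun x => _ + _)) (innerDl f2 tg2 g2).
  by rewrite !innerZl// (innerC g f); ring.
have := inner_ge0 g; rewrite le_eqVlt => /predU1P[g0|g0].
  have [->|/eqP fg0] := eqVneq (inner f g) 0.
    by rewrite expr0n/= mulr_ge0 ?inner_ge0.
  (* With [inner g g = 0] the polynomial is affine in t, and at this t it would take the value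
     -1. *)
  have := H (- (inner f f + 1) / (2 * inner f g)).
  rewrite -g0 mulr0 addr0.
  rewrite (_ : _ + _ = -1); first by move/eqP: fg0 => _; rewrite ler0N1.
  by field; exact/eqP.
(* The minimiser of the polynomial. *)
have := H (- (inner f g) / inner g g).
rewrite (_ : _ + _ = (inner f f * inner g g - inner f g ^+ 2) / inner g g).
  by rewrite pmulr_lge0 ?invr_gt0// subr_ge0.
by field; rewrite gt_eqF.
Qed.

(** Cauchy-Schwarz turns convergence in norm into convergence of pairings; this is how identities
    for smooth functions pass to the limit below. *)
Lemma inner_cvg (fk : nat -> T -> R) f g : (forall k, L2 (fk k)) -> L2 f ->
  L2 g -> sqnorm (fun x => f x - fk k x) @[k --> \oo] --> 0%E ->
  inner (fk k) g @[k --> \oo] --> inner f g.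
Proof.
move=> fk2 f2 g2 H.
have dk k : L2 (fun x => f x - fk k x) by exact: L2B.
apply/subr_cvg0; rewrite (_ : (fun k => _) =
    fun k => - inner (fun x => f x - fk k x) g); last first.
  by apply/funext => k; rewrite innerBl// opprB.
rewrite -oppr0; apply: cvgN; apply: norm_cvg0.
have H0 : inner (fun x => f x - fk k x) (fun x => f x - fk k x) * inner g g
    @[k --> \oo] --> (0 : R).
  rewrite -[0](mul0r (inner g g)); apply: cvgMl.
  rewrite (_ : (fun k => _) =
      fine \o (fun k => sqnorm (fun x => f x - fk k x))).
    exact: fine_cvg.
  by apply/funext => k /=; rewrite sqnorm_inner.
have := cvg_comp _ _ H0 (@sqrt_continuous R 0); rewrite sqrtr0.
apply: (@squeeze_cvgr _ _ _ _ (cst 0)); [|exact: cvg_cst].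
  near=> k; rewrite normr_ge0/= -sqrtr_sqr ler_wsqrtr//.
  exact: inner_CS.
Unshelve. all: by end_near. Qed.

End weighted_L2_theory.

(** * Fubini's theorem for real integrals over rectangles *)

Section Fubini_rectangle.
Context d1 d2 (T1 : measurableType d1) (T2 : measurableType d2) (R : realType).
Variables (m1 : {sigma_finite_measure set T1 -> \bar R})
  (m2 : {sigma_finite_measure set T2 -> \bar R}).
Variables (D1 : set T1) (D2 : set T2).
Hypotheses (mD1 : measurable D1) (mD2 : measurable D2).

(** An integrable function is finite almost everywhere. Iterated real integrals apply [fine] to each
    inner integral, which is thereby harmless. *)
Lemma integral_EFin_fine d (T : measurableType d)
    (mu : {measure set T -> \bar R}) (f : T -> \bar R) :
  mu.-integrable setT f ->
  (\int[mu]_x f x = \int[mu]_x (fine (f x))%:E)%E.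
Proof.
move=> fi; have mf := measurable_int _ fi.
apply: ae_eq_integral => //.
  by apply/measurable_EFinP; exact: measurableT_comp.
apply: filterS (integrable_ae measurableT fi) => x /(_ Logic.I) fx _.
by rewrite fineK.
Qed.

(** The modulus of an inner integral is at most the inner integral of the modulus, and the latter
    has a finite integral by Tonelli. *)
Lemma integrable_fubini_G (f : T1 * T2 -> \bar R) :
  (m1 \x m2)%E.-integrable setT f -> m2.-integrable setT (fubini_G m1 f).
Proof.
move=> fi; have mf := measurable_int _ fi.
apply/integrableP; split; first exact: measurable_fubini_G fi.
have foo := (integrable21ltyP m1 m2 mf).1 fi.
apply: (le_lt_trans _ foo).
apply: ge0_le_integral => //=.
- by apply: measurableT_comp => //; exact: measurable_fubini_G fi.
- apply: (measurable_fun_fubini_tonelli_G (abse \o f)) => //=.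
  exact: measurableT_comp.
- move=> y _; apply: le_abse_integral => //.
  exact: measurableT_comp.
Qed.

Section integrable_rectangle.
Variable f : T1 * T2 -> R.
Hypothesis fi : (m1 \x m2)%E.-integrable (D1 `*` D2) (EFin \o f).

Let g := (EFin \o f) \_ (D1 `*` D2).

Let gi : (m1 \x m2)%E.-integrable setT g.
Proof. by move: fi; rewrite integrable_mkcond//; exact: measurableX. Qed.

Let gE x y : g (x, y) =
  if (x \in D1) && (y \in D2) then (f (x, y))%:E else 0%E.
Proof.
rewrite /g patchE; congr (if _ then _ else _).
by apply/idP/andP; rewrite !inE.
Qed.

Lemma Rintegral_setX12 :
  \int[(m1 \x m2)%E]_(z in D1 `*` D2) f z =
  \int[m1]_(x in D1) \int[m2]_(y in D2) f (x, y).
Proof.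
rewrite {1}/Rintegral integral_mkcond -/g -integral12_prod_meas1//.
rewrite integral_EFin_fine; last exact: integrable_fubini_F.
rewrite [in RHS]Rintegral_mkcond /Rintegral; congr fine.
apply: eq_integral => x _; congr EFin; rewrite /fubini_F patchE.
have [xD|xD] := boolP (x \in D1).
  rewrite -/(Rintegral m2 D2 (fun y => f (x, y))) /Rintegral [in RHS]integral_mkcond.
  congr fine; apply: eq_integral => y _; rewrite gE xD patchE.
  by case: (y \in D2).
rewrite integral0_eq// => y _; by rewrite gE (negbTE xD).
Qed.

Lemma Rintegral_setX21 :
  \int[(m1 \x m2)%E]_(z in D1 `*` D2) f z =
  \int[m2]_(y in D2) \int[m1]_(x in D1) f (x, y).
Proof.
rewrite {1}/Rintegral integral_mkcond -/g -integral21_prod_meas1//.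
rewrite integral_EFin_fine; last exact: integrable_fubini_G.
rewrite [in RHS]Rintegral_mkcond /Rintegral; congr fine.
apply: eq_integral => y _; congr EFin; rewrite /fubini_G patchE.
have [yD|yD] := boolP (y \in D2).
  rewrite -/(Rintegral m1 D1 (fun x => f (x, y))) /Rintegral [in RHS]integral_mkcond.
  congr fine; apply: eq_integral => x _; rewrite gE yD andbT patchE.
  by case: (x \in D1).
rewrite integral0_eq// => x _; by rewrite gE (negbTE yD) andbF.
Qed.

End integrable_rectangle.

(** Tonelli's criterion on the whole product, applied to the integrand extended by zero off the
    rectangle. *)
Lemma integrable_setX12 (f : T1 * T2 -> R) :
  measurable_fun (D1 `*` D2) f ->
  (\int[m1]_(x in D1) \int[m2]_(y in D2) `|f (x, y)|%:E < +oo)%E ->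
  (m1 \x m2)%E.-integrable (D1 `*` D2) (EFin \o f).
Proof.
move=> mf foo; have mX : measurable (D1 `*` D2) by exact: measurableX.
rewrite integrable_mkcond//; apply/integrable12ltyP.
  by apply/(measurable_restrictT _ mX)/measurable_EFinP.
move: foo; rewrite [X in (X < _)%E -> _]integral_mkcond.
rewrite (eq_integral (fun x =>
    \int[m2]_y `|((EFin \o f) \_ (D1 `*` D2)) (x, y)|)%E)// => x _.
rewrite patchE; have [xD|xD] := boolP (x \in D1).
  rewrite integral_mkcond; apply: eq_integral => y _.
  rewrite !patchE; have [yD|yD] := boolP (y \in D2).
    by rewrite ifT//= inE; split; exact/set_mem.
  rewrite ifF ?abse0//; apply/negbTE; move: yD; rewrite !notin_setE.
  by move=> yD [].
rewrite integral0_eq// => y _; rewrite patchE ifF ?abse0//.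
by apply/negbTE; move: xD; rewrite !notin_setE => xD [].
Qed.

Lemma measurable_fun_fst_setX (f : T1 -> R) : measurable_fun D1 f ->
  measurable_fun (D1 `*` D2) (fun z => f z.1).
Proof.
move=> mf; apply: (measurable_comp mD1) => //; last exact: measurable_funTS.
by move=> _ [z [zD _]] <-.
Qed.

Lemma measurable_fun_snd_setX (f : T2 -> R) : measurable_fun D2 f ->
  measurable_fun (D1 `*` D2) (fun z => f z.2).
Proof.
move=> mf; apply: (measurable_comp mD2) => //; last exact: measurable_funTS.
by move=> _ [z [_ zD]] <-.
Qed.

Lemma integrable_setX_mul (f : T1 -> R) (g : T2 -> R) :
  m1.-integrable D1 (EFin \o f) -> m2.-integrable D2 (EFin \o g) ->
  (m1 \x m2)%E.-integrable (D1 `*` D2) (EFin \o (fun z => f z.1 * g z.2)).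
Proof.
move=> fi gi; apply: integrable_setX12.
  apply: measurable_funM.
  - apply: measurable_fun_fst_setX; exact: integrable_EFin_measurable fi.
  - apply: measurable_fun_snd_setX; exact: integrable_EFin_measurable gi.
have /integrableP[mf foo] := fi; have /integrableP[mg goo] := gi.
rewrite (eq_integral (fun x =>
    `|f x|%:E * \int[m2]_(y in D2) `|g y|%:E))%E; last first.
  move=> x _ /=; rewrite -ge0_integralZl//=.
  - by apply: eq_integral => y _; rewrite normrM EFinM.
  - by apply/measurable_EFinP/measurableT_comp => //; exact/measurable_EFinP.
rewrite ge0_integralZr//=.
- apply: lte_mul_pinfty => //; first exact: integral_ge0.
  by rewrite ge0_fin_numE//; exact: integral_ge0.
- by apply/measurable_EFinP/measurableT_comp => //; exact/measurable_EFinP.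
- exact: integral_ge0.
Qed.

End Fubini_rectangle.

(** * Open sets and continuous functions are measurable; sigma-finiteness of Lebesgue measure *)

Section measurable_topology.
Context {R : realType} (n : nat).
Local Notation V := 'rV[R]_n.
Local Notation W := (V * measurableTypeR R)%type.

(** The sigma-algebra is generated by the coordinates and the topology by the maximum norm. An open
    set is the union of the boxes with rational centre and radius 1/(k+1) that it contains, and
    there are countably many of them. *)
Lemma open_measurable_rVR (U : set (V * R)) :
  open U -> measurable (U : set W).
Proof.
move=> oU.
pose box (p : 'rV[rat]_n * rat * nat) : set W :=
  [set z : W | (forall i, `|z.1 ord0 i - ratr (p.1.1 ord0 i)| < p.2.+1%:R^-1) /\
    `|(z.2 : R) - ratr p.1.2| < p.2.+1%:R^-1].
have mbox p : measurable (box p).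
  rewrite (_ : box p = (\bigcap_(i in [set: 'I_n])
      [set x : V | `|x ord0 i - ratr (p.1.1 ord0 i)| < p.2.+1%:R^-1])
    `*` [set y : measurableTypeR R | `|(y : R) - ratr p.1.2| < p.2.+1%:R^-1]).
    have mabs (q c : R) : measurable [set y : measurableTypeR R |
        `|(y : R) - q| < c].
      rewrite (_ : [set _ | _] = [set` `]q - c, q + c[]); first exact: measurable_itv.
      by apply/seteqP; split => y /=; rewrite in_itv/= ltr_distl.
    apply: measurableX => //.
    apply: fin_bigcap_measurable => // i _.
    rewrite (_ : [set _ | _] = (fun x : V => x ord0 i) @^-1`
      [set y : measurableTypeR R |
        `|(y : R) - ratr (p.1.1 ord0 i)| < p.2.+1%:R^-1])//.
    rewrite -[X in measurable X]setTI.
    exact: (@measurable_coord R n i measurableT _ (mabs _ _)).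
  apply/seteqP; split => z /=; rewrite /box/=.
    by move=> [z1 z2]; split => // i _; exact: z1.
  by move=> [z1 z2]; split => // i; exact: z1.
pose F p := if `[< box p `<=` U >] then box p else set0.
suff -> : U = \bigcup_p F p.
  apply: countable_bigcupT_measurable => [|p]; first exact: countableP.
  by rewrite /F; case: ifP.
apply/seteqP; split; last first.
  by move=> z [p _]; rewrite /F; case: ifPn => // /asboolP; exact.
move=> z Uz; have /nbhs_ballP[e /= e0 eU] : nbhs z U by exact: open_nbhs_nbhs.
(* Two points of a box both lie within 1/(k+1) of its centre, hence less than e apart. *)
have [k ke] : exists k : nat, k.+1%:R^-1 < e / 2.
  have e2 : 0 < e / 2 by rewrite divr_gt0.
  exists (Num.truncn (e / 2)^-1).
  rewrite invf_plt ?posrE//.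
  exact: truncnS_gt.
have approx (y : R) : exists q : rat, `|y - ratr q| < k.+1%:R^-1.
  have := @rat_in_itvoo R (y - k.+1%:R^-1) (y + k.+1%:R^-1).
  case; first by rewrite ltrBlDr -addrA ltrDl addr_gt0.
  by move=> q; rewrite in_itv/= => qy; exists q; rewrite distrC ltr_distl.
have [q1 q1P] : exists q1 : 'rV[rat]_n,
    forall i, `|z.1 ord0 i - ratr (q1 ord0 i)| < k.+1%:R^-1.
  exists (\row_i projT1 (cid (approx (z.1 ord0 i)))) => i.
  by rewrite mxE; case: cid.
have [q2 q2P] := approx z.2.
exists (q1, q2, k) => //; rewrite /F ifT; first by split.
apply/asboolP => w [w1 w2]; apply: eU.
have tri (a b q : R) : `|a - q| < k.+1%:R^-1 -> `|b - q| < k.+1%:R^-1 ->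
    `|a - b| < e.
  move=> aq bq; rewrite (_ : a - b = (a - q) - (b - q)); last by ring.
  by apply: le_lt_trans (ler_normB _ _) _; rewrite (splitr e) ltrD//;
    [exact: lt_trans aq ke|exact: lt_trans bq ke].
split => /=.
- split => // i j; rewrite /ball/= ord1; apply: tri (w1 j); exact: q1P.
- exact: tri q2P w2.
Qed.

(** U is the section at y = 0 of the open set U * R, which reduces the claim to the product. *)
Lemma open_measurable_rV (U : set V) : open U -> measurable U.
Proof.
move=> oU; have /open_measurable_rVR : open (fst @^-1` U : set (V * R)).
  by apply: open_comp => // x _; exact: cvg_fst.
move/(measurable_ysection (0 : measurableTypeR R)).
rewrite (_ : ysection _ _ = U)//; apply/seteqP; split => x.
  by rewrite /ysection/= inE.
by move=> Ux; rewrite /ysection/= inE.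
Qed.

Lemma continuous_measurable_rVR (f : V * R -> R) : continuous f ->
  measurable_fun setT (f : W -> R).
Proof.
move=> /continuousP cf.
apply: (measurability _ (RGenOpens.measurableE R)) => _ [_ [a [b ->] <-]].
rewrite setTI; apply: open_measurable_rVR; apply: cf.
exact: interval_open.
Qed.

Lemma continuous_measurable_rV (f : V -> R) (D : set V) : measurable D ->
  {within D, continuous f} -> measurable_fun D f.
Proof.
move=> mD /continuousP cf.
apply: (measurability _ (RGenOpens.measurableE R)) => _ [_ [a [b ->] <-]].
have /open_subspaceP[U oU] := cf `]a, b[%classic ltac:(exact: interval_open).
rewrite setIC => UE; rewrite setIC -UE setIC.
by apply: measurableI => //; exact: open_measurable_rV.
Qed.

End measurable_topology.

Section lebesgue_rV_sigma_finite.
Context {R : realType}.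

Definition rV_box n (M : R) : set 'rV[R]_n :=
  [set x | forall i, `|x ord0 i| <= M].

Arguments rV_box : clear implicits.

Lemma measurable_rV_box n M : measurable (rV_box n M).
Proof.
rewrite (_ : rV_box n M = \bigcap_(i in [set: 'I_n])
    (fun x : 'rV[R]_n => x ord0 i) @^-1` `[- M, M]).
  apply: fin_bigcap_measurable => // i _.
  by rewrite -[X in measurable X]setTI; apply: measurable_coord.
apply/seteqP; split => x xM i //=; first by rewrite in_itv/= -ler_norml.
by have := xM i Logic.I; rewrite /= in_itv/= -ler_norml.
Qed.

Lemma preimage_rV_cons_box n M :
  @rV_cons R n @^-1` (rV_box n.+1 M) = rV_box n M `*` `[- M, M].
Proof.
apply/seteqP; split => [z zM|z [z1 z2]]; last first.
  move=> i; rewrite rV_consE; case: unliftP => [j _|_]; first exact: z1.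
  by move: z2; rewrite /= in_itv/= -ler_norml.
split; first by move=> i; have := zM (lift ord0 i); rewrite rV_consE liftK.
by have := zM ord0; rewrite rV_consE unlift_none /= in_itv/= -ler_norml.
Qed.

Lemma lebesgue_rV_box_lty n M : (lebesgue_rV R n (rV_box n M) < +oo)%E.
Proof.
elim: n => [|n IH] /=; first by rewrite diracE ltry.
rewrite /lebesgue_rV_step /pushforward preimage_rV_cons_box.
rewrite product_measure1E//; last exact: measurable_rV_box.
rewrite lte_mul_pinfty//.
  by rewrite ge0_fin_numE//; exact: IH.
suff : (@lebesgue_measure R `[(- M)%R, M]%classic < +oo)%E by [].
by rewrite lebesgue_measure_itv/=; case: ifP => _; rewrite ltry.
Qed.

Lemma bigcup_rV_box n : \bigcup_k rV_box n k%:R = setT.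
Proof.
apply/seteqP; split => // x _.
exists (Num.truncn (\sum_(i < n) `|x ord0 i|)).+1 => // i.
apply: le_trans (ltW (truncnS_gt _)).
by rewrite (bigD1 i)//= lerDl sumr_ge0.
Qed.

Lemma lebesgue_rV_sigma_finite n : sigma_finite setT (lebesgue_rV R n).
Proof.
exists (fun k => rV_box n k%:R); first by rewrite bigcup_rV_box.
by move=> k; split; [exact: measurable_rV_box|exact: lebesgue_rV_box_lty].
Qed.

(** The same measure bundled with its sigma-finiteness, as Fubini requires; the underlying function
    is unchanged, so integrals against it are convertible to those in the statement. *)
Definition leb n : {sigma_finite_measure set 'rV[R]_n -> \bar R} :=
  HB.pack_for {sigma_finite_measure set 'rV[R]_n -> \bar R}
    (Measure.sort (lebesgue_rV R n))
    (isSFinite.Build _ _ _ (Measure.sort (lebesgue_rV R n))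
      (sfinite_measure_sigma_finite (@lebesgue_rV_sigma_finite n)))
    (isSigmaFinite.Build _ _ _ (Measure.sort (lebesgue_rV R n))
      (@lebesgue_rV_sigma_finite n)).

Lemma Rintegral_leb n :
  Rintegral (lebesgue_rV R n) = Rintegral (leb n).
Proof. by []. Qed.

Lemma Rintegral_lebW n :
  Rintegral (@lebW R n) = Rintegral (leb n \x (@lebesgue_measure R))%E.
Proof. by []. Qed.

End lebesgue_rV_sigma_finite.
Arguments leb : clear implicits.
Arguments rV_box {R} n M.

(** * Directional derivatives and smooth functions of compact support *)

Section derive_affine.
Context {R : realType} {V W : normedModType R}.
Variables (l L : W -> V).
Hypothesis lL : forall h v x, l (h *: v + x) = h *: L v + l x.

Let quotientE (f : V -> R) x v :
  (fun h : R => h^-1 *: (((f \o l) \o shift x) (h *: v) - (f \o l) x)) =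
  (fun h : R => h^-1 *: ((f \o shift (l x)) (h *: L v) - f (l x))).
Proof. by apply/funext => h /=; rewrite lL. Qed.

(** The two difference quotients are the same function of h. Slices, lines and coordinate maps are
    all instances, with [L] the linear part of [l]. *)
Lemma derivable_affine (f : V -> R) x v :
  derivable (f \o l) x v = derivable f (l x) (L v).
Proof. by rewrite /derivable quotientE. Qed.

Lemma derive_affine (f : V -> R) x v : 'D_v (f \o l) x = 'D_(L v) f (l x).
Proof. by rewrite /derive quotientE. Qed.

End derive_affine.

Section derive_line.
Context {R : realType} {V : normedModType R}.
Variables (f : V -> R) (x v : V).

Let line (t : R) : V := t *: v + x.

Let lineP (h w t : R) : line (h *: w + t) = h *: (w *: v) + line t.
Proof. by rewrite /line scalerDl scalerA addrA. Qed.

Let line0 : line 0 = x. Proof. by rewrite /line scale0r add0r. Qed.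

Lemma derivable_line : derivable f x v = derivable (f \o line) (0 : R) (1 : R).
Proof. by rewrite (derivable_affine lineP) line0 scale1r. Qed.

Lemma derive_lineE : 'D_v f x = 'D_1 (f \o line) (0 : R).
Proof. by rewrite (derive_affine lineP) line0 scale1r. Qed.

End derive_line.

Section Ck_theory.
Context {R : realType}.
Implicit Types V : normedModType R.

Lemma Ck_continuous V k (f : V -> R) : Ck k f -> continuous f.
Proof. by case: k => [|k] []. Qed.

Lemma CkW V k (f : V -> R) : Ck k.+1 f -> Ck k f.
Proof.
elim: k f => [|k IH] f; first by case.
by move=> [cf df]; split => // v; have [df1 df2] := df v; split => //; exact: IH.
Qed.

Lemma Ck_cst V k (c : R) : Ck k (cst c : V -> R).
Proof.
elim: k c => [|k IH] c; first by split => //; exact: cst_continuous.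
split; first exact: cst_continuous.
move=> v; split; first by move=> x; exact: derivable_cst.
rewrite (_ : (fun x => _) = cst 0); first exact: IH.
by apply/funext => x; rewrite derive_cst.
Qed.

Lemma Ck_id k : Ck k (id : R -> R).
Proof.
case: k => [|k]; first by split => // x; exact: cvg_id.
split; first by move=> x; exact: cvg_id.
move=> v; split; first by move=> x; exact: derivable_id.
rewrite (_ : (fun x => _) = cst v); first exact: Ck_cst.
by apply/funext => x; rewrite derive_id.
Qed.

Lemma CkD V k (f g : V -> R) : Ck k f -> Ck k g -> Ck k (f + g).
Proof.
elim: k f g => [|k IH] f g [cf df] [cg dg].
  by split => // x; apply: continuousD; [exact: cf|exact: cg].
split; first by move=> x; apply: continuousD; [exact: cf|exact: cg].
move=> v; have [df1 df2] := df v; have [dg1 dg2] := dg v.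
split; first by move=> x; exact: derivableD.
rewrite (_ : (fun x => _) = (fun x => 'D_v f x) + (fun x => 'D_v g x)).
  exact: IH.
by apply/funext => x; rewrite deriveD.
Qed.

Lemma CkM V k (f g : V -> R) : Ck k f -> Ck k g -> Ck k (f * g).
Proof.
elim: k f g => [|k IH] f g.
  by move=> [cf df] [cg dg]; split => // x; apply: continuousM; [exact: cf|exact: cg].
move=> fk gk; have f1 := CkW fk; have g1 := CkW gk; move: fk gk.
move=> [cf df] [cg dg]; split; first by move=> x; apply: continuousM; [exact: cf|exact: cg].
move=> v; have [df1 df2] := df v; have [dg1 dg2] := dg v.
split; first by move=> x; exact: derivableM.
rewrite (_ : (fun x => _) =
    f * (fun x => 'D_v g x) + g * (fun x => 'D_v f x)).
  by apply: CkD; exact: IH.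
by apply/funext => x; rewrite deriveM.
Qed.

Lemma Ck_affine V (W : normedModType R) (l L : W -> V) k (f : V -> R) :
  (forall h v x, l (h *: v + x) = h *: L v + l x) -> continuous l ->
  Ck k f -> Ck k (f \o l).
Proof.
move=> lL cl; elim: k f => [|k IH] f [cf df].
  by split => // x; apply: continuous_comp; [exact: cl|exact: cf].
split; first by move=> x; apply: continuous_comp; [exact: cl|exact: cf].
move=> v; have [df1 df2] := df (L v); split.
  by move=> x; rewrite (derivable_affine lL).
rewrite (_ : (fun x => _) = (fun x => 'D_(L v) f x) \o l); first exact: IH.
by apply/funext => x /=; rewrite (derive_affine lL).
Qed.

(** Along a line the directional derivative is a one-variable derivative, and the chain rule gives
    ['D_v g] times [expR \o g], a product covered by [CkM] and the induction hypothesis. *)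
Lemma Ck_expR V k (g : V -> R) : Ck k g -> Ck k (expR \o g).
Proof.
have D (g' : V -> R) x v : (forall x v, derivable g' x v) ->
    derivable (expR \o g') x v /\ 'D_v (expR \o g') x = 'D_v g' x * expR (g' x).
  move=> dg.
  have dl : derivable (g' \o (fun t : R => t *: v + x)) (0 : R) 1.
    by rewrite -derivable_line.
  have e0 : (g' \o (fun t : R => t *: v + x)) 0 = g' x.
    by rewrite /= scale0r add0r.
  have := @is_derive1_comp R expR _ 0 _ _ (is_derive_expR _) (derivableP dl).
  rewrite e0 -derive_lineE => H; rewrite derivable_line [in LHS]derive_lineE.
  rewrite mulrC; split; first exact: @ex_derive _ _ _ _ _ _ _ H.
  exact: @derive_val _ _ _ _ _ _ _ H.
elim: k g => [|k IH] g.
  move=> [cg dg]; split => // x.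
  by apply: continuous_comp; [exact: cg|exact: continuous_expR].
move=> gk; have g1 := CkW gk; move: gk => [cg dg].
split => [x|v].
  by apply: continuous_comp; [exact: cg|exact: continuous_expR].
split; first by move=> x; apply: (proj1 (D g x v _)) => y w; exact: (proj1 (dg w)).
rewrite (_ : (fun x => _) = (fun x => 'D_v g x) * (expR \o g)).
  by apply: CkM; [exact: (proj2 (dg v))|exact: IH].
by apply/funext => x; rewrite (proj2 (D g x v _))// => y w; exact: (proj1 (dg w)).
Qed.

End Ck_theory.

Section Ccinfty_theory.
Context {R : realType}.
Implicit Types V : normedModType R.

Lemma Ccinfty_continuous V (D : set V) f : Ccinfty D f -> continuous f.
Proof. by move=> [/(_ 0%N)/Ck_continuous]. Qed.

Lemma Ccinfty_derivable V (D : set V) f x v : Ccinfty D f -> derivable f x v.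
Proof. by move=> [/(_ 1%N)[_ /(_ v)[]]]. Qed.

Lemma Ccinfty_out V (D : set V) f x : Ccinfty D f -> ~ D x -> f x = 0.
Proof. by move=> [_ [K [_ KD f0]]] Dx; apply: f0 => /KD. Qed.

Lemma Ccinfty_sub V (D D' : set V) : D `<=` D' -> Ccinfty D `<=` Ccinfty D'.
Proof.
move=> DD' f [fk [K [cK KD f0]]]; split => //.
by exists K; split => //; exact: subset_trans KD _.
Qed.

Lemma CcinftyMr V (D : set V) (f g : V -> R) : Ccinfty D f ->
  (forall k, Ck k g) -> Ccinfty D (f * g).
Proof.
move=> [fk [K [cK KD f0]]] gk; split; first by move=> k; exact: CkM.
exists K; split => // x Kx.
by rewrite [LHS](_ : _ = f x * g x)// f0// mul0r.
Qed.

Lemma Ccinfty_derive V (D : set V) (f : V -> R) v : Ccinfty D f ->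
  Ccinfty D (fun x => 'D_v f x).
Proof.
move=> [fk [K [cK KD f0]]]; split.
  by move=> k; have [_ /(_ v)[]] := fk k.+1.
exists K; split => // x Kx.
have oK : open (~` K).
  by apply: closed_openC; apply: compact_closed => //; exact: norm_hausdorff.
rewrite -(derive_cst (0 : R) x v); apply: near_eq_derive => //.
have : \forall z \near x, (~` K) z by exact: open_nbhs_nbhs.
by apply: filterS => z; exact: f0.
Qed.

Lemma Ccinfty_bounded V (D : set V) (f : V -> R) : Ccinfty D f ->
  exists2 B, 0 < B & forall x, `|f x| <= B.
Proof.
move=> fD; have cf := Ccinfty_continuous fD; have [fk [K [cK KD f0]]] := fD.
have : bounded_set (f @` K).
  apply: compact_bounded; apply: continuous_compact => //.
  exact: continuous_subspaceT.
move=> [M [Mr MB]]; exists (`|M| + 1); first by rewrite ltr_pwDr.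
move=> x; have [Kx|Kx] := pselect (K x); last first.
  by rewrite f0// normr0 addr_ge0.
apply: (MB (`|M| + 1)); last by exists x.
by rewrite (le_lt_trans (ler_norm _))// ltrDl.
Qed.

Lemma Ccinfty_support_bounded V (D : set V) (f : V -> R) : Ccinfty D f ->
  exists2 M, 0 < M & forall x, M < `|x| -> f x = 0.
Proof.
move=> [fk [K [cK KD f0]]].
have [M [Mr MB]] := compact_bounded cK.
exists (`|M| + 1); first by rewrite ltr_pwDr.
move=> x xM; apply: f0 => Kx; move: xM; rewrite ltNge => /negP; apply.
apply: (MB (`|M| + 1)) => //.
by rewrite (le_lt_trans (ler_norm _))// ltrDl.
Qed.

(** The projection of the support of F to the first factor is compact and serves for every y. *)
Lemma Ccinfty_slice V (D : set V) (F : V * R -> R) y :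
  Ccinfty (D `*` [set: R]) F -> Ccinfty D (fun x => F (x, y)).
Proof.
move=> [Fk [K [cK KD F0]]]; split.
  move=> k; apply: (@Ck_affine R _ _ (fun x => (x, y)) (fun v => (v, 0))) => //.
    move=> h v x; transitivity (h *: v + x, h *: (0 : R) + y) => //.
    by rewrite scaler0 add0r.
  move=> x; have yx : cst y z @[z --> x] --> y by exact: cvg_cst.
  exact: (cvg_pair (@cvg_id _ (nbhs x)) yx).
exists (fst @` K); split.
- apply: continuous_compact => //; apply: continuous_subspaceT => x.
  exact: cvg_fst.
- by move=> _ [z /KD[zD _] <-].
- by move=> x Kx; apply: F0 => Kxy; apply: Kx; exists (x, y).
Qed.

Lemma Ccinfty_tensor V (D : set V) (p : V -> R) (e : R -> R) :
  Ccinfty D p -> Ccinfty setT e ->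
  Ccinfty (D `*` [set: R]) (fun z => p z.1 * e z.2).
Proof.
move=> [pk [K [cK KD p0]]] [ek [K' [cK' KD' e0]]]; split.
  move=> k; apply: (@CkM R _ k (p \o fst) (e \o snd)).
    by apply: (@Ck_affine R _ _ fst fst) => // x; exact: cvg_fst.
  by apply: (@Ck_affine R _ _ snd snd) => // x; exact: cvg_snd.
exists (K `*` K'); split; [exact: compact_setX| |].
  by move=> z [/KD].
move=> [x y] /not_andP[]/= nK; first by rewrite p0// mul0r.
by rewrite e0// mulr0.
Qed.

End Ccinfty_theory.

(** * Integrals of derivatives over half-lines, lines and R^n *)

Lemma integrable_EFin_indic d (T : measurableType d) (R : realType)
    (mu : {measure set T -> \bar R}) (A : set T) :
  measurable A -> (mu A < +oo)%E ->
  mu.-integrable setT (EFin \o (\1_A : T -> R)).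
Proof.
move=> mA muA; apply/integrableP; split.
  exact/measurable_EFinP/measurable_indic.
rewrite (eq_integral (fun x => (\1_A x)%:E)); last first.
  by move=> t _; rewrite gee0_abs// lee_fin.
by rewrite integral_indic// setIT.
Qed.

Lemma ler_mx_coord {R : realType} m n (x : 'M[R]_(m, n)) i j :
  `|x i j| <= `|x|.
Proof.
by rewrite [leRHS]/Num.norm/= mx_normrE; apply/bigmax_geP; right; exists (i, j).
Qed.

Section half_line.
Context {R : realType}.
Local Notation mu := (@lebesgue_measure R).

Lemma derive_eq0 (V : normedModType R) (g : V -> R) (U : set V) x v :
  open U -> U x -> (forall z, U z -> g z = 0) -> 'D_v g x = 0.
Proof.
move=> oU Ux g0; rewrite -(derive_cst (0 : R) x v).
apply: near_eq_derive => //.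
have : \forall z \near x, U z by exact: open_nbhs_nbhs.
by apply: filterS => z /g0.
Qed.

Lemma Rintegral_derive_itv (g : R -> R) a b : a < b ->
  (forall x, derivable g x 1) -> continuous (fun x => 'D_1 g x) ->
  \int[mu]_(x in `[a, b]) 'D_1 g x = g b - g a.
Proof.
move=> ab dg cg; rewrite /Rintegral (@continuous_FTC2 _ _ g)//.
- exact: continuous_subspaceT.
- have gc x : {for x, continuous g}.
    exact/differentiable_continuous/derivable1_diffP.
  by split => //; [exact/cvg_at_right_filter/gc|exact/cvg_at_left_filter/gc].
- by move=> x _; rewrite derive1E.
Qed.

(** The fundamental theorem on [0, N] with N beyond the support; past N the derivative vanishes,
    since g is zero on the open set M < x. *)
Lemma Rintegral_derive_half (g : R -> R) M :
  (forall x, derivable g x 1) -> continuous (fun x => 'D_1 g x) ->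
  (forall x, M < x -> g x = 0) ->
  \int[mu]_(x in `]0, +oo[) 'D_1 g x = - g 0.
Proof.
move=> dg cg g0; pose N := `|M| + 1.
have N0 : 0 < N by rewrite ltr_pwDr.
have MN : M < N by rewrite (le_lt_trans (ler_norm M))// ltrDl.
have := Rintegral_derive_itv N0 dg cg; rewrite (g0 N MN) sub0r => <-.
have -> : \int[mu]_(x in `]0, +oo[) 'D_1 g x =
    \int[mu]_(x in `[0, +oo[) 'D_1 g x.
  rewrite /Rintegral integral_itv_obnd_cbnd//.
  apply/measurable_EFinP/measurable_funTS.
  exact: continuous_measurable_fun.
rewrite Rintegral_mkcond [RHS]Rintegral_mkcond; apply: eq_Rintegral => x _.
rewrite !patchE !mem_setE !in_itv/= andbT.
have [x0|//] := boolP (0 <= x); case: ifPn => //=; rewrite -ltNge => Nx.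
apply: (@derive_eq0 _ _ [set z | M < z]) => //.
exact: lt_trans MN Nx.
Qed.

Lemma Rintegral_derive_line (g : R -> R) M :
  (forall x, derivable g x 1) -> continuous (fun x => 'D_1 g x) ->
  (forall x, M < `|x| -> g x = 0) ->
  \int[mu]_x 'D_1 g x = 0.
Proof.
move=> dg cg g0; pose N := `|M| + 1.
have N0 : 0 < N by rewrite ltr_pwDr.
have MN : M < N by rewrite (le_lt_trans (ler_norm M))// ltrDl.
have NN : - N < N by rewrite (lt_trans _ N0)// oppr_lt0.
have := Rintegral_derive_itv NN dg cg.
rewrite !g0 ?normrN ?(ger0_norm (ltW N0))// subr0 => <-.
rewrite [RHS]Rintegral_mkcond; apply: eq_Rintegral => x _.
rewrite patchE mem_setE in_itv/= -ler_norml.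
case: ifPn => //=; rewrite -ltNge => Nx.
apply: (@derive_eq0 _ _ [set z | M < `|z|]) => //.
- apply: (@open_comp _ _ (fun z : R => `|z|) [set z | M < z]).
    by move=> z _; exact: norm_continuous.
  exact: (@open_gt R M).
- exact: lt_trans MN Nx.
Qed.

End half_line.

Section integral_derive_rV.
Context {R : realType}.
Local Notation mu := (@lebesgue_measure R).

Lemma lipschitz1_continuous_rV (V : normedModType R) n (l : V -> 'rV[R]_n) :
  (forall x y i, `|l x ord0 i - l y ord0 i| <= `|x - y|) -> continuous l.
Proof.
move=> ll x; apply/cvg_ballP => e e0.
near=> y; split => // i j; rewrite ord1 /ball/=.
apply: le_lt_trans (ll _ _ _) _.
near: y; have := @nbhsx_ballx _ V x e e0.
by apply: filterS => z; rewrite -ball_normE.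
Unshelve. all: by end_near. Qed.

Lemma rV_cons_affine n (p q : 'rV[R]_n) (h v t : R) :
  rV_cons (h *: q + p, h * v + t) = h *: rV_cons (q, v) + rV_cons (p, t).
Proof.
apply/rowP => i; rewrite rV_consE [RHS]mxE [X in _ = X + _]mxE !rV_consE.
by case: unlift => [j|] //=; rewrite !mxE.
Qed.

Lemma rV_cons_delta0 n : rV_cons (0, 1) = delta_mx ord0 ord0 :> 'rV[R]_n.+1.
Proof.
apply/rowP => i; rewrite rV_consE mxE eqxx/=.
by case: unliftP => [j|] ->; rewrite ?eqxx//= mxE.
Qed.

Lemma rV_cons_delta n (j : 'I_n) :
  rV_cons (delta_mx ord0 j, 0) = delta_mx ord0 (lift ord0 j) :> 'rV[R]_n.+1.
Proof.
apply/rowP => i; rewrite rV_consE mxE eqxx/=.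
case: unliftP => [k|] ->; last by rewrite (negbTE (neq_lift _ _)).
by rewrite mxE eqxx/= (inj_eq (@lift_inj _ _)).
Qed.

Lemma continuous_rV_cons1 n (p : 'rV[R]_n) :
  continuous (fun t : R => rV_cons (p, t)).
Proof.
apply: lipschitz1_continuous_rV => x y i; rewrite !rV_consE.
by case: unlift => [j|] //=; rewrite subrr normr0.
Qed.

Lemma continuous_rV_cons2 n (t : R) :
  continuous (fun p : 'rV[R]_n => rV_cons (p, t)).
Proof.
apply: lipschitz1_continuous_rV => x y i; rewrite !rV_consE.
case: unlift => [j|] //=; last by rewrite subrr normr0.
by have := ler_mx_coord (x - y) ord0 j; rewrite !mxE.
Qed.

(** By its recursive definition Lebesgue measure is an image under [rV_cons], so this is Fubini; a
    bounded F with support in a box is integrable. Both orders are kept because the variable of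
    differentiation may be the split-off coordinate or one of the others. *)
Lemma Rintegral_rV_cons n (F : 'rV[R]_n.+1 -> R) (M B : R) :
  measurable_fun setT F -> (forall x, `|F x| <= B) ->
  (forall (x : 'rV[R]_n.+1) i, M < `|x ord0 i| -> F x = 0) ->
  \int[leb R n.+1]_x F x = \int[leb R n]_p \int[mu]_t F (rV_cons (p, t)) /\
  \int[leb R n.+1]_x F x = \int[mu]_t \int[leb R n]_p F (rV_cons (p, t)).
Proof.
move=> mF FB F0.
have mFc : measurable_fun setT (fun z : 'rV[R]_n * measurableTypeR R =>
    F (rV_cons z)).
  exact: measurableT_comp mF (@measurable_rV_cons R n).
have iF : (leb R n \x mu)%E.-integrable ([set: 'rV[R]_n] `*` [set: measurableTypeR R])
    (EFin \o (fun z => F (rV_cons z))).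
  rewrite setXTT.
  have i1 : (leb R n).-integrable setT (EFin \o \1_(rV_box n M)).
    apply: integrable_EFin_indic => //; first exact: measurable_rV_box.
    exact: lebesgue_rV_box_lty.
  have i2 : mu.-integrable [set: R]
      (EFin \o (fun t => B * \1_(`[- M, M]%classic : set R) t)).
    apply: integrable_EFinZ => //.
    apply: integrable_EFin_indic => //.
    suff : (@lebesgue_measure R `[(- M)%R, M]%classic < +oo)%E by [].
    by rewrite lebesgue_measure_itv/=; case: ifP => _; rewrite ltry.
  have := integrable_setX_mul measurableT measurableT i1 i2; rewrite setXTT.
  apply: integrable_EFin_le => //.
  move=> [p t] _ /=; rewrite !indicE.
  have B0 : 0 <= B by exact: le_trans (FB 0).
  have [pM|pM] := boolP (p \in rV_box n M); last first.
    have [j Mj] : exists j, M < `|p ord0 j|.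
      apply: contrapT => /forallNP pM'; move/negP: pM; apply.
      by rewrite inE => j; rewrite leNgt; apply/negP/pM'.
    by rewrite (F0 _ (lift ord0 j)) ?normr0// rV_consE liftK.
  have [tM|tM] := boolP (t \in (`[- M, M]%classic : set R)).
    by rewrite !mulr1 mul1r (ger0_norm B0).
  rewrite (F0 _ ord0) ?normr0// rV_consE unlift_none/=.
  by move: tM; rewrite mem_setE in_itv/= -ler_norml -ltNge.
have -> : \int[leb R n.+1]_x F x =
    \int[(leb R n \x mu)%E]_(z in setT `*` setT) F (rV_cons z).
  rewrite /Rintegral setXTT; congr fine.
  apply: (@integral_pushforward _ _ _ _ _ _ (@measurable_rV_cons R n)
    (leb R n \x mu)%E setT (EFin \o F)) => //.
  - exact/measurable_EFinP.
  - by move: iF; rewrite setXTT preimage_setT.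
by split; [exact: Rintegral_setX12|exact: Rintegral_setX21].
Qed.

(** Induction on the dimension: if i is the split-off coordinate, the inner integral is that of a
    derivative on the line; otherwise the slice has one coordinate fewer. Applied to a product this
    is integration by parts. *)
Lemma Rintegral_derive_rV n (f : 'rV[R]_n -> R) (i : 'I_n) (M B : R) :
  (forall x, derivable f x (delta_mx ord0 i)) ->
  continuous (fun x => 'D_(delta_mx ord0 i) f x) ->
  (forall x, `|'D_(delta_mx ord0 i) f x| <= B) ->
  (forall (x : 'rV[R]_n) j, M < `|x ord0 j| -> f x = 0) ->
  \int[leb R n]_x 'D_(delta_mx ord0 i) f x = 0.
Proof.
elim: n f i => [|n IH] f i; first by case: i.
move=> df cf fB f0.
have D0 (x : 'rV[R]_n.+1) j : M < `|x ord0 j| -> 'D_(delta_mx ord0 i) f x = 0.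
  move=> Mj; apply: (@derive_eq0 _ _ _ [set z : 'rV[R]_n.+1 | M < `|z ord0 j|]) => //.
    apply: (@open_comp _ _ (fun z : 'rV[R]_n.+1 => `|z ord0 j|) [set z | M < z]).
      move=> z _; apply: (@continuous_comp _ _ _ (fun z : 'rV[R]_n.+1 => z ord0 j)
        (fun y : R => `|y|)); first exact: coord_continuous.
      exact: norm_continuous.
    exact: (@open_gt R M).
  by move=> z /f0.
have mD : measurable_fun setT (fun x => 'D_(delta_mx ord0 i) f x).
  by apply: continuous_measurable_rV => //; exact: continuous_subspaceT.
have [E12 E21] := Rintegral_rV_cons mD fB D0.
case: (unliftP ord0 i) => [j|] iE.
  rewrite E21 (_ : (fun t => _) = cst 0) ?Rintegral_cst ?mul0r//.
  apply/funext => t.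
  have ll (h : R) (v x : 'rV[R]_n) : rV_cons (h *: v + x, t) =
      h *: rV_cons (v, 0) + rV_cons (x, t).
    by rewrite -rV_cons_affine mulr0 add0r.
  have DE x : 'D_(delta_mx ord0 i) f (rV_cons (x, t)) =
      'D_(delta_mx ord0 j) (f \o (fun x => rV_cons (x, t))) x.
    by rewrite (derive_affine ll) rV_cons_delta iE.
  under eq_Rintegral do rewrite DE; apply: IH.
  - by move=> x; rewrite (derivable_affine ll) rV_cons_delta -iE.
  - rewrite (_ : (fun x => _) = (fun x => 'D_(delta_mx ord0 i) f x) \o
      (fun x => rV_cons (x, t))); last by apply/funext => x /=; rewrite DE.
    move=> x; apply: continuous_comp; last exact: cf.
    exact: continuous_rV_cons2.
  - by move=> x; rewrite -DE.
  - by move=> x k Mk; apply: (f0 _ (lift ord0 k)); rewrite rV_consE liftK.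
rewrite E12 (_ : (fun p => _) = cst 0) ?Rintegral_cst ?mul0r//.
apply/funext => p.
have ll (h : R) (v t : R) : rV_cons (p, h *: v + t) =
    h *: rV_cons (0, v) + rV_cons (p, t).
  by rewrite -rV_cons_affine scaler0 add0r.
have DE t : 'D_(delta_mx ord0 i) f (rV_cons (p, t)) =
    'D_1 (f \o (fun t => rV_cons (p, t))) t.
  by rewrite (derive_affine ll) rV_cons_delta0 iE.
under eq_Rintegral do rewrite DE; apply: (@Rintegral_derive_line _ _ M).
- by move=> x; rewrite (derivable_affine ll) rV_cons_delta0 -iE.
- rewrite (_ : (fun x => _) = (fun x => 'D_(delta_mx ord0 i) f x) \o
    (fun t => rV_cons (p, t))); last by apply/funext => x /=; rewrite DE.
  move=> x; apply: continuous_comp; last exact: cf.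
  exact: continuous_rV_cons1.
- by move=> t Mt; apply: (f0 _ ord0); rewrite rV_consE unlift_none.
Qed.

End integral_derive_rV.

(** * Integrability on the half-line and positivity of Gamma *)

Section half_line_integrals.
Context {R : realType}.
Local Notation mu := (@lebesgue_measure R).
Local Notation Rp := (`]0%R, +oo[%classic : set R).

(** Chosen so that t -> b / t maps the n-th interval for c = 1 onto the n-th interval for c = b. *)
Definition exhaust_itv (c : R) n : set R := `[c / n.+1%:R, c * n.+1%:R].

Lemma bigcup_exhaust_itv c : 0 < c -> \bigcup_n exhaust_itv c n = Rp.
Proof.
move=> c0; apply/seteqP; split => [t [n _]|t].
  rewrite /exhaust_itv/= !in_itv/= andbT => /andP[+ _]; apply: lt_le_trans.
  by rewrite divr_gt0.
rewrite /= in_itv/= andbT => t0.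
exists (maxn (Num.truncn (c / t)) (Num.truncn (t / c))) => //.
rewrite /exhaust_itv/= in_itv/= ler_pdivrMr// -ler_pdivrMl// -(ler_pdivrMl _ _ c0).
set m := maxn _ _; apply/andP; split.
  rewrite mulrC; apply: ltW; apply: lt_le_trans (truncnS_gt _) _.
  by rewrite ler_nat ltnS leq_maxl.
rewrite mulrC; apply: ltW; apply: lt_le_trans (truncnS_gt _) _.
by rewrite ler_nat ltnS leq_maxr.
Qed.

Lemma nondecreasing_exhaust_itv c : 0 < c -> nondecreasing_seq (exhaust_itv c).
Proof.
move=> c0 m n mn; apply/subsetPset => t; rewrite /exhaust_itv/= !in_itv/=.
move=> /andP[t1 t2]; apply/andP; split.
  apply: le_trans t1; rewrite ler_pM2l// lef_pV2 ?posrE// ler_nat ltnS//.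
by apply: (le_trans t2); rewrite ler_pM2l// ler_nat ltnS.
Qed.

Lemma cvg_integral_exhaust_itv c (f : R -> R) : 0 < c -> measurable_fun Rp f ->
  (forall t, 0 < t -> 0 <= f t) ->
  (\int[mu]_(t in exhaust_itv c n) (f t)%:E @[n --> \oo] -->
  \int[mu]_(t in Rp) (f t)%:E)%E.
Proof.
move=> c0 mf f0; rewrite -(bigcup_exhaust_itv c0).
apply: ge0_nondecreasing_set_cvg_integral.
- exact: nondecreasing_exhaust_itv.
- by move=> n; exact: measurable_itv.
- move=> n; apply/measurable_EFinP; apply: measurable_funS mf => //.
  by rewrite -(bigcup_exhaust_itv c0); exact: bigcup_sup.
- move=> n t Jt; rewrite lee_fin f0//.
  have : (\bigcup_n exhaust_itv c n) t by exists n.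
  by rewrite bigcup_exhaust_itv//= in_itv/= andbT.
Qed.

Lemma continuous_measurable_half (f : R -> R) :
  (forall t, 0 < t -> {for t, continuous f}) -> measurable_fun Rp f.
Proof.
move=> cf; apply: open_continuous_measurable_fun; first exact: interval_open.
by move=> t; rewrite inE/= in_itv/= andbT; exact: cf.
Qed.

(** By the fundamental theorem the integral of f over each interval of the exhaustion is a
    difference of two values of F, hence at most C; monotone convergence does the rest. *)
Lemma integrable_derive_bounded (f F : R -> R) (C : R) :
  (forall t, 0 < t -> 0 <= f t) ->
  (forall t, 0 < t -> {for t, continuous f}) ->
  (forall t : R, 0 < t -> is_derive t 1 F (f t)) ->
  (forall t, 0 < t -> 0 <= F t <= C) -> mu.-integrable Rp (EFin \o f).
Proof.
move=> f0 cf dF FC; have mf := continuous_measurable_half cf.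
apply/integrableP; split; first exact/measurable_EFinP.
apply: (le_lt_trans _ (ltry C)).
have -> : (\int[mu]_(x in Rp) `|(EFin \o f) x| =
    \int[mu]_(x in Rp) (f x)%:E)%E.
  apply: eq_integral => t; rewrite inE/= in_itv/= andbT => t0.
  by rewrite /= ger0_norm// f0.
have := cvg_integral_exhaust_itv ltr01 mf f0; set u := (X in X @ _) => cu.
rewrite -(cvg_lim _ cu)//; apply: lime_le.
  by apply/cvg_ex; eexists; exact: cu.
apply: nearW => n; rewrite /u /exhaust_itv !mul1r.
have pos t : t \in `[n.+1%:R^-1, n.+1%:R] -> 0 < t.
  by rewrite in_itv/= => /andP[+ _]; apply: lt_le_trans; rewrite invr_gt0.
(* The interval of index 0 is the single point 1, too small for the fundamental theorem. *)
case: n pos => [|n] pos; first by rewrite invr1 set_itv1 integral_set1 lee_fin;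
  have /andP[] := FC 1 ltr01; exact: le_trans.
have n1 : n.+2%:R^-1 < n.+2%:R :> R.
  by rewrite (@lt_trans _ _ 1)// ?invf_lt1 ?ltr1n.
rewrite (@continuous_FTC2 _ _ F)//.
- rewrite -EFinB lee_fin.
  have /andP[F1 _] := FC n.+2%:R^-1 ltac:(by rewrite invr_gt0).
  have /andP[_ F2] := FC n.+2%:R ltac:(by []).
  by rewrite (le_trans _ F2)// gerBl.
- apply: continuous_in_subspaceT => t; rewrite inE/= => /pos; exact: cf.
- have cF t : 0 < t -> {for t, continuous F}.
    move=> t0; apply/differentiable_continuous/derivable1_diffP.
    by have [] := dF t t0.
  split.
  + move=> t; rewrite in_itv/= => /andP[t1 t2].
    have t0 : 0 < t by apply: lt_trans t1; rewrite invr_gt0.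
    by have [] := dF t t0.
  + by apply/cvg_at_right_filter/cF; rewrite invr_gt0.
  + exact/cvg_at_left_filter/cF.
- move=> t; rewrite in_itv/= => /andP[t1 t2].
  rewrite derive1E; apply: derive_val; apply: dF.
  by apply: lt_trans t1; rewrite invr_gt0.
Qed.

Lemma continuous_powR_half (a t : R) : 0 < t ->
  {for t, continuous (fun t => t `^ a)}.
Proof.
move=> t0; apply/differentiable_continuous/derivable1_diffP.
by apply: derivable_powR; rewrite in_itv/= t0.
Qed.

(** The inequality ln x < x at x = (1 + t) c / m, multiplied by m; this is where the constant comes
    from. *)
Lemma powR_expR_bounded (m c : R) : 0 < m -> 0 < c ->
  exists2 C, 0 < C & forall t, 0 < t -> (1 + t) `^ m * expR (- (c * t)) <= C.
Proof.
move=> m0 c0; exists (expR (c - m * ln (c / m))); first exact: expR_gt0.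
move=> t t0; have t1 : 0 < 1 + t by rewrite addr_gt0.
rewrite /powR gt_eqF// -expRD ler_expR lerBrDl.
have cm0 : 0 < c / m by rewrite divr_gt0.
have := ln_sublinear (mulr_gt0 t1 cm0).
rewrite [in ln (_ * (c / m))]lnM ?posrE// => /ltW.
rewrite -(ler_pM2l m0) (_ : m * ((1 + t) * (c / m)) = c * (1 + t)); last first.
  by field; rewrite gt_eqF.
by move=> H; lra.
Qed.

(** With g(t) = t / (1 + t), the function (a + 1) g^a (1 + t)^(-2) has the antiderivative g^(a+1),
    which stays in [0, 1] because a > -1. It has the singularity t^a at the origin and serves as
    majorant. *)
Lemma integrable_powR_expR (a c : R) : -1 < a -> 0 < c ->
  mu.-integrable Rp (EFin \o (fun t => t `^ a * expR (- (c * t)))).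
Proof.
move=> a1 c0; have a10 : 0 < a + 1 by rewrite -ltrBlDr sub0r.
pose g (t : R) : R := t / (1 + t).
have g0 t : 0 < t -> 0 < g t by move=> t0; rewrite divr_gt0// addr_gt0.
have g1 t : 0 < t -> g t <= 1.
  by move=> t0; rewrite ler_pdivrMr ?addr_gt0// mul1r lerDr.
have dg (t : R) : 0 < t -> is_derive t 1 g ((1 + t) ^- 2).
  move=> t0; have t1 : 1 + t != 0 by rewrite gt_eqF// addr_gt0.
  have dV : is_derive t 1 (fun t : R => (1 + t)^-1) (- (1 + t) ^- 2 *: (0 + 1)).
    by apply: is_deriveV.
  have := is_deriveM (is_derive_id t 1) dV.
  rewrite (_ : _ + _ = (1 + t) ^- 2)// /GRing.scale/=.
  by field.
pose f (t : R) := (a + 1) * g t `^ a * (1 + t) ^- 2.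
have cg t : 0 < t -> {for t, continuous g}.
  move=> t0; apply/differentiable_continuous/derivable1_diffP.
  by have [] := dg t t0.
have fi : mu.-integrable Rp (EFin \o f).
  apply: (@integrable_derive_bounded _ (fun t => g t `^ (a + 1)) 1).
  - move=> t t0; rewrite !mulr_ge0 ?powR_ge0 ?ltW// invr_gt0 exprn_gt0//.
    by rewrite addr_gt0.
  - move=> t t0; apply: continuousM; first apply: continuousM.
    + exact: cst_continuous.
    + apply: (@continuous_comp _ _ _ g (fun x => x `^ a)); first exact: cg.
      by apply: continuous_powR_half; exact: g0.
    + apply: continuousV; first by rewrite expf_neq0// gt_eqF// addr_gt0.
      have c1 : {for t, continuous (fun t : R => 1 + t)}.
        by apply: continuousD; [exact: cst_continuous|exact: cvg_id].
      exact: (continuousM c1 c1).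
  - move=> t t0; have dP := @is_derive1_powR R (a + 1) _ (g0 _ t0).
    have := @is_derive1_comp R (fun x => x `^ (a + 1)) g t _ _ dP (dg t t0).
    rewrite (_ : _ * _ * _ = f t)//.
    by rewrite /f addrK.
  - move=> t t0; rewrite powR_ge0/=.
    apply: (@le_trans _ _ (1 `^ (a + 1))); last by rewrite powR1.
    by apply: ge0_ler_powR;
      rewrite ?nnegrE ?(ltW (g0 _ t0)) ?(ltW a10) ?g1.
have [C C0 CP] := @powR_expR_bounded (a + 2) c ltac:(lra) c0.
have := @integrable_EFinZ _ _ R mu Rp (measurable_itv _) (C / (a + 1)) f fi.
apply: integrable_EFin_le => //.
  apply: measurable_funM; first exact: measurable_funTS (measurable_powR _).
  apply: measurable_funTS; apply: measurableT_comp => //.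
  exact: measurableT_comp.
move=> t; rewrite /= in_itv/= andbT => t0; have t1 : 0 < 1 + t by rewrite addr_gt0.
(* The last factor, in parentheses, is bounded by the constant C obtained above. *)
have -> : t `^ a * expR (- (c * t)) =
    g t `^ a * (1 + t) ^- 2 * ((1 + t) `^ (a + 2) * expR (- (c * t))).
  rewrite /g powRM ?invr_ge0 ?ltW// -powR_inv1 ?ltW// powRAC.
  have -> : (1 + t) `^ (a + 2) = (1 + t) `^ a * (1 + t) ^+ 2.
    rewrite powRD ?powR_mulrn ?ltW//; apply/implyP => _.
    by rewrite gt_eqF.
  rewrite powR_inv1 ?powR_ge0//.
  have P1 : (1 + t) `^ a != 0 by rewrite powR_eq0 gt_eqF.
  have T1 : 1 + t != 0 by rewrite gt_eqF.
  by field; rewrite P1 T1.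
rewrite /f !normrM ![`|g t `^ a|]ger0_norm ?powR_ge0//.
rewrite (ger0_norm (ltW C0)) (ger0_norm (ltW a10)).
rewrite (_ : _ * _ * (_ * _ * _) =  g t `^ a * `|(1 + t) ^- 2| * C).
  rewrite ler_wpM2l// ?mulr_ge0 ?powR_ge0//.
  by rewrite -normrM ger0_norm ?mulr_ge0 ?powR_ge0 ?expR_ge0// CP.
by rewrite normfV (ger0_norm (ltW a10)); field; rewrite gt_eqF.
Qed.

(** Completing the square gives y <= r y^2 + 1/(4 r), which reduces the Gaussian to e^(-y). *)
Lemma integrable_powR_gauss (a r : R) : -1 < a -> 0 < r ->
  mu.-integrable Rp (EFin \o (fun y => y `^ a * expR (- (r * y ^+ 2)))).
Proof.
move=> a1 r0.
have := @integrable_EFinZ _ _ R mu Rp (measurable_itv _) (expR (4 * r)^-1) _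
  (integrable_powR_expR a1 ltr01).
apply: integrable_EFin_le => //.
  apply: measurable_funM; first exact: measurable_funTS (measurable_powR _).
  apply: measurable_funTS; apply: measurableT_comp => //.
  by apply: measurableT_comp => //; apply: measurable_funM => //;
     exact: measurable_funX.
move=> y _; rewrite [X in _ <= `|X|]mulrCA normrM [leRHS]normrM ler_wpM2l//.
rewrite -expRD !ger0_norm ?expR_ge0// ler_expR mul1r.
rewrite -subr_ge0 (_ : _ - _ = r * (y - (2 * r)^-1) ^+ 2).
  by rewrite mulr_ge0 ?sqr_ge0// ltW.
by field; rewrite gt_eqF.
Qed.

(** Were the integral zero, the strictly positive integrand would vanish almost everywhere, and the
    half-line would be a null set. *)
Lemma Gamma_gt0 (x : R) : 0 < x -> 0 < Gamma x.
Proof.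
move=> x0; rewrite lt_neqAle Rintegral_ge0 ?andbT; last first.
  by move=> t _; rewrite mulr_ge0 ?powR_ge0 ?expR_ge0.
have fi := @integrable_powR_expR (x - 1) 1 ltac:(lra) ltr01.
apply/negP => /eqP/esym G0.
have mf := measurable_int _ fi.
have : (\int[mu]_(t in Rp)
    `|(EFin \o (fun t => (t `^ (x - 1) * expR (- (1 * t)))%R)) t| = 0)%E.
  transitivity (\int[mu]_(t in Rp) (t `^ (x - 1) * expR (- t))%R%:E)%E.
    apply: eq_integral => t _ /=.
    by rewrite mul1r ger0_norm ?mulr_ge0 ?powR_ge0 ?expR_ge0.
  move: G0; rewrite /Gamma /Rintegral => /eqP; rewrite fine_eq0; first by move/eqP.
  apply: integrable_fin_num => //.
  by apply: eq_integrable fi => // t _ /=; rewrite mul1r.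
have mRp : measurable (Rp : set (measurableTypeR R)) by exact: measurable_itv.
move/(ae_eq_integral_abs mu mRp mf) => [N [mN N0 fN]].
have RpN : Rp `<=` N.
  move=> t Rt; apply: fN => /(_ Rt)/eqP; rewrite /= eqe.
  move: Rt; rewrite /= in_itv/= andbT => t0.
  by rewrite gt_eqF// mulr_gt0 ?expR_gt0// powR_gt0.
have : (mu Rp <= mu N)%E by apply: le_measure => //; rewrite inE//.
by rewrite N0 lebesgue_measure_itv/= ltry// leNgt addye// ltry.
Qed.

End half_line_integrals.

(** * The inversion t -> b / t and its effect on Bessel moments *)

Section inversion.
Context {R : realType}.
Local Notation mu := (@lebesgue_measure R).
Local Notation Rp := (`]0%R, +oo[%classic : set R).

(** Substitution on the compact intervals of the exhaustion, which the inversion matches index by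
    index, followed by monotone convergence on both sides. *)
Lemma integral_inversion (G : R -> R) b : 0 < b ->
  (forall t, 0 < t -> {for t, continuous G}) -> (forall t, 0 < t -> 0 <= G t) ->
  (\int[mu]_(t in Rp) (G t)%:E =
   \int[mu]_(t in Rp) (G (b / t) * (b / t ^+ 2))%:E)%E.
Proof.
move=> b0 cG G0; pose F (t : R) : R := b / t.
have dF (t : R) : 0 < t -> is_derive t 1 F (- (b / t ^+ 2)).
  move=> t0; have tN0 : t != 0 by rewrite gt_eqF.
  have dV : is_derive t 1 (fun t : R => t^-1) (- t ^- 2 *: 1).
    by apply: is_deriveV.
  have := is_deriveM (is_derive_cst b t 1) dV.
  by rewrite scaler0 addr0 /GRing.scale/= mulr1 mulrN.
have F'E t : 0 < t -> derive1 F t = - (b / t ^+ 2).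
  by move=> t0; rewrite derive1E; apply: derive_val; exact: dF.
have cg (t : R) : 0 < t -> {for t, continuous (fun t : R => b / t ^+ 2)}.
  move=> t0; apply: continuousM; first exact: cst_continuous.
  apply: continuousV; first by rewrite expf_neq0// gt_eqF.
  have ci : {for t, continuous (fun t : R => t)} by exact: cvg_id.
  exact: (continuousM ci ci).
have cF' t : 0 < t -> {for t, continuous (derive1 F)}.
  move=> t0; suff : derive1 F x @[x --> t] --> derive1 F t by [].
  rewrite (F'E _ t0).
  apply: (@cvg_trans _ ((fun t => - (b / t ^+ 2)) x @[x --> t])); last first.
    exact: (cvgN (cg _ t0)).
  apply: near_eq_cvg; near=> z; rewrite F'E//.
  by near: z; exact: lt_nbhsr.
have cF t : 0 < t -> {for t, continuous F}.
  move=> t0; apply/differentiable_continuous/derivable1_diffP.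
  by have [] := dF t t0.
have mG := continuous_measurable_half cG.
have Ft t : 0 < t -> 0 < F t by move=> t0; rewrite divr_gt0.
have cH t : 0 < t -> {for t, continuous (fun t => G (F t) * (b / t ^+ 2))}.
  move=> t0; apply: continuousM; last exact: cg.
  apply: (@continuous_comp _ _ _ F G); first exact: cF.
  exact/cG/Ft.
have mH := continuous_measurable_half cH.
have c1 := cvg_integral_exhaust_itv b0 mG G0.
have c2 : (\int[mu]_(t in exhaust_itv 1 n) (G (F t) * (b / t ^+ 2))%:E
    @[n --> \oo] --> \int[mu]_(t in Rp) (G (F t) * (b / t ^+ 2))%:E)%E.
  apply: cvg_integral_exhaust_itv => // t t0.
  by rewrite mulr_ge0 ?G0 ?Ft// divr_ge0 ?sqr_ge0// ltW.
suff E : (fun n => \int[mu]_(t in exhaust_itv b n) (G t)%:E)%E =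
    (fun n => \int[mu]_(t in exhaust_itv 1 n) (G (F t) * (b / t ^+ 2))%:E)%E.
  rewrite -(cvg_lim (@ereal_hausdorff R) c1) E.
  exact: (cvg_lim (@ereal_hausdorff R) c2).
apply/funext => n; rewrite /exhaust_itv !mul1r.
have n0 : 0 < n.+1%:R^-1 :> R by rewrite invr_gt0.
have pos t : t \in `[n.+1%:R^-1, n.+1%:R] -> 0 < t :> R.
  by rewrite in_itv/= => /andP[+ _]; exact: lt_le_trans.
have poso t : t \in `]n.+1%:R^-1, n.+1%:R[ -> 0 < t :> R.
  by rewrite in_itv/= => /andP[+ _]; exact: lt_trans.
rewrite (_ : b * n.+1%:R = F n.+1%:R^-1); last by rewrite /F invrK.
rewrite -/(F n.+1%:R) integration_by_substitution_decreasing.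
- apply: eq_integral => t; rewrite inE/= => /pos t0; congr EFin.
  by rewrite [LHS](_ : _ = G (F t) * - (derive1 F) t)// F'E// opprK.
- by rewrite (@le_trans _ _ 1)// ?invf_le1 ?ler1n.
- move=> x y /pos x0 /pos y0 xy; rewrite /F ltr_pM2l//.
  by rewrite ltf_pV2 ?posrE.
- by move=> t /poso; exact: cF'.
- apply/cvg_ex; exists (derive1 F n.+1%:R^-1).
  exact/cvg_at_right_filter/cF'.
- apply/cvg_ex; exists (derive1 F n.+1%:R).
  exact/cvg_at_left_filter/cF'.
- split.
  + by move=> t /poso t0; have [] := dF t t0.
  + exact/cvg_at_right_filter/cF.
  + exact/cvg_at_left_filter/cF.
- apply: continuous_in_subspaceT => t; rewrite inE/= in_itv/= => /andP[t1 _].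
  by apply: cG; apply: lt_le_trans t1; exact: Ft.
Unshelve. all: by end_near. Qed.

(** For b = c y^2 the last factor is [gauss (c / t) y]; the others are the density against which the
    Gaussians are superposed. *)
Definition mixing (p b t : R) : R := t `^ p * expR (- t) * expR (- (b / t)).

(* A modified Bessel function: [bessel p b = 2 b^((p+1)/2) K_(p+1)(2 sqrt b)] *)
Definition bessel (p b : R) : R := \int[mu]_(t in Rp) mixing p b t.

Lemma mixing_ge0 p b t : 0 <= mixing p b t.
Proof. by rewrite !mulr_ge0 ?powR_ge0 ?expR_ge0. Qed.

Lemma measurable_mixing d (T : measurableType d) (D : set T) p
    (b t : T -> R) : measurable D -> (forall x, D x -> 0 < t x) ->
  measurable_fun D b -> measurable_fun D t ->
  measurable_fun D (fun x => mixing p (b x) (t x)).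
Proof.
move=> mD t0 mb mt; apply: (@eq_measurable_fun _ _ _ _ D (fun x =>
    t x `^ p * expR (- t x) * expR (- (b x * t x `^ (-1))))).
  by move=> x /set_mem/t0 tx; rewrite /mixing powR_inv1// ltW.
have mpow q : measurable_fun D (fun x => t x `^ q).
  exact: measurableT_comp (measurable_powR q) mt.
apply: measurable_funM; first apply: measurable_funM => //.
  by apply: measurableT_comp => //; exact: measurableT_comp.
apply: measurableT_comp => //; apply: measurableT_comp => //.
exact: measurable_funM.
Qed.

(** The inversion exchanges e^(-t) and e^(-b/t); it expresses the symmetry of K_nu in its order nu.
    In extended reals the identity transfers finiteness as well as values. *)
Lemma bessel_inversion p b : 0 < b ->
  (\int[mu]_(t in Rp) (mixing (- p - 2) b t)%:E =
   (b `^ (- p - 1))%:E * \int[mu]_(t in Rp) (mixing p b t)%:E)%E.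
Proof.
move=> b0.
have cm r t : 0 < t -> {for t, continuous (mixing r b)}.
  move=> t0; have tN0 : t != 0 by rewrite gt_eqF.
  apply: continuousM; first apply: continuousM.
  - exact: continuous_powR_half.
  - by apply: continuous_comp; [exact: continuousN|exact: continuous_expR].
  - have cV : {for t, continuous (fun t : R => - (b / t))}.
      apply: continuousN; apply: continuousM; first exact: cst_continuous.
      exact: inv_continuous.
    exact: (continuous_comp cV (@continuous_expR R _)).
rewrite (@integral_inversion _ b)//; last 2 first.
- by move=> t; exact: cm.
- by move=> t _; exact: mixing_ge0.
rewrite -ge0_integralZl//=.
- apply: eq_integral => t; rewrite inE/= in_itv/= andbT => t0.
  rewrite -EFinM; congr EFin; rewrite /mixing.
  have tN0 : t != 0 by rewrite gt_eqF.
  have bN0 : b != 0 by rewrite gt_eqF.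
  have -> : b / (b / t) = t by field; rewrite tN0 bN0.
  rewrite -(powR_mulrn 2 (ltW t0)).
  rewrite powRM ?invr_ge0 ?ltW// -[t^-1]powR_inv1 ?ltW// -powRrM.
  rewrite mulN1r (_ : - (- p - 2) = p + 2); last by ring.
  have -> : t `^ (p + 2) = t `^ p * t `^ 2%:R.
    by rewrite powRD//; apply/implyP.
  have -> : b `^ (- p - 1) = b `^ (- p - 2) * b.
    rewrite -{3}(powRr1 (ltW b0)) -powRD; last by apply/implyP.
    by congr (_ `^ _); ring.
  have t2 : t `^ 2%:R != 0 by rewrite gt_eqF// powR_gt0.
  by field.
- apply/measurable_EFinP.
  by apply: (@continuous_measurable_half _ (mixing p b)) => t; exact: cm.
- by move=> t _; rewrite lee_fin mixing_ge0.
- by rewrite lee_fin powR_ge0.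
Qed.

Lemma bessel_inv p b : 0 < b ->
  bessel (- p - 2) b = b `^ (- p - 1) * bessel p b.
Proof.
move=> b0; rewrite /bessel /Rintegral bessel_inversion//.
have [fn|] := boolP (\int[mu]_(t in Rp) (mixing p b t)%:E \is a fin_num)%E.
  by rewrite fineM.
(* If the moment is infinite then so is its multiple, and [fine] sends both to 0. *)
rewrite ge0_fin_numE; last by apply: integral_ge0 => t _; rewrite lee_fin mixing_ge0.
rewrite -leNgt leye_eq => /eqP ->.
by rewrite gt0_muley ?lte_fin ?powR_gt0//= mulr0.
Qed.

Lemma integrable_mixing_bound p : -1 < p ->
  mu.-integrable Rp (EFin \o (fun t => t `^ p * expR (- (2^-1 * t)))).
Proof. by move=> p1; apply: integrable_powR_expR => //; rewrite invr_gt0. Qed.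

(** The arithmetic-geometric inequality t/2 + (k y)^2/(2 t) >= k y. One half of t is spent on decay
    in y; the other half keeps the bound integrable in t. *)
Lemma mixing_le p k y t : 0 < t -> 
  mixing p (k ^+ 2 / 2 * y ^+ 2) t <=
  expR (- (k * y)) * (t `^ p * expR (- (2^-1 * t))).
Proof.
move=> t0; rewrite /mixing -mulrA [leRHS]mulrCA ler_wpM2l ?powR_ge0//.
rewrite -!expRD ler_expR -subr_ge0.
rewrite (_ : _ - _ = (t - k * y) ^+ 2 / (2 * t)); last by field; rewrite gt_eqF.
by rewrite divr_ge0 ?sqr_ge0// mulr_ge0 ?ltW.
Qed.

End inversion.

(** * Pairings along approximating sequences *)

Section H1_convergence.
Context {d : measure_display} {T : measurableType d} {R : realType} {n : nat}.
Variables (mu : {measure set T -> \bar R}) (D : set T) (omega : T -> R).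
Variables (test core : set (T -> R)) (pd : 'I_n -> (T -> R) -> (T -> R)).
Hypothesis mD : measurable D.
Hypothesis momega : measurable_fun D omega.
Hypothesis omega_ge0 : forall x, D x -> 0 <= omega x.
Hypothesis coreL2 : forall f, core f -> L2 mu D omega f.
Hypothesis core_pdL2 : forall f i, core f -> L2 mu D omega (pd i f).
Variables (w : T -> R) (g : T -> 'rV[R]_n) (phi : nat -> T -> R).
Hypothesis wL2 : L2 mu D omega w.
Hypothesis gL2 : forall i, L2 mu D omega (fun x => g x ord0 i).
Hypothesis wphi : H1approx mu D omega core pd w g phi.

Let sqnorm_ge0 f : (0 <= sqnorm mu D omega f)%E.
Proof.
by apply: integral_ge0 => x Dx; rewrite lee_fin mulr_ge0 ?sqr_ge0 ?omega_ge0.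
Qed.

Lemma H1approx_inner G : L2 mu D omega G ->
  inner mu D omega (phi k) G @[k --> \oo] --> inner mu D omega w G.
Proof.
move=> G2; have [cphi phi0] := wphi.
apply: (inner_cvg mD momega omega_ge0) => //; first by move=> k; exact: coreL2.
apply: (@squeeze_cvge _ _ _ _ (cst 0%E)) phi0; last exact: cvg_cst.
by apply: nearW => k; rewrite sqnorm_ge0/= leeDl// sume_ge0.
Qed.

Lemma H1approx_inner_pd i G : L2 mu D omega G ->
  inner mu D omega (pd i (phi k)) G @[k --> \oo] -->
  inner mu D omega (fun x => g x ord0 i) G.
Proof.
move=> G2; have [cphi phi0] := wphi.
apply: (inner_cvg mD momega omega_ge0) => //; first by move=> k; exact: core_pdL2.
apply: (@squeeze_cvge _ _ _ _ (cst 0%E)) phi0; last exact: cvg_cst.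
apply: nearW => k; rewrite sqnorm_ge0/= /H1sqnorm (bigD1 i)//=.
set X := sqnorm _ _ _ _; set Y := sqnorm _ _ _ (fun x => _ _ i).
have -> : X = Y by congr sqnorm; apply/funext => x; rewrite !mxE.
by rewrite addeCA leeDl// adde_ge0// sume_ge0.
Qed.

End H1_convergence.

(** * Gaussians and the weighted L^2 space of the cylinder *)

Section gauss.
Context {R : realType}.
Variable r : R.

Definition gauss (y : R) : R := expR (- (r * y ^+ 2)).

Lemma Ck_gauss k : Ck k gauss.
Proof.
suff : Ck k (fun y : R => - (r * y ^+ 2)) by move/Ck_expR.
rewrite (_ : (fun y => _) = (cst (- r) : R -> R) * ((id : R -> R) * (id : R -> R))).
  by apply: CkM; [exact: Ck_cst|apply: CkM; exact: Ck_id].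
by apply/funext => y; rewrite -mulNr.
Qed.

Lemma derive_gauss y : 'D_1 gauss y = - (2 * r * y) * gauss y.
Proof.
have d2 : is_derive y 1 (fun y : R => - (r * y ^+ 2)) (- (2 * r * y)).
  have H := is_deriveM (is_derive_id y 1) (is_derive_id y 1).
  have := is_deriveM (is_derive_cst (- r) y 1) H.
  rewrite (_ : _ * _ = fun y : R => - (r * y ^+ 2)); last first.
    by apply/funext => z; rewrite -mulNr.
  rewrite (_ : _ + _ = - (2 * r * y))// /GRing.scale/=.
  by ring.
have := @is_derive1_comp R expR _ y _ _ (is_derive_expR _) d2.
by move=> H; rewrite (@derive_val _ _ _ _ _ _ _ H) mulrC.
Qed.

Lemma gauss_gt0 y : 0 < gauss y. Proof. exact: expR_gt0. Qed.

Lemma measurable_gauss : measurable_fun setT gauss.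
Proof. by apply: continuous_measurable_fun; exact: Ck_continuous (Ck_gauss 0). Qed.

End gauss.

Section cylinder.
Context {R : realType} {n : nat}.
Variables (Omega : set 'rV[R]_n) (s : R).
Hypothesis mOmega : measurable Omega.
Hypothesis bOmega : exists2 M, 0 < M & forall x, Omega x -> `|x| <= M.
Hypothesis s01 : 0 < s < 1.
Local Notation V := 'rV[R]_n.
Local Notation W := (V * measurableTypeR R)%type.
Local Notation mu := (@lebesgue_measure R).
Local Notation Rp := (`]0%R, +oo[%classic : set (measurableTypeR R)).
Local Notation C := (cylinder Omega).
Local Notation "'|x|^a'" := (fun y : R => y `^ alpha s).
Local Notation L2y := (L2 mu Rp (fun y => y `^ alpha s)).
Local Notation L2w := (L2 lebW C (@weight R n s)).

Lemma cylinderE : C = Omega `*` Rp.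
Proof.
by apply/seteqP; split => -[x y]; rewrite /cylinder/= in_itv/= andbT => -[].
Qed.

Lemma measurable_half : measurable Rp.
Proof. exact: measurable_itv. Qed.
Hint Resolve measurable_half : core.

Lemma measurable_cylinder : measurable C.
Proof. by rewrite cylinderE; exact: measurableX. Qed.
Hint Resolve measurable_cylinder : core.

Lemma measurable_weight : measurable_fun C (@weight R n s).
Proof.
by apply: measurable_funTS; apply: measurableT_comp (measurable_powR _) _.
Qed.
Hint Resolve measurable_weight : core.

Lemma weight_ge0 z : C z -> 0 <= weight s z.
Proof. by move=> _; exact: powR_ge0. Qed.

Lemma alpha_bounds : -1 < alpha s < 1.
Proof.
by move: s01 => /andP[s0 s1]; rewrite /alpha; apply/andP; split; lra.
Qed.

Lemma Rintegral_cylinder12 (F : W -> R) : lebW.-integrable C (EFin \o F) ->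
  \int[lebW]_(z in C) F z = \int[leb R n]_(x in Omega) \int[mu]_(y in Rp) F (x, y).
Proof.
by rewrite cylinderE => iF; rewrite Rintegral_lebW Rintegral_setX12.
Qed.

Lemma Rintegral_cylinder21 (F : W -> R) : lebW.-integrable C (EFin \o F) ->
  \int[lebW]_(z in C) F z = \int[mu]_(y in Rp) \int[leb R n]_(x in Omega) F (x, y).
Proof.
by rewrite cylinderE => iF; rewrite Rintegral_lebW Rintegral_setX21.
Qed.

Lemma L2_tensor (h : V -> R) (e : R -> R) : L2Omega Omega h -> L2y e ->
  L2w (fun z => h z.1 * e z.2).
Proof.
move=> h2 e2; apply: (integrable_sq_L2 measurable_cylinder measurable_weight
  weight_ge0).
  rewrite cylinderE; apply: measurable_funM.
    by apply: measurable_fun_fst_setX => //; exact: (proj1 h2).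
  by apply: measurable_fun_snd_setX => //; exact: (proj1 e2).
have hi := L2_integrable_sq (measurable_cst _) (fun _ _ => ler01) h2.
have me : measurable_fun Rp (fun y : measurableTypeR R => y `^ alpha s).
  exact: measurable_funTS (measurable_powR _).
have ei := L2_integrable_sq me (fun y _ => powR_ge0 y _) e2.
have := @integrable_setX_mul _ _ _ _ _ (leb R n) mu _ _ mOmega measurable_half
  _ _ hi ei.
rewrite -cylinderE; apply: eq_integrable => // z _ /=; congr EFin.
by rewrite /weight; ring.
Qed.

Lemma L2_half_expR c : 0 < c -> L2y (fun y => expR (- (c * y))).
Proof.
move=> c0; apply: integrable_sq_L2 => //.
- exact: measurable_funTS (measurable_powR _).
- by move=> y _; exact: powR_ge0.
- by apply: measurable_funTS; apply: measurableT_comp => //; exact: measurableT_comp.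
have /andP[a1 _] := alpha_bounds.
have := @integrable_powR_expR R (alpha s) (2 * c) a1 ltac:(by rewrite mulr_gt0).
apply: eq_integrable => // y _ /=; congr (_ * _)%:E.
by rewrite expr2 -expRD; congr expR; ring.
Qed.

(** Square times weight is y^(2b + alpha) e^(-2 r y^2); the condition on b is integrability at the
    origin. *)
Lemma L2_half_gauss b r : -1 < 2 * b + alpha s -> 0 < r ->
  L2y (fun y => y `^ b * gauss r y).
Proof.
move=> ba r0; apply: integrable_sq_L2 => //.
- exact: measurable_funTS (measurable_powR _).
- by move=> y _; exact: powR_ge0.
- apply: measurable_funTS; apply: measurable_funM; first exact: measurable_powR.
  exact: measurable_gauss.
have := @integrable_powR_gauss R (2 * b + alpha s) (2 * r) ba ltac:(by rewrite mulr_gt0).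
apply: eq_integrable => // y; rewrite inE/= in_itv/= andbT => y0.
have -> : y `^ (2 * b + alpha s) = y `^ alpha s * y `^ b * y `^ b.
  rewrite -!powRD ?(gt_eqF y0) ?implybT//; congr (_ `^ _); ring.
have E2 : expR (- (2 * r * y ^+ 2)) = gauss r y * gauss r y.
  by rewrite -expRD; congr expR; ring.
by congr EFin; rewrite /= E2; ring.
Qed.

Lemma L2Omega_bounded (h : V -> R) B : measurable_fun Omega h ->
  (forall x, Omega x -> `|h x| <= B) -> L2Omega Omega h.
Proof.
move=> mh hB; have [M M0 OM] := bOmega.
have i1 : (leb R n).-integrable Omega (EFin \o cst (B ^+ 2)).
  have := integrable_EFin_indic (@measurable_rV_box R n M) (@lebesgue_rV_box_lty R n M).
  move=> /(integrableS measurableT mOmega (@subsetT _ _)) iM.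
  have := integrable_EFinZ mOmega (B ^+ 2) iM.
  apply: eq_integrable => // x /set_mem Ox /=; congr EFin.
  rewrite indicE mem_set ?mulr1// => i.
  exact: le_trans (ler_mx_coord _ _ _) (OM _ Ox).
apply: integrable_sq_L2 => //; apply: integrable_EFin_le i1 => //.
  by apply: measurable_funM => //; exact: measurable_funX.
move=> x Ox; rewrite mul1r !ger0_norm ?sqr_ge0//.
rewrite -(real_normK (num_real (h x))) ler_sqr ?nnegrE ?hB//.
exact: le_trans (hB _ Ox).
Qed.

(** These functions may be nonzero down to y = 0, where alpha > -1 makes the weight integrable. On
    the support y <= M, so B e^(M-y) is a majorant. *)
Lemma Ccinfty_L2w (F : V * R -> R) :
  Ccinfty (Omega `*` [set: R]) F -> L2w F.
Proof.
move=> cF; have [B B0 FB] := Ccinfty_bounded cF.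
have [M M0 FM] := Ccinfty_support_bounded cF.
have c1 : L2Omega Omega (cst B).
  by apply: (@L2Omega_bounded _ `|B|) => //; exact: measurable_cst.
have e2 : L2y (fun y => expR M * expR (- (1 * y))).
  apply: L2Z; [exact: measurable_half| |by move=> y _; exact: powR_ge0|].
    exact: measurable_funTS (measurable_powR _).
  exact: L2_half_expR.
apply: (L2_le measurable_cylinder measurable_weight weight_ge0 _ (L2_tensor c1 e2)).
  apply: measurable_funTS; apply: continuous_measurable_rVR.
  exact: Ccinfty_continuous cF.
move=> [x y] [/= Ox y0].
have [yM|yM] := ltP M y.
  rewrite FM ?normr0//; apply: (lt_le_trans yM).
  rewrite [leRHS]prod_normE le_max; apply/orP; right.
  exact: ler_norm.
apply: le_trans (FB _) _.
rewrite -expRD ger0_norm ?mulr_ge0 ?expR_ge0 ?(ltW B0)//.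
rewrite ler_peMr ?(ltW B0)// mul1r (le_trans _ (expR_ge1Dx _))//.
by rewrite lerDl subr_ge0.
Qed.

End cylinder.

Lemma cvg_Rintegral_dominated d (T : measurableType d) (R : realType)
    (mu : {measure set T -> \bar R}) (D : set T) (fk : nat -> T -> R)
    (f g : T -> R) : measurable D -> (forall k, measurable_fun D (fk k)) ->
  measurable_fun D f -> (forall x, D x -> fk k x @[k --> \oo] --> f x) ->
  mu.-integrable D (EFin \o g) -> (forall k x, D x -> `|fk k x| <= g x) ->
  \int[mu]_(x in D) fk k x @[k --> \oo] --> \int[mu]_(x in D) f x.
Proof.
move=> mD mfk mf fkf gi fg.
have mfk' k : measurable_fun D (EFin \o fk k) by exact/measurable_EFinP.
have mf' : measurable_fun D (EFin \o f) by exact/measurable_EFinP.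
have cv : {ae mu, forall x, D x ->
    (EFin \o fk k) x @[k --> \oo] --> (EFin \o f) x}.
  apply: aeW => x Dx; apply: cvg_EFin; first exact: nearW.
  exact: fkf.
have bd : {ae mu, forall x k, D x -> (`|(EFin \o fk k) x| <= (EFin \o g) x)%E}.
  by apply: aeW => x k Dx; rewrite lee_fin fg.
have [fi _ H] := dominated_convergence mD mfk' mf' cv gi bd.
apply: fine_cvg; rewrite /Rintegral fineK; first exact: H.
exact: integrable_fin_num.
Qed.

(** * Slices of functions on the cylinder and their derivatives *)

Section slices.
Context {R : realType} {V : normedModType R}.

Lemma derive_snd_slice (F : V * R -> R) x y :
  'D_(0, 1) F (x, y) = 'D_1 (fun y => F (x, y)) y.
Proof.
have l h (v t : R) : (x, h *: v + t) = h *: ((0, v) : V * R) + (x, t).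
  have -> : h *: ((0, v) : V * R) + (x, t) = (h *: 0 + x, h *: v + t) by [].
  by rewrite scaler0 add0r.
by rewrite -[RHS]/('D_1 (F \o pair x) y) (derive_affine l).
Qed.

Lemma derive_fst_slice (F : V * R -> R) x y v :
  'D_(v, 0) F (x, y) = 'D_v (fun x => F (x, y)) x.
Proof.
have l h (u t : V) : (h *: u + t, y) = h *: ((u, 0) : V * R) + (t, y).
  have -> : h *: ((u, 0) : V * R) + (t, y) = (h *: u + t, h *: 0 + y) by [].
  by rewrite scaler0 add0r.
by rewrite -[RHS]/('D_v (F \o (fun x => (x, y))) x) (derive_affine l).
Qed.

Lemma Ck_snd_slice k (F : V * R -> R) x : Ck k F -> Ck k (fun y => F (x, y)).
Proof.
apply: (@Ck_affine R _ _ (pair x) (pair 0)).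
  move=> h v t.
  have -> : h *: ((0, v) : V * R) + (x, t) = (h *: 0 + x, h *: v + t) by [].
  by rewrite scaler0 add0r.
move=> y; have xx : cst x z @[z --> y] --> x by exact: cvg_cst.
exact: (cvg_pair xx (@cvg_id _ (nbhs y))).
Qed.

Lemma Ck_derivable1 (g : R -> R) : (forall k, Ck k g) ->
  (forall x, derivable g x 1) /\ continuous (fun x => 'D_1 g x).
Proof.
by move=> gk; have [_ /(_ 1)[dg [cg _]]] := gk 1%N.
Qed.

End slices.

Section pdC.
Context {R : realType} {n : nat}.

Definition iy : 'I_(n + 1) := rshift n ord0.

Lemma pdC_iy (F : 'rV[R]_n * R -> R) x y :
  pdC iy F (x, y) = 'D_1 (fun y => F (x, y)) y.
Proof. by rewrite /pdC (unsplitK (inr ord0)) derive_snd_slice. Qed.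

Lemma pdC_lshift (F : 'rV[R]_n * R -> R) j x y :
  pdC (lshift 1 j) F (x, y) = pdOmega j (fun x => F (x, y)) x.
Proof. by rewrite /pdC (unsplitK (inl j)) derive_fst_slice. Qed.

Lemma Ccinfty_pdC (D : set ('rV[R]_n * R)) i F : Ccinfty D F ->
  Ccinfty D (pdC i F).
Proof. exact: Ccinfty_derive. Qed.

End pdC.

(** * The trace recovered from pairings with Gaussians *)

Section trace_identity.
Context {R : realType} {n : nat}.
Variables (Omega : set 'rV[R]_n) (s : R).
Hypothesis mOmega : measurable Omega.
Hypothesis bOmega : exists2 M, 0 < M & forall x, Omega x -> `|x| <= M.
Hypothesis s01 : 0 < s < 1.
Local Notation V := 'rV[R]_n.
Local Notation W := (V * measurableTypeR R)%type.
Local Notation mu := (@lebesgue_measure R).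
Local Notation Rp := (`]0%R, +oo[%classic : set (measurableTypeR R)).
Local Notation C := (cylinder Omega).
Local Notation a := (alpha s).
Local Notation L2w := (L2 lebW C (@weight R n s)).
Local Notation innerw := (inner lebW C (@weight R n s)).
Local Notation core := (Ccinfty (Omega `*` [set: R])).
Let mC := measurable_cylinder mOmega.
Let mw := @measurable_weight R n Omega s.
Let w0 := @weight_ge0 R n Omega s.
Let m1 : measurable_fun Omega (cst 1 : V -> R) := measurable_cst _.
Let p1 (x : V) (_ : Omega x) : 0 <= cst (1 : R) x := ler01.

Definition tgauss (h : V -> R) (b r : R) (z : W) : R :=
  h z.1 * (z.2 `^ b * gauss r z.2).

Lemma L2_tgauss h b r : -1 < 2 * b + a -> 0 < r -> L2Omega Omega h ->
  L2w (tgauss h b r).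
Proof.
move=> ab r0 h2.
exact: (L2_tensor mOmega h2 (L2_half_gauss ab r0)).
Qed.

Let a1 : -1 < 2 * - a + a.
Proof. by have /andP[_ H] := alpha_bounds s01; lra. Qed.
Let a2 : -1 < 2 * (1 - a) + a.
Proof. by have /andP[_ H] := alpha_bounds s01; lra. Qed.

(** The weight y^alpha cancels against y^(-alpha), so for smooth w this is the integral of h times
    the y-derivative of w e^(-r y^2). Written with weighted pairings it is continuous in the norm of
    [H1L]. *)
Definition trace_form (w wy : W -> R) (h : V -> R) (r : R) : R :=
  innerw wy (tgauss h (- a) r) - 2 * r * innerw w (tgauss h (1 - a) r).

Lemma L2Omega_Ccinfty (f : V -> R) : Ccinfty Omega f -> L2Omega Omega f.
Proof.
move=> cf; have [B B0 fB] := Ccinfty_bounded cf.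
apply: (L2Omega_bounded mOmega bOmega (B := B)); last by move=> x _; exact: fB.
apply: continuous_measurable_rV => //; apply: continuous_subspaceT.
exact: Ccinfty_continuous cf.
Qed.

(** The fundamental theorem in y for h(x) F(x, y) e^(-r y^2): the Gaussian is 1 at y = 0, and the
    lower endpoint produces the sign. *)
Lemma trace_form_smooth F h r : core F -> L2Omega Omega h -> 0 < r ->
  trace_form F (pdC iy F) h r = - innerOmega Omega (fun x => F (x, 0)) h.
Proof.
move=> cF h2 r0; have F2 := Ccinfty_L2w mOmega bOmega s01 cF.
have Fy2 := Ccinfty_L2w mOmega bOmega s01 (Ccinfty_pdC iy cF).
have G1 := L2_tgauss a1 r0 h2; have G2 := L2_tgauss a2 r0 h2.
have i1 := L2_integrableM mC mw w0 Fy2 G1.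
have i2 := L2_integrableM mC mw w0 F2 G2.
rewrite /trace_form {1 2}/inner -mulNr -RintegralZl// -RintegralD//; last first.
  exact: integrable_EFinZ.
rewrite Rintegral_cylinder12//; last first.
  by apply: integrable_EFinD => //; exact: integrable_EFinZ.
have F02 : L2Omega Omega (fun x => F (x, 0)).
  by apply: L2Omega_Ccinfty; exact: Ccinfty_slice cF.
rewrite -[RHS]mulN1r /innerOmega /inner -RintegralZl//; last first.
  exact: (L2_integrableM mOmega m1 p1 F02 h2).
rewrite [in RHS]Rintegral_leb; apply: eq_Rintegral => x xO.
pose g : R -> R := cst (h x) * ((fun y => F (x, y)) * gauss r).
have gk k : Ck k g.
  apply: CkM; first exact: Ck_cst.
  by apply: CkM; [apply: Ck_snd_slice; exact: (proj1 cF)|exact: Ck_gauss].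
have [dg cg] := Ck_derivable1 gk.
have [M M0 FM] := Ccinfty_support_bounded cF.
have g0 y : M < y -> g y = 0.
  move=> My; rewrite [LHS](_ : _ = h x * (F (x, y) * gauss r y))//.
  rewrite FM ?mul0r ?mulr0//; apply: (lt_le_trans My).
  by rewrite prod_normE le_max ler_norm orbT.
have := Rintegral_derive_half dg cg g0.
rewrite [g 0](_ : _ = h x * (F (x, 0) * gauss r 0))//.
rewrite {1}/gauss expr0n/= mulr0 oppr0 expR0 !mulr1 mul1r mulN1r [in RHS]mulrC => <-.
apply: eq_Rintegral => y; rewrite inE/= in_itv/= andbT => y0.
have [dF _] := Ck_derivable1 (fun k => Ck_snd_slice x (proj1 cF k)).
have [dG _] := Ck_derivable1 (Ck_gauss r).
rewrite [RHS]deriveM//; last exact: derivableM.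
rewrite derive_cst scaler0 addr0 deriveM// derive_gauss -pdC_iy.
rewrite /tgauss /weight /GRing.scale/=.
have e1 : y `^ (- a) = (y `^ a)^-1 by rewrite powRN.
have e2 : y `^ (1 - a) = y / y `^ a.
  rewrite -{2}(powRr1 (ltW y0)) -powRB//.
  by apply/implyP => _; rewrite gt_eqF.
have ya : y `^ a != 0 by rewrite gt_eqF// powR_gt0.
by rewrite e1 e2; field.
Qed.

Section limit.
Variables (w : W -> R) (g : W -> 'rV[R]_(n + 1)) (phi : nat -> W -> R).
Hypothesis wg : H1L Omega s w g.
Hypothesis wphi :
  H1approx lebW C (@weight R n s) core pdC w g phi.

Lemma H1L_L2 : L2w w. Proof. by have [[]] := wg. Qed.
Lemma H1L_L2y i : L2w (fun x => g x ord0 i). Proof. by have [[]] := wg. Qed.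

Lemma H1L_cvg G : L2w G -> innerw (phi k) G @[k --> \oo] --> innerw w G.
Proof.
move=> G2; apply: (H1approx_inner mC mw w0 _ H1L_L2 wphi G2) => F cF.
exact: Ccinfty_L2w.
Qed.

Lemma H1L_pd_cvg i G : L2w G ->
  innerw (pdC i (phi k)) G @[k --> \oo] --> innerw (fun x => g x ord0 i) G.
Proof.
move=> G2; apply: (@H1approx_inner_pd _ _ _ _ lebW C _ core pdC) => //.
- by move=> F j cF; apply: Ccinfty_L2w => //; exact: Ccinfty_pdC.
- exact: H1L_L2y.
- exact: wphi.
Qed.

(** Convergence of the boundary pairings is a conclusion here: the form is continuous along [phi]
    and equals those pairings at each index, for every r at once. *)
Lemma trace_form_cvg h r : L2Omega Omega h -> 0 < r ->
  - innerOmega Omega (fun x => phi k (x, 0)) h @[k --> \oo] -->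
  trace_form w (fun x => g x ord0 iy) h r.
Proof.
move=> h2 r0.
rewrite (_ : (fun k => _) = fun k => trace_form (phi k) (pdC iy (phi k)) h r).
  apply: cvgB; first by apply: H1L_pd_cvg; exact: L2_tgauss.
  by apply: cvgMr; apply: H1L_cvg; exact: L2_tgauss.
by apply/funext => k; rewrite trace_form_smooth//; exact: (proj1 wphi).
Qed.

(** The sequence whose restrictions converge to u has to be the one approximating w with this
    gradient g. *)
Lemma trace_form_trace u h r : L2Omega Omega u ->
  sqnorm (lebesgue_rV R n) Omega (cst 1) (fun x => phi k (x, 0) - u x)
    @[k --> \oo] --> 0%E ->
  L2Omega Omega h -> 0 < r ->
  trace_form w (fun x => g x ord0 iy) h r = - innerOmega Omega u h.
Proof.
move=> u2 uphi h2 r0.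
apply: (cvg_unique _ (trace_form_cvg h2 r0)) => //.
apply: cvgN; apply: (inner_cvg mOmega m1 p1) => //.
  move=> k; apply: L2Omega_Ccinfty; apply: Ccinfty_slice.
  exact: (proj1 wphi).
rewrite (_ : (fun k => _) =
  (fun k => sqnorm (lebesgue_rV R n) Omega (cst 1) (fun x => phi k (x, 0) - u x)))//.
apply/funext => k; apply: eq_integral => x _; congr (_ * _)%:E.
by rewrite -sqrrN opprB.
Qed.

End limit.

(** Dominated convergence: for y > 0 the Gaussians are the powers of e^(-y^2) < 1, and the one with
    parameter 1 is a majorant. *)
Lemma inner_tgauss_cvg0 f h : L2w f -> L2Omega Omega h ->
  innerw f (tgauss h (- a) m.+1%:R) @[m --> \oo] --> (0 : R).
Proof.
move=> f2 h2.
have G m := L2_tgauss a1 (ltr0Sn R m) h2.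
have im m := L2_integrableM mC mw w0 f2 (G m).
have mf : measurable_fun C f by exact: (proj1 f2).
have mG m : measurable_fun C (tgauss h (- a) m.+1%:R) by exact: (proj1 (G m)).
have -> : 0 = \int[lebW]_(z in C) 0 :> R.
  by rewrite Rintegral_cst ?mul0r.
have gi : lebW.-integrable C
    (EFin \o (fun z : W => `|weight s z * f z * tgauss h (- a) 1 z|)).
  exact: integrable_norm (im 0%N).
apply: (cvg_Rintegral_dominated mC _ _ _ gi) => //.
- by move=> m; apply: measurable_funM => //; exact: measurable_funM.
- move=> [x y] [/= Ox y0].
  rewrite -[0](mulr0 (weight s (x, y) * f (x, y))).
  apply: cvgMr; rewrite -[0](mulr0 (h x)); apply: cvgMr.
  rewrite -[0](mulr0 (y `^ (- a))); apply: cvgMr => /=.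
  have y1 : `|expR (- y ^+ 2)| < 1.
    by rewrite ger0_norm ?expR_ge0// expR_lt1 oppr_lt0 exprn_gt0.
  have := cvg_expr y1; rewrite -(cvg_shiftS (GRing.exp (expR (- y ^+ 2)))).
  rewrite (_ : (fun m => _) = (fun m => gauss m.+1%:R y))//.
  by apply/funext => m; rewrite /= -expRM_natl mulrN.
- move=> m [x y] [/= Ox y0]; rewrite !normrM ler_wpM2l// ler_wpM2l//.
  rewrite ler_wpM2l// !(ger0_norm (ltW (gauss_gt0 _ _))) ler_expR lerN2.
  by rewrite ler_wpM2r ?sqr_ge0// ler1n.
Qed.

(** For every r the form is the limit of one and the same sequence of boundary pairings. *)
Lemma trace_form_const w g phi h r r' : H1L Omega s w g ->
  H1approx lebW C (@weight R n s) core pdC w g phi -> L2Omega Omega h ->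
  0 < r -> 0 < r' ->
  trace_form w (fun x => g x ord0 iy) h r =
  trace_form w (fun x => g x ord0 iy) h r'.
Proof.
move=> wg wphi h2 r0 r0'.
have c := trace_form_cvg wg wphi h2 r0; have c' := trace_form_cvg wg wphi h2 r0'.
exact: (cvg_unique _ c c').
Qed.

(* The y-derivatives of the two gradients may a priori differ, but their
   contribution disappears as [r] tends to infinity while the form is
   independent of [r]. *)
Lemma trace_form_is_trace w g u h r : H1L Omega s w g ->
  is_trace Omega s w u -> L2Omega Omega h -> 0 < r ->
  trace_form w (fun x => g x ord0 iy) h r = - innerOmega Omega u h.
Proof.
move=> wg [u2 [g' [phi' [wg' wphi' uphi']]]] h2 r0.
have [_ [phi wphi]] := wg.
have wy := H1L_L2y wg iy; have wy' := H1L_L2y wg' iy.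
have d2 := L2B mC mw w0 wy wy'.
pose K := trace_form w (fun x => g x ord0 iy) h r + innerOmega Omega u h.
suff K0 : K = 0 by apply/eqP; rewrite -addr_eq0; apply/eqP.
have := inner_tgauss_cvg0 d2 h2.
rewrite (_ : (fun m => _) = cst K).
  by move=> c; apply: (cvg_unique _ (cvg_cst K) c).
apply/funext => m; rewrite /K (trace_form_const wg wphi h2 r0 (ltr0Sn R m)).
rewrite -[innerOmega _ _ _]opprK -(trace_form_trace wg' wphi' u2 uphi' h2 (ltr0Sn R m)).
rewrite (innerBl mC mw w0 wy wy' (L2_tgauss a1 (ltr0Sn R m) h2)) /trace_form.
rewrite /cst.
move: (innerw (fun x => g x ord0 iy) _) (innerw (fun x => g' x ord0 iy) _)
  (2 * _ * innerw w _) => A A' B.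
by ring.
Qed.

Lemma is_trace_unique w u u' : is_trace Omega s w u -> is_trace Omega s w u' ->
  forall h, L2Omega Omega h -> innerOmega Omega u h = innerOmega Omega u' h.
Proof.
move=> wu wu' h h2; have [_ [g [phi [wg _ _]]]] := wu.
apply: oppr_inj; rewrite -(trace_form_is_trace wg wu h2 ltr01).
exact: trace_form_is_trace.
Qed.

End trace_identity.

(** * Products of an [H10] function of x' with a test function of y *)

Section tensor.
Context {R : realType} {n : nat}.
Variables (Omega : set 'rV[R]_n) (s : R).
Hypothesis mOmega : measurable Omega.
Hypothesis bOmega : exists2 M, 0 < M & forall x, Omega x -> `|x| <= M.
Hypothesis s01 : 0 < s < 1.
Local Notation V := 'rV[R]_n.
Local Notation W := (V * measurableTypeR R)%type.
Local Notation mu := (@lebesgue_measure R).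
Local Notation Rp := (`]0%R, +oo[%classic : set (measurableTypeR R)).
Local Notation C := (cylinder Omega).
Local Notation wy := (fun y : R => y `^ alpha s).
Local Notation L2y := (L2 mu Rp wy).
Local Notation L2w := (L2 lebW C (@weight R n s)).
Local Notation innerw := (inner lebW C (@weight R n s)).
Local Notation sqO := (sqnorm (lebesgue_rV R n) Omega (cst (1 : R)%R)).
Local Notation core := (Ccinfty (Omega `*` [set: R])).
Let mC := measurable_cylinder mOmega.
Let mw := @measurable_weight R n Omega s.
Let w0 := @weight_ge0 R n Omega s.
Let m1 : measurable_fun Omega (cst 1 : V -> R) := measurable_cst _.
Let p1 (x : V) (_ : Omega x) : 0 <= cst (1 : R) x := ler01.
Let mRp : measurable Rp := measurable_half.
Let mwy : measurable_fun Rp wy := measurable_funTS (measurable_powR _).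
Let wy0 (y : measurableTypeR R) (_ : Rp y) : 0 <= wy y := powR_ge0 _ _.

Lemma Ccinfty_L2y (e : R -> R) : Ccinfty setT e -> L2y e.
Proof.
move=> ce; have [B B0 eB] := Ccinfty_bounded ce.
have [M M0 eM] := Ccinfty_support_bounded ce.
apply: (L2_le mRp mwy wy0 _ (L2Z mRp mwy wy0 (B * expR M) (L2_half_expR s01 ltr01))).
  by apply: measurable_funTS; apply: continuous_measurable_fun;
    exact: Ccinfty_continuous ce.
move=> y y0; have [yM|yM] := ltP M y.
  by rewrite eM ?normr0//; apply: (lt_le_trans yM); exact: ler_norm.
apply: le_trans (eB _) _; rewrite -mulrA -expRD.
rewrite ger0_norm ?mulr_ge0 ?expR_ge0 ?(ltW B0)//.
rewrite ler_peMr ?(ltW B0)// mul1r (le_trans _ (expR_ge1Dx _))//.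
by rewrite lerDl subr_ge0.
Qed.

Lemma inner_tensor h h' e e' : L2Omega Omega h -> L2Omega Omega h' ->
  L2y e -> L2y e' ->
  innerw (fun z => h z.1 * e z.2) (fun z => h' z.1 * e' z.2) =
  innerOmega Omega h h' * inner mu Rp wy e e'.
Proof.
move=> h2 h2' e2 e2'.
rewrite {1}/inner Rintegral_cylinder12//; last first.
  by apply: (L2_integrableM mC mw w0); exact: L2_tensor.
rewrite /innerOmega {1}/inner -RintegralZr//; last first.
  exact: (L2_integrableM mOmega m1 p1).
rewrite [in RHS]Rintegral_leb; apply: eq_Rintegral => x _ /=.
rewrite /inner -RintegralZl//; last exact: (L2_integrableM mRp mwy wy0).
by apply: eq_Rintegral => y _; rewrite /weight/=; ring.
Qed.

Lemma sqnorm_tensor h e : L2Omega Omega h -> L2y e ->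
  sqnorm lebW C (@weight R n s) (fun z => h z.1 * e z.2) =
  (sqO h * sqnorm mu Rp wy e)%E.
Proof.
move=> h2 e2; rewrite (sqnorm_inner mC mw w0 (L2_tensor mOmega h2 e2)).
rewrite (sqnorm_inner mOmega m1 p1 h2) (sqnorm_inner mRp mwy wy0 e2).
by rewrite inner_tensor.
Qed.

(** Weak gradients on the cylinder are tested without the weight, so this is not an instance of the
    weighted pairing. On the bounded set [Omega] an L^2 function is integrable, and B e^(M-y) bounds
    F. *)
Lemma integrable_L2Omega_Ccinfty h (F : V * R -> R) : L2Omega Omega h ->
  core F -> (@lebW R n).-integrable C (EFin \o (fun z : W => h z.1 * F z)).
Proof.
move=> h2 cF; have [B B0 FB] := Ccinfty_bounded cF.
have [M M0 FM] := Ccinfty_support_bounded cF.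
have o2 : L2Omega Omega (cst 1).
  by apply: (L2Omega_bounded mOmega bOmega (B := `|1|)) => //; exact: measurable_cst.
have hi : (leb R n).-integrable Omega (EFin \o h).
  have := L2_integrableM mOmega m1 p1 h2 o2.
  by apply: eq_integrable => // x _ /=; rewrite mul1r mulr1.
have ei := integrable_EFinZ mRp (B * expR M)
  (@integrable_powR_expR R 0 1 ltac:(by rewrite ltrN10) ltr01).
have := @integrable_setX_mul _ _ _ _ _ (leb R n) mu _ _ mOmega mRp _ _ hi ei.
rewrite -cylinderE; apply: (integrable_EFin_le mC).
  apply: measurable_funM.
    rewrite cylinderE; apply: measurable_fun_fst_setX => //.
    exact: (proj1 h2).
  apply: measurable_funTS; apply: continuous_measurable_rVR.
  exact: Ccinfty_continuous cF.
move=> [x y] [/= Ox y0]; rewrite normrM [leRHS]normrM ler_wpM2l//.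
have [yM|yM] := ltP M y.
  rewrite FM ?normr0//; apply: (lt_le_trans yM).
  by rewrite [leRHS]prod_normE le_max ler_norm orbT.
apply: le_trans (FB _) _.
rewrite powRr0 mul1r -mulrA -expRD ger0_norm ?mulr_ge0 ?expR_ge0 ?(ltW B0)//.
rewrite ler_peMr ?(ltW B0)// mul1r (le_trans _ (expR_ge1Dx _))//.
by rewrite lerDl subr_ge0.
Qed.

Section H10_tensor.
Variables (h : V -> R) (gh : V -> V) (e : R -> R).
Hypothesis hgh : H10 Omega h gh.
Hypothesis ce : Ccinfty setT e.

Lemma H10_L2 : L2Omega Omega h.
Proof. by have [[H _ _] _] := hgh; exact: H. Qed.

Lemma H10_L2g i : L2Omega Omega (fun x => gh x ord0 i).
Proof. by have [[_ H _] _] := hgh; exact: H. Qed.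

Definition tensor (z : W) : R := h z.1 * e z.2.

Definition tensor_grad (z : W) : 'rV[R]_(n + 1) :=
  row_mx (e z.2 *: gh z.1) (h z.1 * 'D_1 e (z.2 : R))%:M.

Let ce' : Ccinfty setT (fun y : R => 'D_1 e y).
Proof. exact: Ccinfty_derive. Qed.

Lemma tensor_grad_lshift j z :
  tensor_grad z ord0 (lshift 1 j) = gh z.1 ord0 j * e z.2.
Proof. by rewrite /tensor_grad row_mxEl mxE mulrC. Qed.

Lemma tensor_grad_iy z : tensor_grad z ord0 iy = h z.1 * 'D_1 e (z.2 : R).
Proof. by rewrite /tensor_grad /iy row_mxEr mxE mulr1n. Qed.

Lemma L2_tensor_grad i : L2w (fun z => tensor_grad z ord0 i).
Proof.
case: (split_ordP i) => j ->.
  rewrite (_ : (fun z => _) = fun z => gh z.1 ord0 j * e z.2); last first.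
    by apply/funext => z; rewrite tensor_grad_lshift.
  exact: (L2_tensor mOmega (H10_L2g j) (Ccinfty_L2y ce)).
rewrite (_ : (fun z => _) = fun z => h z.1 * 'D_1 e (z.2 : R)); last first.
  by apply/funext => z; rewrite [j]ord1 -tensor_grad_iy.
exact: (L2_tensor mOmega H10_L2 (Ccinfty_L2y ce')).
Qed.

Let core_of (psi : V * R -> R) : Ccinfty (C : set (V * R)) psi -> core psi.
Proof. by apply: Ccinfty_sub => z []. Qed.

Let core_M (psi : V * R -> R) (f : R -> R) : core psi -> (forall k, Ck k f) ->
  core (fun z => f z.2 * psi z).
Proof.
move=> cpsi fk; rewrite (_ : (fun z => _) = psi * (f \o snd)); last first.
  by apply/funext => z; rewrite mulrC.
apply: CcinftyMr => // k.
by apply: (@Ck_affine R _ _ snd snd) => // x; exact: cvg_snd.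
Qed.

(** In a direction of x' the integral over y is taken last and e(y) psi(., y) is a test function for
    h. In the direction of y the integral over x' is taken last and the fundamental theorem applies
    to e psi(x, .). *)
Lemma weak_gradient_tensor :
  weak_gradient lebW C (Ccinfty (C : set (V * R))) pdC tensor tensor_grad.
Proof.
move=> i psi cpsi; have cp := core_of cpsi.
have ek := proj1 ce; have ek' := proj1 ce'.
case: (split_ordP i) => j ->.
  have iA := integrable_L2Omega_Ccinfty H10_L2
    (core_M (Ccinfty_pdC (lshift 1 j) cp) ek).
  have iB := integrable_L2Omega_Ccinfty (H10_L2g j) (core_M cp ek).
  transitivity (\int[lebW]_(z in C) (h z.1 * (e z.2 * pdC (lshift 1 j) psi z))).
    by apply: eq_Rintegral => z _; rewrite mulrA.
  transitivity (-1 * \int[lebW]_(z in C) (gh z.1 ord0 j * (e z.2 * psi z))); last first.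
    rewrite mulN1r; congr (- _); apply: eq_Rintegral => z _.
    by rewrite tensor_grad_lshift mulrA.
  rewrite -(RintegralZl (-1) mC iB) (Rintegral_cylinder21 mOmega iA).
  rewrite (Rintegral_cylinder21 mOmega (integrable_EFinZ mC (-1) iB)).
  apply: eq_Rintegral => y _ /=.
  have cy : Ccinfty Omega (fun x => e y * psi (x, y)).
    exact: (Ccinfty_slice y (core_M cp ek)).
  have [[_ _ /(_ j _ cy) wk] _] := hgh.
  rewrite RintegralZl//; last first.
    have := L2_integrableM mOmega m1 p1 (H10_L2g j)
      (L2Omega_Ccinfty mOmega bOmega cy).
    by apply: eq_integrable => // x _ /=; rewrite mul1r.
  rewrite mulN1r -!Rintegral_leb -wk; apply: eq_Rintegral => x _.
  congr (_ * _); rewrite pdC_lshift /pdOmega.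
  rewrite -[fun x => e y * psi (x, y)]/(cst (e y) * (fun x => psi (x, y))).
  rewrite deriveM//; last first.
    exact: (Ccinfty_derivable (Ccinfty_slice y cp)).
  by rewrite derive_cst scaler0 addr0.
rewrite [j]ord1 -/iy.
have iA := integrable_L2Omega_Ccinfty H10_L2 (core_M (Ccinfty_pdC iy cp) ek).
have iB := integrable_L2Omega_Ccinfty H10_L2 (core_M cp ek').
apply/eqP; rewrite -addr_eq0; apply/eqP.
transitivity (\int[lebW]_(z in C) (h z.1 * (e z.2 * pdC iy psi z)) +
  \int[lebW]_(z in C) (h z.1 * ('D_1 e (z.2 : R) * psi z))).
  congr (_ + _); apply: eq_Rintegral => z _; first by rewrite mulrA.
  by rewrite tensor_grad_iy mulrA.
rewrite -RintegralD// Rintegral_cylinder12//; last exact: integrable_EFinD.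
rewrite (_ : (fun x => _) = cst 0) ?Rintegral_cst ?mul0r//.
apply/funext => x.
pose g : R -> R := cst (h x) * (e * (fun y => psi (x, y))).
have pk := fun k => Ck_snd_slice x (proj1 cp k).
have gk k : Ck k g.
  by apply: CkM; [exact: Ck_cst|exact: CkM].
have [dg cg] := Ck_derivable1 gk.
have [M M0 pM] := Ccinfty_support_bounded cp.
have g0 y : M < y -> g y = 0.
  move=> My; rewrite [LHS](_ : _ = h x * (e y * psi (x, y)))//.
  rewrite pM ?mulr0//; apply: (lt_le_trans My).
  by rewrite prod_normE le_max ler_norm orbT.
(* The test functions are supported in the open cylinder, which removes the boundary term although e
   need not vanish at 0. *)
have psi0 : psi (x, 0) = 0.
  by apply: (Ccinfty_out cpsi) => -[_] /=; rewrite ltxx.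
have := Rintegral_derive_half dg cg g0.
rewrite [g 0](_ : _ = h x * (e 0 * psi (x, 0)))// psi0 !mulr0 oppr0 => g'0.
apply: etrans g'0.
apply: eq_Rintegral => y _.
have [dF _] := Ck_derivable1 pk; have [dE _] := Ck_derivable1 ek.
rewrite [RHS]deriveM//; last exact: derivableM.
by rewrite derive_cst scaler0 addr0 deriveM// -pdC_iy /GRing.scale/=; ring.
Qed.

(** Multiplying the approximants of h by e suffices: the squared norm of the error is the H^1 error
    of h times |e|^2 plus its L^2 error times |e'|^2, and both L^2 norms of e and e' are finite. *)
Lemma H10_approx_tensor (p : nat -> V -> R) :
  H1approx (lebesgue_rV R n) Omega (cst 1) (Ccinfty Omega) pdOmega h gh p ->
  H1approx lebW C (@weight R n s) core pdC tensor tensor_grad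
    (fun k z => p k z.1 * e z.2) /\
  sqO (fun x => h x - p k x)
    @[k --> \oo] --> 0%E.
Proof.
move=> [cp p0].
have e2 := Ccinfty_L2y ce; have e2' := Ccinfty_L2y ce'.
have p2 k := L2Omega_Ccinfty mOmega bOmega (cp k).
have dp2 k j := L2Omega_Ccinfty mOmega bOmega (Ccinfty_derive (delta_mx ord0 j) (cp k)).
have d2 k : L2Omega Omega (fun x => h x - p k x).
  exact: (L2B mOmega m1 p1 H10_L2 (p2 k)).
have sq0 f : (0 <= sqO f)%E.
  by apply: integral_ge0 => x _; rewrite lee_fin mul1r sqr_ge0.
have s0 : sqO (fun x => h x - p k x)
    @[k --> \oo] --> 0%E.
  apply: (@squeeze_cvge _ _ _ _ (cst 0%E)) p0; last exact: cvg_cst.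
  by apply: nearW => k; rewrite sq0/= leeDl// sume_ge0.
split=> //; split; first by move=> k; exact: Ccinfty_tensor.
have dE k : (fun z => tensor z - p k z.1 * e z.2) =
    fun z => (h z.1 - p k z.1) * e z.2.
  by apply/funext => z; rewrite mulrBl.
have gE k j : (fun z => (tensor_grad z -
      grad pdC (fun z => p k z.1 * e z.2) z) ord0 (lshift 1 j)) =
    fun z : W => (gh z.1 ord0 j - pdOmega j (p k) z.1) * e z.2.
  apply/funext => -[x y]; rewrite mxE tensor_grad_lshift !mxE pdC_lshift mulrBl.
  congr (_ - _); rewrite /pdOmega /=.
  rewrite -[fun x => p k x * e y]/(p k * cst (e y)).
  rewrite deriveM//; last exact: (Ccinfty_derivable (cp k)).
  by rewrite derive_cst scaler0 add0r /GRing.scale/= mulrC.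
have yE k : (fun z => (tensor_grad z -
      grad pdC (fun z => p k z.1 * e z.2) z) ord0 iy) =
    fun z : W => (h z.1 - p k z.1) * 'D_1 e (z.2 : R).
  apply/funext => -[x y]; rewrite mxE tensor_grad_iy !mxE pdC_iy mulrBl.
  congr (_ - _) => /=.
  rewrite -[fun y => p k x * e y]/(cst (p k x) * e).
  rewrite deriveM//; last exact: (Ccinfty_derivable ce).
  by rewrite derive_cst scaler0 addr0.
have E k : H1sqnorm lebW C (@weight R n s) (fun z => tensor z - p k z.1 * e z.2)
    (fun z => tensor_grad z - grad pdC (fun z => p k z.1 * e z.2) z) =
  (H1sqnorm (lebesgue_rV R n) Omega (cst (1 : R)%R) (fun x => h x - p k x)%R
    (fun x => gh x - grad pdOmega (p k) x)%R * sqnorm mu Rp wy e +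
   sqO (fun x => h x - p k x)%R *
     sqnorm mu Rp wy (fun y : R => 'D_1 e y)%R)%E.
  have split_sum (F : 'I_(n + 1) -> \bar R) :
      (\sum_(i < n + 1) F i = \sum_(j < n) F (lshift 1 j) + F iy)%E.
    by rewrite big_split_ord/= big_ord1.
  rewrite /H1sqnorm dE (sqnorm_tensor (d2 k) e2) split_sum.
  rewrite yE (sqnorm_tensor (d2 k) e2') addeA.
  apply: (f_equal2 (@GRing.add (\bar R))) => //.
  apply: etrans; last first.
    by apply: esym; apply: ge0_muleDl; [exact: sq0|exact: sume_ge0].
  apply: (f_equal2 (@GRing.add (\bar R))) => //.
  rewrite ge0_sume_distrl//; apply: eq_bigr => j _; rewrite gE.
  rewrite (sqnorm_tensor (L2B mOmega m1 p1 (H10_L2g j) (dp2 k j)) e2).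
  by congr (sqnorm _ _ _ _ * _)%E; apply/funext => x; rewrite !mxE.
rewrite (_ : (fun k => _) = fun k =>
  (H1sqnorm (lebesgue_rV R n) Omega (cst (1 : R)%R) (fun x => h x - p k x)%R
    (fun x => gh x - grad pdOmega (p k) x)%R * sqnorm mu Rp wy e +
   sqO (fun x => h x - p k x)%R *
     sqnorm mu Rp wy (fun y : R => 'D_1 e y)%R)%E); last by apply/funext => k; exact: E.
rewrite -[X in _ --> X](adde0 0%E); apply: cvgeD => //.
- rewrite -[X in _ --> X](mul0e (sqnorm mu Rp wy e)); apply: cvgeZr => //.
  by rewrite (sqnorm_inner mRp mwy wy0 e2).
- rewrite -[X in _ --> X](mul0e (sqnorm mu Rp wy (fun y : R => 'D_1 e y)%R)).
  apply: cvgeZr => //.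
  by rewrite (sqnorm_inner mRp mwy wy0 e2').
Qed.

Lemma H1L_tensor : H1L Omega s tensor tensor_grad.
Proof.
split; first split.
- exact: (L2_tensor mOmega H10_L2 (Ccinfty_L2y ce)).
- exact: L2_tensor_grad.
- exact: weak_gradient_tensor.
have [_ [p hp]] := hgh; exists (fun k z => p k z.1 * e z.2).
by have [] := H10_approx_tensor hp.
Qed.

(** The approximants restricted to y = 0 are e(0) times those of h. *)
Lemma is_trace_tensor : is_trace Omega s tensor (fun x => e 0 * h x).
Proof.
split; first exact: (L2Z mOmega m1 p1 _ H10_L2).
have [_ [p hp]] := hgh; have [Hp p0] := H10_approx_tensor hp.
exists tensor_grad, (fun k z => p k z.1 * e z.2); split => //.
  exact: H1L_tensor.
have p2 k := L2Omega_Ccinfty mOmega bOmega (proj1 hp k).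
rewrite (_ : (fun k => _) = fun k => ((e 0 ^+ 2)%:E *
    sqO (fun x => h x - p k x)%R)%E).
  rewrite -[X in _ --> X](mule0 (e 0 ^+ 2)%:E); exact: cvgeZl.
apply/funext => k; rewrite /sqnorm -ge0_integralZl//=.
- apply: eq_integral => x _; rewrite -EFinM; congr EFin.
  by rewrite !mul1r -exprMn -sqrrN; congr (_ ^+ 2); ring.
- have := L2B mOmega m1 p1 H10_L2 (p2 k) => -[mh _].
  by apply/measurable_EFinP/measurable_funM => //; exact: measurable_funX.
- by move=> x _; rewrite lee_fin mul1r sqr_ge0.
- by rewrite lee_fin sqr_ge0.
Qed.

End H10_tensor.

End tensor.

(** * The domain, the coefficient matrix and the space [H10] *)

Lemma polytope_measurable (R : realType) n (Omega : set 'rV[R]_n) :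
  open_bounded_convex_polytope Omega -> measurable Omega.
Proof.
move=> [_ _ [m [N [b ->]]]].
rewrite (_ : [set x | _] = \bigcap_(i in [set: 'I_m])
    (fun x : 'rV[R]_n => (x *m N) ord0 i) @^-1` `]-oo, b ord0 i[); last first.
  apply/seteqP; split => x H i; first by move=> _; rewrite /= in_itv/=; exact: H.
  by have := H i Logic.I; rewrite /= in_itv.
apply: fin_bigcap_measurable => // i _.
have mf : measurable_fun setT (fun x : 'rV[R]_n => (x *m N) ord0 i).
  rewrite (_ : (fun x => _) = fun x : 'rV[R]_n => \sum_j x ord0 j * N j i).
    apply: measurable_sum => j; apply: measurable_funM => //.
    exact: measurable_coord.
  by apply/funext => x; rewrite mxE.
by rewrite -[X in measurable X]setTI; apply: mf.
Qed.

Lemma polytope_bounded (R : realType) n (Omega : set 'rV[R]_n) :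
  open_bounded_convex_polytope Omega ->
  exists2 M, 0 < M & forall x, Omega x -> `|x| <= M.
Proof.
move=> [_ [M [Mr MO]] _]; exists (`|M| + 1); first by rewrite ltr_pwDr.
move=> x Ox; apply: (MO (`|M| + 1)) => //.
by rewrite (le_lt_trans (ler_norm _))// ltrDl.
Qed.

(** A Lipschitz function on a bounded set is continuous, hence measurable, and differs from its
    value at one point by at most the Lipschitz constant times 2 M. *)
Lemma admissible_entry (R : realType) n (Omega : set 'rV[R]_n)
    (A : 'rV[R]_n -> 'M[R]_n) i j : measurable Omega -> Omega !=set0 ->
  (exists2 M, 0 < M & forall x, Omega x -> `|x| <= M) ->
  admissible_matrix Omega A ->
  measurable_fun Omega (fun x => A x i j) /\
  exists B, forall x, Omega x -> `|A x i j| <= B.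
Proof.
move=> mO [x0 Ox0] [M M0 OM] [lA _ _ _].
have [K K0 AK] : exists2 K, 0 < K &
    forall x y, Omega x -> Omega y -> `|A x i j - A y i j| <= K * `|x - y|.
  have [K [Kr HK]] := lA; exists (`|K| + 1); first by rewrite ltr_pwDr.
  move=> x y Ox Oy; have := HK (`|K| + 1).
  move=> /(_ ltac:(by rewrite (le_lt_trans (ler_norm _))// ltrDl)).
  move=> /(_ (x, y)) /= /(_ (conj Ox Oy)); apply: le_trans.
  by have := ler_mx_coord (A x - A y) i j; rewrite !mxE.
split.
  apply: continuous_measurable_rV => //; apply/subspace_continuousP => x Ox.
  apply/cvgrPdist_le => e e0; near=> y.
  have Oy : Omega y by near: y; exact: withinT.
  apply: le_trans (AK _ _ Ox Oy) _; rewrite -ler_pdivlMl//.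
  near: y; apply: cvg_within.
  have := @nbhsx_ballx _ _ x (K^-1 * e) ltac:(by rewrite mulr_gt0 ?invr_gt0).
  by apply: filterS => z; rewrite -ball_normE => /ltW.
exists (`|A x0 i j| + K * (M + M)) => x Ox.
rewrite -[A x i j](subrK (A x0 i j)) addrC (le_trans (ler_normD _ _))// lerD2l.
apply: le_trans (AK _ _ Ox Ox0) _; rewrite ler_wpM2l ?(ltW K0)//.
by apply: le_trans (ler_normB _ _) _; rewrite lerD ?OM.
Unshelve. all: by end_near. Qed.

Lemma Rintegral_ge0_ae d (T : measurableType d) (R : realType)
    (mu : {measure set T -> \bar R}) (D : set T) (f : T -> R) :
  measurable D -> measurable_fun D f ->
  {ae mu, forall x, D x -> 0 <= f x} -> 0 <= \int[mu]_(x in D) f x.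
Proof.
move=> mD mf f0.
rewrite [X in _ <= X](_ : _ = \int[mu]_(x in D) `|f x|).
  exact: Rintegral_ge0.
congr fine; apply: ae_eq_integral => //; first exact/measurable_EFinP.
  by apply/measurable_EFinP; exact: measurableT_comp.
by apply: filterS f0 => x f0 Dx; rewrite ger0_norm ?f0.
Qed.

Section H10.
Context {R : realType} {n : nat}.
Variables (Omega : set 'rV[R]_n).
Hypothesis mOmega : measurable Omega.
Hypothesis bOmega : exists2 M, 0 < M & forall x, Omega x -> `|x| <= M.
Local Notation V := 'rV[R]_n.
Local Notation lebn := (lebesgue_rV R n).
Local Notation L2O := (L2 lebn Omega (cst 1)).
Local Notation innerO := (inner lebn Omega (cst 1)).
Let m1 : measurable_fun Omega (cst 1 : V -> R) := measurable_cst _.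
Let p1 (x : V) (_ : Omega x) : 0 <= cst (1 : R) x := ler01.

(** Integration by parts for v psi on the whole space; a constant sequence approximates v. It makes
    every slice F(., y) of a smooth function admissible in the weak eigenvalue equation. *)
Lemma H10_Ccinfty v : Ccinfty Omega v -> H10 Omega v (grad pdOmega v).
Proof.
move=> cv; have v2 := L2Omega_Ccinfty mOmega bOmega cv.
have dv2 i := L2Omega_Ccinfty mOmega bOmega (Ccinfty_derive (delta_mx ord0 i) cv).
split; first split => //.
- move=> i; rewrite (_ : (fun x => _) = fun x => pdOmega i v x)//.
    exact: dv2.
  by apply/funext => x; rewrite mxE.
- move=> i psi cpsi; have psi2 := L2Omega_Ccinfty mOmega bOmega cpsi.
  have dpsi2 := L2Omega_Ccinfty mOmega bOmega (Ccinfty_derive (delta_mx ord0 i) cpsi).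
  have iA : lebn.-integrable Omega (EFin \o (fun x => v x * pdOmega i psi x)).
    have := L2_integrableM mOmega m1 p1 v2 dpsi2.
    by apply: eq_integrable => // x _ /=; rewrite mul1r.
  have iB : lebn.-integrable Omega (EFin \o (fun x => pdOmega i v x * psi x)).
    have := L2_integrableM mOmega m1 p1 (dv2 i) psi2.
    by apply: eq_integrable => // x _ /=; rewrite mul1r.
  apply/eqP; rewrite -addr_eq0; apply/eqP.
  transitivity (\int[lebn]_(x in Omega) (v x * pdOmega i psi x) +
      \int[lebn]_(x in Omega) (pdOmega i v x * psi x)).
    by congr (_ + _); apply: eq_Rintegral => x _; rewrite mxE.
  rewrite -RintegralD// Rintegral_mkcond.
  have cvpsi : Ccinfty Omega (v * psi) by apply: CcinftyMr => //; exact: (proj1 cpsi).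
  have cD := Ccinfty_derive (delta_mx ord0 i) cvpsi.
  have [B B0 DB] := Ccinfty_bounded cD.
  have [M M0 vM] := Ccinfty_support_bounded cvpsi.
  rewrite Rintegral_leb -[RHS](@Rintegral_derive_rV R n (v * psi) i M B) //.
  + apply: eq_Rintegral => x _; rewrite patchE.
    have [/set_mem Ox|] := boolP (x \in Omega).
      rewrite deriveM//; [|exact: (Ccinfty_derivable cv)
        |exact: (Ccinfty_derivable cpsi)].
      by congr (_ + _); rewrite /GRing.scale/= mulrC.
    by rewrite notin_setE => /(Ccinfty_out cD).
  + by move=> x; exact: (Ccinfty_derivable cvpsi).
  + exact: Ccinfty_continuous cD.
  + move=> x j Mj; apply: vM; exact: lt_le_trans Mj (ler_mx_coord _ _ _).
exists (fun=> v); split=> //.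
rewrite (_ : (fun k => _) = cst 0%E); first exact: cvg_cst.
apply/funext => k; rewrite /H1sqnorm /sqnorm integral0_eq ?add0e; last first.
  by move=> x _; rewrite subrr expr0n mulr0.
apply: big1 => i _; rewrite integral0_eq// => x _.
by rewrite subrr mxE expr0n mulr0.
Qed.

Section H10_limit.
Variables (h : V -> R) (g : V -> V).
Hypothesis hg : H10 Omega h g.

Let h2 := H10_L2 hg.
Let g2 i := H10_L2g hg i.

Lemma coord_L2 (j : 'I_n) f : L2O f -> L2O (fun x => x ord0 j * f x).
Proof.
move=> f2; have [M M0 OM] := bOmega.
apply: (L2_mulb mOmega m1 p1 (B := M)) => //.
  by apply: measurable_funTS; exact: measurable_coord.
by move=> x Ox; apply: le_trans (ler_mx_coord _ _ _) (OM _ Ox).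
Qed.

(* Testing the weak gradient against [x_j p] for [p] close to [h] *)
Lemma H10_inner_coord (j : 'I_n) :
  innerO h h = - (2 * innerO (fun x => x ord0 j * h x) (fun x => g x ord0 j)).
Proof.
have [[_ _ wk] [p hp]] := hg; have [cp _] := hp.
have coreL2 f : Ccinfty Omega f -> L2O f by exact: L2Omega_Ccinfty.
have core_pdL2 f i : Ccinfty Omega f -> L2O (pdOmega i f).
  by move=> /(Ccinfty_derive (delta_mx ord0 i)); exact: L2Omega_Ccinfty.
have xh2 := coord_L2 j h2; have xg2 := coord_L2 j (g2 j).
have c1 := H1approx_inner mOmega m1 p1 coreL2 h2 hp h2.
have c2 := H1approx_inner_pd mOmega m1 p1 core_pdL2 g2 hp (i := j) xh2.
have c3 := H1approx_inner mOmega m1 p1 coreL2 h2 hp xg2.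
have xE (x : V) : 'D_(delta_mx ord0 j) (fun x : V => x ord0 j) x = 1 /\
    derivable (fun x : V => x ord0 j) x (delta_mx ord0 j).
  have l (k : R) (v y : V) : (k *: v + y) ord0 j = k *: v ord0 j + y ord0 j.
    by rewrite !mxE.
  rewrite -[fun x : V => x ord0 j]/(id \o (fun x : V => x ord0 j)).
  rewrite (derive_affine l) (derivable_affine l) derive_id mxE !eqxx.
  by split => //; exact: derivable_id.
have xk k : Ck k (fun x : V => x ord0 j).
  apply: (@Ck_affine R _ _ (fun x : V => x ord0 j) (fun x : V => x ord0 j) k id).
  - by move=> r v x; rewrite !mxE.
  - exact: coord_continuous.
  - exact: Ck_id.
have E k : innerO (p k) h + innerO (pdOmega j (p k)) (fun x => x ord0 j * h x) =
    - innerO (p k) (fun x => x ord0 j * g x ord0 j).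
  have := wk j (p k * (fun x : V => x ord0 j)) (CcinftyMr (cp k) xk).
  have i1 := L2_integrableM mOmega m1 p1 (coreL2 _ (cp k)) h2.
  have i2 := L2_integrableM mOmega m1 p1 (core_pdL2 _ j (cp k)) xh2.
  rewrite /inner -RintegralD// => W.
  transitivity (\int[lebn]_(x in Omega)
    (h x * pdOmega j (p k * (fun x : V => x ord0 j)) x)).
    apply: eq_Rintegral => x _; rewrite /pdOmega deriveM//.
    - by rewrite (proj1 (xE x)) /GRing.scale /cst /pdOmega /=; ring.
    - exact: (Ccinfty_derivable (cp k)).
    - exact: (proj2 (xE x)).
  rewrite W; congr (- _); apply: eq_Rintegral => x _.
  by rewrite [(_ * _) x](_ : _ = p k x * x ord0 j)// /cst; ring.
have c12 := cvgD c1 c2; have c3N := cvgN c3.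
have U : innerO h h + innerO (fun x => g x ord0 j) (fun x => x ord0 j * h x) =
    - innerO h (fun x => x ord0 j * g x ord0 j).
  have c3' : innerO (p k) h + innerO (pdOmega j (p k)) (fun x => x ord0 j * h x)
      @[k --> \oo] --> - innerO h (fun x => x ord0 j * g x ord0 j).
    by rewrite (funext E); exact: c3N.
  have c12' : innerO (p k) h + innerO (pdOmega j (p k)) (fun x => x ord0 j * h x)
      @[k --> \oo] -->
      innerO h h + innerO (fun x => g x ord0 j) (fun x => x ord0 j * h x).
    exact: c12.
  exact: (cvg_unique _ c12' c3').
have S : innerO h (fun x => x ord0 j * g x ord0 j) =
    innerO (fun x => x ord0 j * h x) (fun x => g x ord0 j).
  by apply: eq_Rintegral => x _; rewrite /cst; ring.
have S' : innerO (fun x => g x ord0 j) (fun x => x ord0 j * h x) =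
    innerO (fun x => x ord0 j * h x) (fun x => g x ord0 j).
  by apply: eq_Rintegral => x _; rewrite /cst; ring.
by rewrite S S' in U; lra.
Qed.

End H10_limit.

End H10.

Section Rintegral_sum.
Context d (T : measurableType d) (R : realType).
Variables (mu : {measure set T -> \bar R}) (D : set T).
Hypothesis mD : measurable D.

Lemma integrable_EFin_sum m (f : 'I_m -> T -> R) :
  (forall i, mu.-integrable D (EFin \o f i)) ->
  mu.-integrable D (EFin \o (fun x => \sum_(i < m) f i x)).
Proof.
elim: m f => [|m IH] f fi.
  rewrite (_ : EFin \o _ = cst 0%E); first exact: integrable0.
  by apply/funext => x /=; rewrite big_ord0.
have := integrable_EFinD mD (fi ord0) (IH _ (fun i => fi (lift ord0 i))).
by apply: eq_integrable => // x _ /=; rewrite big_ord_recl.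
Qed.

Lemma Rintegral_sum m (f : 'I_m -> T -> R) :
  (forall i, mu.-integrable D (EFin \o f i)) ->
  \int[mu]_(x in D) (\sum_(i < m) f i x) = \sum_(i < m) \int[mu]_(x in D) f i x.
Proof.
elim: m f => [|m IH] f fi.
  rewrite big_ord0 (_ : (fun x => _) = cst 0) ?Rintegral_cst ?mul0r//.
  by apply/funext => x; rewrite big_ord0.
rewrite big_ord_recl -IH// -RintegralD//.
  by apply: eq_Rintegral => x _; rewrite big_ord_recl.
exact: integrable_EFin_sum.
Qed.

End Rintegral_sum.

Lemma cvg_sum_ord (R : realType) m (f : 'I_m -> nat -> R) (l : 'I_m -> R) :
  (forall i, f i k @[k --> \oo] --> l i) ->
  \sum_(i < m) f i k @[k --> \oo] --> \sum_(i < m) l i.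
Proof.
elim: m f l => [|m IH] f l fl.
  rewrite big_ord0 (_ : (fun k => _) = cst 0); first exact: cvg_cst.
  by apply/funext => k; rewrite big_ord0.
rewrite big_ord_recl (_ : (fun k => _) =
  fun k => f ord0 k + \sum_(i < m) f (lift ord0 i) k).
  by apply: cvgD => //; exact: IH.
by apply/funext => k; rewrite big_ord_recl.
Qed.

Lemma dotv_mulmx_tr (R : realType) n (u v : 'rV[R]_n) (A : 'M[R]_n) :
  dotv (u *m A^T) v = \sum_(j < n) u ord0 j * \sum_(i < n) A i j * v ord0 i.
Proof.
rewrite /dotv mxE; under eq_bigr do rewrite !mxE mulr_suml.
rewrite exchange_big /=; apply: eq_bigr => j _; rewrite mulr_sumr.
by apply: eq_bigr => i _; rewrite !mxE mulrA.
Qed.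

(** * Separation of variables for a single eigenfunction *)

Section eigenfunction.
Context {R : realType} {n : nat}.
Variables (Omega : set 'rV[R]_n) (A : 'rV[R]_n -> 'M[R]_n) (qbar s : R).
Hypothesis mOmega : measurable Omega.
Hypothesis neOmega : Omega !=set0.
Hypothesis bOmega : exists2 M, 0 < M & forall x, Omega x -> `|x| <= M.
Hypothesis s01 : 0 < s < 1.
Hypothesis aA : admissible_matrix Omega A.
Variable q : 'rV[R]_n -> R.
Hypothesis cq : coefficients Omega qbar q.
Local Notation V := 'rV[R]_n.
Local Notation W := (V * measurableTypeR R)%type.
Local Notation lebn := (lebesgue_rV R n).
Local Notation mu := (@lebesgue_measure R).
Local Notation C := (cylinder Omega).
Local Notation L2O := (L2 lebn Omega (cst 1)).
Local Notation innerO := (inner lebn Omega (cst 1)).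
Local Notation innerw := (inner lebW C (@weight R n s)).
Local Notation core := (Ccinfty (Omega `*` [set: R])).
Let mC := measurable_cylinder mOmega.
Let mw := @measurable_weight R n Omega s.
Let w0 := @weight_ge0 R n Omega s.
Let m1 : measurable_fun Omega (cst 1 : V -> R) := measurable_cst _.
Let p1 (x : V) (_ : Omega x) : 0 <= cst (1 : R) x := ler01.

Lemma coefficient_L2 f : L2O f -> L2O (fun x => q x * f x).
Proof.
move=> f2; have [mq q01] := cq.
have mf : measurable_fun Omega f by exact: (proj1 f2).
(* The bounds on q hold only almost everywhere; the truncation obeys them everywhere and agrees with
   q off a null set. *)
pose q' x := Num.max 0 (Num.min (q x) `|qbar|).
have q'2 : L2O (fun x => q' x * f x).
  apply: (L2_mulb mOmega m1 p1 (B := `|qbar|)) => //.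
    apply: (measurable_maxr (f := cst 0)); first exact: measurable_cst.
    by apply: (measurable_minr (g := cst `|qbar|)) => //; exact: measurable_cst.
  move=> x _; rewrite /q' ger0_norm ?le_max ?lexx// ge_max normr_ge0/=.
  by rewrite ge_min lexx orbT.
have [mq' q'oo] := q'2.
split; first exact: measurable_funM.
rewrite /sqnorm (ae_eq_integral (fun x => (cst 1 x * (q' x * f x) ^+ 2)%:E))//.
- apply/measurable_EFinP; apply: measurable_funM => //; apply: measurable_funX.
  exact: measurable_funM.
- apply/measurable_EFinP; apply: measurable_funM => //; exact: measurable_funX.
- apply: filterS q01 => x qx Ox; have /andP[q0 q1] := qx Ox.
  have -> : q' x = q x; last by [].
  rewrite /q' min_l ?max_r//; exact: le_trans q1 (ler_norm _).
Qed.

Variables (lam : R) (h : V -> R) (g : V -> V).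
Hypothesis hg : H10 Omega h g.
Hypothesis eigen : forall v hv, H10 Omega v hv ->
  \int[lebn]_(x in Omega) (dotv (g x *m (A x)^T) (hv x) + q x * h x * v x) =
  lam * innerOmega Omega h v.

Let h2 : L2O h := H10_L2 hg.
Let g2 i : L2O (fun x => g x ord0 i) := H10_L2g hg i.

(** The component of A^T g against which the j-th partial derivative of w is paired in [a_C]. *)
Definition flux (j : 'I_n) (x : V) : R := \sum_(i < n) A x i j * g x ord0 i.

Lemma flux_L2 j : L2O (flux j).
Proof.
apply: (L2_sum mOmega m1 p1 (f := fun i x => A x i j * g x ord0 i)) => i.
have [mA [B AB]] := admissible_entry i j mOmega neOmega bOmega aA.
exact: (L2_mulb mOmega m1 p1 mA AB).
Qed.

(** In the eigenvalue equation the matrix acts on the gradient of the eigenfunction, in [a_C] on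
    that of the solution; the symmetry of A lets the same flux serve both. *)
Lemma dotv_flux x u : Omega x ->
  dotv (g x *m (A x)^T) u = \sum_(j < n) u ord0 j * flux j x.
Proof.
move=> Ox; have [_ _ /(_ x Ox) sA _] := aA.
rewrite dotv_mulmx_tr; under eq_bigr do rewrite mulr_sumr.
rewrite exchange_big /=; apply: eq_bigr => j _; rewrite /flux mulr_sumr.
apply: eq_bigr => i _.
have -> : A x j i = A x i j by rewrite -[in LHS]sA mxE.
by ring.
Qed.

Let integrable_dotv v hv : H10 Omega v hv ->
  lebn.-integrable Omega (EFin \o (fun x => dotv (g x *m (A x)^T) (hv x))).
Proof.
move=> hv10; have hvg i := H10_L2g hv10 i.
have := integrable_EFin_sum mOmega
  (fun j => L2_integrableM mOmega m1 p1 (hvg j) (flux_L2 j)).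
apply: eq_integrable => // x /set_mem Ox /=; rewrite dotv_flux//.
by congr EFin; apply: eq_bigr => j _; rewrite mul1r.
Qed.

Lemma eigen_flux v hv : H10 Omega v hv ->
  \sum_(j < n) innerO (fun x => hv x ord0 j) (flux j) +
  innerO v (fun x => q x * h x - lam * h x) = 0.
Proof.
move=> hv10; have v2 := H10_L2 hv10; have hvg i := H10_L2g hv10 i.
have qh2 := coefficient_L2 h2.
have lh2 : L2O (fun x => lam * h x) by exact: (L2Z mOmega m1 p1).
rewrite innerC (innerBl mOmega m1 p1 qh2 lh2 v2) (innerZl mOmega m1 p1 lam h2 v2).
have := eigen hv10; rewrite -[innerOmega _ _ _]/(innerO h v) => <-.
have iq := L2_integrableM mOmega m1 p1 qh2 v2.
rewrite [X in _ - X](_ : _ = \sum_(j < n) innerO (fun x => hv x ord0 j) (flux j) +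
    innerO (fun x => q x * h x) v).
  by move: (\sum_(j < n) _) (innerO (fun x => q x * h x) v) => S B; ring.
have iqh : lebn.-integrable Omega (EFin \o (fun x => q x * h x * v x)).
  by apply: eq_integrable iq => // x _ /=; rewrite mul1r.
rewrite RintegralD//; last exact: integrable_dotv hv10.
congr (_ + _); last by apply: eq_Rintegral => x _; rewrite mul1r.
rewrite -Rintegral_sum//; last first.
  by move=> j; exact: (L2_integrableM mOmega m1 p1 (hvg j) (flux_L2 j)).
apply: eq_Rintegral => x /set_mem Ox; rewrite dotv_flux//.
by apply: eq_bigr => j _; rewrite mul1r.
Qed.

(** By [H10_inner_coord] a normalised h has <x_j h, g_j> = -1/2, so g_j is not zero in L^2.
    Ellipticity and q >= 0 then give lam >= c |g_j|^2 > 0. *)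
Lemma eigenvalue_gt0 (j : 'I_n) : innerO h h = 1 -> 0 < lam.
Proof.
move=> h1; have [_ _ _ [c c0 cA]] := aA.
have xh2 := coord_L2 mOmega bOmega j h2.
have gj0 : 0 < innerO (fun x => g x ord0 j) (fun x => g x ord0 j).
  rewrite lt_neqAle inner_ge0// andbT; apply/eqP => g0.
  have := inner_CS mOmega m1 p1 xh2 (g2 j); rewrite -g0 mulr0.
  have := H10_inner_coord mOmega bOmega hg j; rewrite h1.
  set I := innerO _ _ => I1 I2.
  have I3 : I = - 2^-1 by lra.
  by move: I2; rewrite I3 sqrrN leNgt exprn_gt0// invr_gt0.
apply: lt_le_trans (mulr_gt0 c0 gj0) _.
have := eigen hg; rewrite -[innerOmega _ _ _]/(innerO h h) h1 mulr1 => <-.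
have qh2 := coefficient_L2 h2.
have iq : lebn.-integrable Omega (EFin \o (fun x => q x * h x * h x)).
  have := L2_integrableM mOmega m1 p1 qh2 h2.
  by apply: eq_integrable => // x _ /=; rewrite mul1r.
have ig := integrable_EFinZ mOmega c (L2_integrableM mOmega m1 p1 (g2 j) (g2 j)).
have iF := integrable_EFinD mOmega (integrable_dotv hg) iq.
rewrite -subr_ge0 /inner -RintegralZl//; last first.
  exact: (L2_integrableM mOmega m1 p1 (g2 j) (g2 j)).
rewrite -RintegralB//; apply: Rintegral_ge0_ae => //.
  apply: measurable_funB; first exact: (integrable_EFin_measurable iF).
  exact: (integrable_EFin_measurable ig).
have [_ q01] := cq; apply: filterS q01 => x qx Ox.
have /andP[q0 _] := qx Ox.
rewrite subr_ge0 mul1r; apply: le_trans (_ : c * dotv (g x) (g x) <= _).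
  rewrite ler_pM2l// /dotv mxE (bigD1 j)//= mxE lerDl sumr_ge0// => i _.
  by rewrite mxE -expr2 sqr_ge0.
apply: le_trans (cA _ Ox _) _; rewrite lerDl -mulrA mulr_ge0//.
by rewrite -expr2 sqr_ge0.
Qed.

Variable e : R -> R.
Hypothesis ce : Ccinfty setT e.
Let e2 := Ccinfty_L2y s01 ce.
Let ce' : Ccinfty setT (fun y : R => 'D_1 e y).
Proof. exact: Ccinfty_derive. Qed.

Local Notation kap := (fun x => q x * h x - lam * h x).

Let kap2 : L2O kap.
Proof.
apply: (L2B mOmega m1 p1); first exact: coefficient_L2.
exact: (L2Z mOmega m1 p1).
Qed.

(** The operator -div(A grad) + q - lam in x', applied weakly to h and paired with w, with the
    factor e in y. *)
Definition lateral_form (w : W -> R) (gw : 'I_n -> W -> R) : R :=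
  \sum_(j < n) innerw (gw j) (fun z => flux j z.1 * e z.2) +
  innerw w (fun z => kap z.1 * e z.2).

(** For almost no effort beyond Fubini: each slice F(., y) belongs to [H10], where the eigenvalue
    equation makes the inner integral vanish. *)
Lemma lateral_form_smooth F : core F ->
  lateral_form F (fun j => pdC (lshift 1 j) F) = 0.
Proof.
move=> cF; have F2 := Ccinfty_L2w mOmega bOmega s01 cF.
have dF2 j := Ccinfty_L2w mOmega bOmega s01 (Ccinfty_pdC (lshift 1 j) cF).
have i1 j := L2_integrableM mC mw w0 (dF2 j) (L2_tensor mOmega (flux_L2 j) e2).
have i2 := L2_integrableM mC mw w0 F2 (L2_tensor mOmega kap2 e2).
rewrite /lateral_form /inner -(Rintegral_sum mC i1).
have i3 := integrable_EFin_sum mC i1.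
rewrite -RintegralD//.
rewrite (Rintegral_cylinder21 mOmega (integrable_EFinD mC i3 i2)).
rewrite (_ : (fun y => _) = cst 0) ?Rintegral_cst ?mul0r//.
apply/funext => y.
have cy := Ccinfty_slice y cF; have v10 := H10_Ccinfty mOmega bOmega cy.
have v2 := H10_L2 v10.
have gv2 j := H10_L2g v10 j.
have j1 j := L2_integrableM mOmega m1 p1 (gv2 j) (flux_L2 j).
have j2 := L2_integrableM mOmega m1 p1 v2 kap2.
have j3 := integrable_EFin_sum mOmega j1.
transitivity (\int[lebn]_(x in Omega) (y `^ alpha s * e y *
  (\sum_(j < n) (cst 1 x * grad pdOmega (fun x => F (x, y)) x ord0 j * flux j x) +
   cst 1 x * F (x, y) * kap x))).
  rewrite Rintegral_leb; apply: eq_Rintegral => x _; rewrite /weight /= mulrDr.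
  congr (_ + _); last by ring.
  rewrite mulr_sumr; apply: eq_bigr => j _.
  by rewrite mxE pdC_lshift; ring.
rewrite RintegralZl//; last exact: integrable_EFinD.
by rewrite RintegralD// Rintegral_sum// (eigen_flux v10) mulr0.
Qed.

Lemma lateral_form_eq0 w gw : H1L Omega s w gw ->
  lateral_form w (fun j z => gw z ord0 (lshift 1 j)) = 0.
Proof.
move=> wg; have [_ [phi wphi]] := wg.
have c1 : \sum_(j < n) innerw (pdC (lshift 1 j) (phi k)) (fun z => flux j z.1 * e z.2)
    @[k --> \oo] --> \sum_(j < n) innerw (fun z => gw z ord0 (lshift 1 j))
      (fun z => flux j z.1 * e z.2).
  apply: (@cvg_sum_ord _ _ (fun j k => innerw (pdC (lshift 1 j) (phi k))
    (fun z => flux j z.1 * e z.2))) => j.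
  apply: (H1L_pd_cvg mOmega bOmega s01 wg wphi).
  exact: (L2_tensor mOmega (flux_L2 j) e2).
have c2 := H1L_cvg mOmega bOmega s01 wg wphi (L2_tensor mOmega kap2 e2).
have c12 : lateral_form (phi k) (fun j => pdC (lshift 1 j) (phi k)) @[k --> \oo] -->
    lateral_form w (fun j z => gw z ord0 (lshift 1 j)).
  exact: (cvgD c1 c2).
have c0 : lateral_form (phi k) (fun j => pdC (lshift 1 j) (phi k))
    @[k --> \oo] --> (0 : R).
  rewrite (_ : (fun k => _) = cst 0); first exact: cvg_cst.
  by apply/funext => k; rewrite lateral_form_smooth//; exact: (proj1 wphi).
exact: (cvg_unique _ c12 c0).
Qed.

(** The x'-part of the form acts on h as multiplication by lam, so only a one-dimensional expression
    in y remains. *)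
Lemma a_C_tensor w gw : H1L Omega s w gw ->
  a_C Omega A s q w (tensor h e) gw (tensor_grad h g e) =
  lam * innerw w (tensor h e) +
  innerw (fun z => gw z ord0 iy) (fun z => h z.1 * 'D_1 e (z.2 : R)).
Proof.
move=> wg; have w2 := H1L_L2 wg; have gw2 i := H1L_L2y wg i.
have i1 j := L2_integrableM mC mw w0 (gw2 (lshift 1 j))
  (L2_tensor mOmega (flux_L2 j) e2).
have i2 := L2_integrableM mC mw w0 w2 (L2_tensor mOmega kap2 e2).
have i3 := L2_integrableM mC mw w0 w2 (L2_tensor mOmega h2 e2).
have i4 := L2_integrableM mC mw w0 (gw2 iy)
  (L2_tensor mOmega h2 (Ccinfty_L2y s01 ce')).
have i5 := integrable_EFin_sum mC i1.
(* Adding the vanishing lateral form on the right makes the claim a pointwise identity of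
   integrands; the terms with lam cancel. *)
rewrite -[RHS]add0r -(lateral_form_eq0 wg) /lateral_form /inner.
rewrite -(Rintegral_sum mC i1) -(RintegralD mC i5 i2) -(RintegralZl lam mC i3).
rewrite -(RintegralD mC (integrable_EFinZ mC lam i3) i4).
rewrite -RintegralD//; last 2 first.
- exact: integrable_EFinD.
- by apply: integrable_EFinD => //; exact: integrable_EFinZ.
apply: eq_Rintegral => -[x y] /set_mem[/= Ox y0].
rewrite /tensor_grad -[gw (x, y)]hsubmxK /Abold tr_block_mx !trmx0 trmx1.
rewrite mul_row_block !mulmx0 mulmx1 addr0 add0r.
rewrite {1}/dotv tr_row_mx mul_row_col mxE.
have -> : (lsubmx (gw (x, y)) *m (A x)^T *m (e y *: g x)^T) ord0 ord0 =
    e y * dotv (lsubmx (gw (x, y)) *m (A x)^T) (g x).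
  by rewrite /dotv linearZ/= -scalemxAr mxE.
rewrite dotv_mulmx_tr -/(flux _ _).
rewrite [(rsubmx _ *m _) _ _]mxE big_ord1 !mxE mulr1n /tensor /weight /=.
rewrite (_ : fintype.split iy = inr ord0); last exact: (unsplitK (inr ord0)).
rewrite [rsubmx _ _ _]mxE.
have -> : \sum_(i < n) y `^ alpha s *
     row_mx (lsubmx (gw (x, y))) (rsubmx (gw (x, y))) ord0 (lshift 1 i) *
     (flux i x * e y) =
   y `^ alpha s * e y * \sum_(j < n) lsubmx (gw (x, y)) ord0 j * flux j x.
  by rewrite mulr_sumr; apply: eq_bigr => j _; rewrite row_mxEl; ring.
rewrite /flux.
move: (\sum_(j < n) lsubmx _ _ _ * _) (gw (x, y) ord0 _) => S G.
by ring.
Qed.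

End eigenfunction.

(** * From compactly supported test functions to Gaussians *)

Section bump.
Context {R : realType}.

(** Since v is nonzero the line leaves every bounded set, so the preimage of the support is closed
    and bounded. Such restrictions supply the cutoffs in y. *)
Lemma Ccinfty_line (V : normedModType R) (D : set V) (p : V -> R) x v :
  v != 0 -> Ccinfty D p -> Ccinfty setT (fun y : R => p (y *: v + x)).
Proof.
move=> v0 [pk [K [cK KD p0]]]; pose l (y : R) := y *: v + x.
have cl : continuous l.
  move=> y; apply: cvgD; last exact: cvg_cst.
  by apply: cvgZr_tmp; exact: cvg_id.
split.
  move=> k; apply: (@Ck_affine R _ _ l (fun y => y *: v) k p) => //.
  by move=> h w y; rewrite /l scalerDl scalerA addrA.
have [M [Mr MB]] := compact_bounded cK.
(* If y v + x has norm at most |M| + 1, then |y| |v| is at most |M| + 1 + |x|. *)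
pose N := (`|M| + 1 + `|x|) / `|v|.
exists (l @^-1` K); split => //; last by move=> y Ky; exact: p0.
apply: (@subclosed_compact _ _ `[- N, N]).
- apply: preimage_closed => //.
  by apply: compact_closed => //; exact: norm_hausdorff.
- exact: segment_compact.
- move=> y Ky; rewrite /= in_itv/= -ler_norml /N ler_pdivlMr ?normr_gt0//.
  rewrite -normrZ -(addrK x (y *: v)) (le_trans (ler_normB _ _))// lerD2r.
  by apply: MB => //; rewrite (le_lt_trans (ler_norm _))// ltrDl.
Qed.

Lemma Ccinfty_dilation (e : R -> R) c : c != 0 -> Ccinfty setT e ->
  Ccinfty setT (fun y : R => e (y * c)).
Proof.
move=> c0 ce; have := Ccinfty_line (0 : R) c0 ce.
by congr Ccinfty; apply/funext => y; rewrite addr0.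
Qed.

End bump.

Section gauss_test.
Context {R : realType} {n : nat}.
Variables (Omega : set 'rV[R]_n) (s : R).
Hypothesis mOmega : measurable Omega.
Hypothesis s01 : 0 < s < 1.
Local Notation V := 'rV[R]_n.
Local Notation W := (V * measurableTypeR R)%type.
Local Notation mu := (@lebesgue_measure R).
Local Notation Rp := (`]0%R, +oo[%classic : set (measurableTypeR R)).
Local Notation C := (cylinder Omega).
Local Notation wy := (fun y : R => y `^ alpha s).
Local Notation L2y := (L2 mu Rp wy).
Local Notation L2w := (L2 lebW C (@weight R n s)).
Local Notation innerw := (inner lebW C (@weight R n s)).
Let mC := measurable_cylinder mOmega.
Let mw := @measurable_weight R n Omega s.
Let w0 := @weight_ge0 R n Omega s.
Let mRp : measurable Rp := measurable_half.
Let mwy : measurable_fun Rp wy := measurable_funTS (measurable_powR _).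
Let wy0 (y : measurableTypeR R) (_ : Rp y) : 0 <= wy y := powR_ge0 _ _.

Lemma inner_tensor_dominated (f : W -> R) (h : V -> R) (phik : nat -> R -> R)
    (phi psi : R -> R) : L2w f -> L2Omega Omega h ->
  (forall k, measurable_fun Rp (phik k)) -> measurable_fun Rp phi -> L2y psi ->
  (forall k y, 0 < y -> `|phik k y| <= psi y) ->
  (forall y, 0 < y -> phik k y @[k --> \oo] --> phi y) ->
  innerw f (fun z => h z.1 * phik k z.2) @[k --> \oo] -->
  innerw f (fun z => h z.1 * phi z.2).
Proof.
move=> f2 h2 mphik mphi psi2 phikpsi phikphi.
have mf : measurable_fun C f by exact: (proj1 f2).
have mh : measurable_fun C (fun z : W => h z.1).
  by rewrite cylinderE; apply: measurable_fun_fst_setX => //; exact: (proj1 h2).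
have mt (g : R -> R) : measurable_fun Rp g -> measurable_fun C (fun z : W => g z.2).
  by move=> mg; rewrite cylinderE; apply: measurable_fun_snd_setX.
have gi := integrable_norm (L2_integrableM mC mw w0 f2 (L2_tensor mOmega h2 psi2)).
apply: (cvg_Rintegral_dominated mC _ _ _ gi).
- move=> k; apply: measurable_funM; first exact: measurable_funM.
  by apply: measurable_funM => //; exact: mt.
- apply: measurable_funM; first exact: measurable_funM.
  by apply: measurable_funM => //; exact: mt.
- move=> [x y] [/= Ox y0]; apply: cvgMr; apply: cvgMr; exact: phikphi.
- move=> k [x y] [/= Ox y0]; rewrite normrM [leRHS]normrM ler_wpM2l//.
  rewrite normrM [leRHS]normrM ler_wpM2l//.
  exact: le_trans (phikpsi _ _ y0) (ler_norm _).
Qed.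

Variables (w wn : W -> R) (h : V -> R) (lam D : R).
Hypothesis w2 : L2w w.
Hypothesis wn2 : L2w wn.
Hypothesis h2 : L2Omega Omega h.
Hypothesis test : forall e, Ccinfty setT e ->
  lam * innerw w (fun z => h z.1 * e z.2) +
  innerw wn (fun z => h z.1 * 'D_1 e (z.2 : R)) = D * e 0.

(** The Gaussian times the cutoff e0(y / (k+1)) is an admissible test function. As k grows the
    cutoff tends to e0(0) = 1, and its derivative carries a factor 1/(k+1) and disappears. *)
Lemma gauss_test (e0 : R -> R) r : Ccinfty setT e0 -> e0 0 = 1 -> 0 < r ->
  lam * innerw w (tgauss h 0 r) - 2 * r * innerw wn (tgauss h 1 r) = D.
Proof.
move=> ce0 e01 r0.
pose c (k : nat) : R := k.+1%:R^-1.
have c0 k : 0 < c k by rewrite invr_gt0.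
have c1 k : c k <= 1 by rewrite invf_le1 ?ler1n.
have cvgc : c k @[k --> \oo] --> (0 : R) by exact: cvg_harmonic.
pose e k : R -> R := (fun y => e0 (y * c k)) * gauss r.
have cd k : Ccinfty setT (fun y : R => e0 (y * c k)).
  by apply: Ccinfty_dilation => //; rewrite gt_eqF.
have ce k : Ccinfty setT (e k) by apply: CcinftyMr => // m; exact: Ck_gauss.
have [B B0 eB] := Ccinfty_bounded ce0.
have ce0' : Ccinfty setT (fun y : R => 'D_1 e0 y) by exact: Ccinfty_derive.
have [B' B0' eB'] := Ccinfty_bounded ce0'.
have /andP[a1 _] := alpha_bounds s01.
have g02 := @L2_half_gauss R s 0 r ltac:(by rewrite mulr0 add0r) r0.
have g12 := @L2_half_gauss R s 1 r ltac:(by lra) r0.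
have d1 k (y : R) : 'D_1 (fun y : R => e0 (y * c k)) y = c k * 'D_1 e0 (y * c k).
  have dM : is_derive y 1 (fun y : R => y * c k) (c k).
    have := is_deriveM (is_derive_id y 1) (is_derive_cst (c k) y 1).
    by rewrite scaler0 add0r /GRing.scale/= mulr1.
  have de : is_derive (y * c k) 1 e0 ('D_1 e0 (y * c k)).
    by apply: derivableP; exact: (Ccinfty_derivable ce0).
  have H := @is_derive1_comp R e0 _ y _ _ de dM.
  by rewrite (@derive_val _ _ _ _ _ _ _ H) mulrC.
have dE k y : 'D_1 (e k) y = c k * 'D_1 e0 (y * c k) * gauss r y +
    e0 (y * c k) * (- (2 * r * y) * gauss r y).
  rewrite deriveM; [|exact: (Ccinfty_derivable (cd k))
    |exact: (proj1 (Ck_derivable1 (Ck_gauss r)))].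
  by rewrite derive_gauss d1 addrC /GRing.scale/= [_ * gauss _ _]mulrC.
have cgauss : continuous (gauss r) by exact: Ck_continuous (Ck_gauss r 0).
have lim0 y (f : R -> R) : Ccinfty setT f -> f (y * c k) @[k --> \oo] --> f 0.
  move=> cf; have cf0 := @Ccinfty_continuous _ _ _ _ cf 0.
  have yc : y * c k @[k --> \oo] --> y * 0 by exact: cvgMr.
  rewrite mulr0 in yc.
  exact: (cvg_comp _ _ yc cf0).
have L1 : innerw w (fun z => h z.1 * e k z.2) @[k --> \oo] -->
    innerw w (tgauss h 0 r).
  apply: (inner_tensor_dominated (phik := e)
    (phi := fun y => y `^ 0 * gauss r y)
    (psi := fun y => B * (y `^ 0 * gauss r y)) w2 h2).
  - move=> k; apply: measurable_funTS; apply: continuous_measurable_fun.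
    exact: Ccinfty_continuous (ce k).
  - exact: (proj1 g02).
  - exact: (L2Z mRp mwy wy0 B g02).
  - move=> k y y0; rewrite [e k y](_ : _ = e0 (y * c k) * gauss r y)//.
    rewrite powRr0 mul1r normrM (ger0_norm (ltW (gauss_gt0 _ _))).
    by rewrite ler_wpM2r// ltW// gauss_gt0.
  - move=> y y0; rewrite powRr0 -e01; apply: cvgMl; exact: lim0.
have L2 : innerw wn (fun z => h z.1 * 'D_1 (e k) (z.2 : R)) @[k --> \oo] -->
    innerw wn (fun z => h z.1 * (- (2 * r) * (z.2 `^ 1 * gauss r z.2))).
  apply: (inner_tensor_dominated (phik := fun k (y : R) => 'D_1 (e k) y)
    (phi := fun y => - (2 * r) * (y `^ 1 * gauss r y))
    (* A majorant uniform in k: B' bounds the derivative of e0, the factor c k is at most 1, and B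
       bounds e0 itself. *)
    (psi := fun y => B' * (y `^ 0 * gauss r y) + (B * (2 * r)) * (y `^ 1 * gauss r y))
    wn2 h2).
  - move=> k; apply: measurable_funTS; apply: continuous_measurable_fun.
    have cDe : Ccinfty setT (fun y : R => 'D_1 (e k) y) by exact: Ccinfty_derive.
    exact: Ccinfty_continuous cDe.
  - by apply: measurable_funM; [exact: measurable_cst|exact: (proj1 g12)].
  - exact: (L2D mRp mwy wy0 (L2Z mRp mwy wy0 B' g02)
      (L2Z mRp mwy wy0 (B * (2 * r)) g12)).
  - move=> k y y0; rewrite dE powRr0 mul1r (powRr1 (ltW y0)).
    have gp := gauss_gt0 r y.
    rewrite (le_trans (ler_normD _ _))//; apply: lerD.
      rewrite !normrM (ger0_norm (ltW gp)) ler_wpM2r ?(ltW gp)//.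
      by rewrite (ger0_norm (ltW (c0 k))) -[leRHS]mul1r ler_pM ?(ltW (c0 k)).
    have -> : B * (2 * r) * (y * gauss r y) = B * (2 * r * y * gauss r y) by ring.
    have p0 : 0 <= 2 * r * y * gauss r y.
      by rewrite !mulr_ge0 ?(ltW gp) ?(ltW y0) ?(ltW r0).
    by rewrite normrM mulNr normrN (ger0_norm p0) ler_wpM2r.
  - move=> y y0; rewrite (powRr1 (ltW y0)).
    rewrite (_ : - (2 * r) * _ = 0 * 'D_1 e0 0 * gauss r y +
       e0 0 * (- (2 * r * y) * gauss r y)); last by rewrite e01; ring.
    rewrite (_ : (fun k => _) = fun k => c k * 'D_1 e0 (y * c k) * gauss r y +
       e0 (y * c k) * (- (2 * r * y) * gauss r y)); last by apply/funext => k.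
    apply: cvgD; last by apply: cvgMl; exact: lim0.
    by apply: cvgMl; apply: cvgM => //; exact: (lim0 y (fun y => 'D_1 e0 y)).
have LD : lam * innerw w (fun z => h z.1 * e k z.2) +
    innerw wn (fun z => h z.1 * 'D_1 (e k) (z.2 : R)) @[k --> \oo] -->
    lam * innerw w (tgauss h 0 r) +
    innerw wn (fun z => h z.1 * (- (2 * r) * (z.2 `^ 1 * gauss r z.2))).
  by apply: cvgD => //; exact: cvgMr.
have e00 k : e k 0 = 1.
  by rewrite [LHS](_ : _ = e0 (0 * c k) * gauss r 0)// /gauss mul0r e01 expr0n/=
    mulr0 oppr0 expR0 mulr1.
have D1 : innerw wn (fun z => h z.1 * (- (2 * r) * (z.2 `^ 1 * gauss r z.2))) =
    - (2 * r * innerw wn (tgauss h 1 r)).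
  have t2 : L2w (tgauss h 1 r) by apply: L2_tgauss => //; lra.
  rewrite -[RHS]mulNr (innerC _ _ _ wn (tgauss h 1 r)) -(innerZl mC mw w0 _ t2 wn2).
  rewrite [LHS]innerC /inner.
  by apply: eq_Rintegral => z _; rewrite /tgauss; ring.
rewrite -D1.
have LD' : lam * innerw w (fun z => h z.1 * e k z.2) +
    innerw wn (fun z => h z.1 * 'D_1 (e k) (z.2 : R)) @[k --> \oo] --> D.
  rewrite (_ : (fun k => _) = cst D); first exact: cvg_cst.
  by apply/funext => k; rewrite test// e00 mulr1.
exact: (cvg_unique _ LD LD').
Qed.

End gauss_test.

(** * Superposing the Gaussian identities into Bessel moments *)

Section lebW_sigma_finite.
Context (R : realType) (n : nat).

Lemma lebW_sigma_finite : sigma_finite setT (@lebW R n).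
Proof.
exists (fun k => @rV_cons R n @^-1` rV_box n.+1 k%:R).
  by rewrite -preimage_bigcup bigcup_rV_box preimage_setT.
move=> k; split.
  rewrite -[X in measurable X]setTI; apply: measurable_rV_cons => //.
  exact: measurable_rV_box.
(* The measure of this preimage is by definition the Lebesgue measure of the box in one dimension
   more. *)
exact: (@lebesgue_rV_box_lty R n.+1 k%:R).
Qed.

Definition lebC : {sigma_finite_measure set ('rV[R]_n * measurableTypeR R)%type -> \bar R} :=
  HB.pack_for {sigma_finite_measure set ('rV[R]_n * measurableTypeR R)%type -> \bar R}
    (Measure.sort (@lebW R n))
    (isSFinite.Build _ _ _ (Measure.sort (@lebW R n))
      (sfinite_measure_sigma_finite lebW_sigma_finite))
    (isSigmaFinite.Build _ _ _ (Measure.sort (@lebW R n)) lebW_sigma_finite).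

End lebW_sigma_finite.
Arguments lebC : clear implicits.

Section bessel_superposition.
Context {R : realType} {n : nat}.
Variables (Omega : set 'rV[R]_n) (s c : R).
Hypothesis mOmega : measurable Omega.
Hypothesis s01 : 0 < s < 1.
Hypothesis c0 : 0 < c.
Local Notation V := 'rV[R]_n.
Local Notation W := (V * measurableTypeR R)%type.
Local Notation mu := (@lebesgue_measure R).
Local Notation Rp := (`]0%R, +oo[%classic : set (measurableTypeR R)).
Local Notation C := (cylinder Omega).
Local Notation a := (alpha s).
Local Notation wy := (fun y : R => y `^ alpha s).
Local Notation L2y := (L2 mu Rp wy).
Local Notation L2w := (L2 lebW C (@weight R n s)).
Local Notation innerw := (inner lebW C (@weight R n s)).
Local Notation nu := (lebC R n \x mu)%E.
Let mC := measurable_cylinder mOmega.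
Let mw := @measurable_weight R n Omega s.
Let w0 := @weight_ge0 R n Omega s.
Let mRp : measurable Rp := measurable_half.
Let mwy : measurable_fun Rp wy := measurable_funTS (measurable_powR _).
Let wy0 (y : measurableTypeR R) (_ : Rp y) : 0 <= wy y := powR_ge0 _ _.

Let RpP (y : R) : Rp y -> 0 < y. Proof. by rewrite /= in_itv/= andbT. Qed.

Let cy2 (y : R) : 0 < y -> 0 < c * y ^+ 2.
Proof. by move=> y0; rewrite mulr_gt0// exprn_gt0. Qed.

(** The solution of c = kappa^2 / 2, the shape required by [mixing_le]. *)
Let kappa : R := Num.sqrt (2 * c).

Let kappa0 : 0 < kappa. Proof. by rewrite sqrtr_gt0 mulr_gt0. Qed.

Let mixing_bound p y t : 0 < t ->
  mixing p (c * y ^+ 2) t <= expR (- (kappa * y)) * (t `^ p * expR (- (2^-1 * t))).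
Proof.
move=> t0; have -> : c = kappa ^+ 2 / 2.
  by rewrite sqr_sqrtr ?mulr_ge0 ?(ltW c0)//; field.
exact: mixing_le.
Qed.

Let measurable_mixing_half p y : measurable_fun Rp (mixing p (c * y ^+ 2)).
Proof.
apply: (measurable_mixing p (b := fun=> c * y ^+ 2) (t := id)) => //.
Qed.

Lemma integrable_mixing p y : -1 < p -> 0 < y ->
  mu.-integrable Rp (EFin \o mixing p (c * y ^+ 2)).
Proof.
move=> p1 y0.
have := integrable_EFinZ mRp (expR (- (kappa * y))) (integrable_mixing_bound p1).
apply: (integrable_EFin_le mRp); first exact: measurable_mixing_half.
move=> t /RpP t0; rewrite (ger0_norm (mixing_ge0 _ _ _)).
exact: le_trans (mixing_bound p y t0) (ler_norm _).
Qed.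

(** Here the exponent is below -1 and t^(-p-2) alone is not integrable at 0; the inversion trades
    this for the exponent p. *)
Lemma integrable_mixing_inv p y : -1 < p -> 0 < y ->
  mu.-integrable Rp (EFin \o mixing (- p - 2) (c * y ^+ 2)).
Proof.
move=> p1 y0; apply/integrableP; split.
  by apply/measurable_EFinP; exact: measurable_mixing_half.
rewrite (_ : (\int[mu]_(t in Rp) _ =
    \int[mu]_(t in Rp) (mixing (- p - 2) (c * y ^+ 2) t)%:E)%E); last first.
  by apply: eq_integral => t _ /=; rewrite ger0_norm// mixing_ge0.
rewrite bessel_inversion ?cy2//.
have fi := integrable_mixing p1 y0.
rewrite -(fineK (integrable_fin_num mRp fi)) -EFinM; exact: ltry.
Qed.

Definition mixing_integrable p := forall y, 0 < y ->
  mu.-integrable Rp (EFin \o mixing p (c * y ^+ 2)).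

Let EFin_bessel p y : mixing_integrable p -> 0 < y ->
  (\int[mu]_(t in Rp) (mixing p (c * y ^+ 2) t)%:E = (bessel p (c * y ^+ 2))%:E)%E.
Proof.
move=> ip y0; rewrite /bessel /Rintegral fineK//.
exact: integrable_fin_num (ip y y0).
Qed.

Lemma bessel_ge0 p b : 0 <= @bessel R p b.
Proof. by apply: Rintegral_ge0 => t _; exact: mixing_ge0. Qed.

(** A Tonelli inner integral of a nonnegative function, extended by zero off the quadrant, is
    measurable in the outer variable. *)
Lemma measurable_bessel p : measurable_fun Rp (fun y : R => bessel p (c * y ^+ 2)).
Proof.
pose F : measurableTypeR R * measurableTypeR R -> \bar R :=
  (fun z => (mixing p (c * (z.1 : R) ^+ 2) z.2)%:E) \_ (Rp `*` Rp).
have mF : measurable_fun setT F.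
  apply/(measurable_restrictT _ (measurableX mRp mRp))/measurable_EFinP.
  apply: (measurable_mixing p (b := fun z : measurableTypeR R * measurableTypeR R =>
    c * (z.1 : R) ^+ 2) (t := snd)).
  - exact: measurableX.
  - by move=> [y t] [_] /RpP.
  - apply: measurable_funM => //; apply: measurable_funX.
    exact: measurable_funTS measurable_fst.
  - exact: measurable_funTS measurable_snd.
have F0 z : (0 <= F z)%E.
  by rewrite /F patchE; case: ifP => // _; rewrite lee_fin mixing_ge0.
have mG := @measurable_fun_fubini_tonelli_F _ _ _ _ _ mu F mF F0.
apply: (@eq_measurable_fun _ _ _ _ _ (fine \o fubini_F mu F)); last first.
  by apply: measurable_funTS; exact: measurableT_comp.
move=> y /set_mem Ry; rewrite /= /fubini_F /bessel /Rintegral [in RHS]integral_mkcond.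
congr fine; apply: eq_integral => t _; rewrite /F !patchE.
have -> : ((y, t) \in Rp `*` Rp) = (t \in Rp); last by [].
by apply/idP/idP => /set_mem H; apply/mem_set; [case: H|split].
Qed.

(** Integrating [mixing_le] in t bounds the moment by a constant times e^(-kappa y); y^b then only
    has to be square integrable at 0. *)
Lemma L2_bessel b p : -1 < p -> -1 < 2 * b + a ->
  L2y (fun y => y `^ b * bessel p (c * y ^+ 2)).
Proof.
move=> p1 ab; pose K := \int[mu]_(t in Rp) (t `^ p * expR (- (2^-1 * t))).
have K0 : 0 <= K by apply: Rintegral_ge0 => t _; rewrite mulr_ge0 ?powR_ge0 ?expR_ge0.
have ib := integrable_mixing_bound p1.
have bK y : 0 < y -> bessel p (c * y ^+ 2) <= K * expR (- (kappa * y)).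
  move=> y0; rewrite [leRHS]mulrC /K -RintegralZl//.
  apply: le_Rintegral => //; first exact: integrable_mixing.
    exact: integrable_EFinZ.
  by move=> t /RpP t0; exact: mixing_bound.
have me : measurable_fun Rp (fun y : R => y `^ b * expR (- (kappa * y))).
  apply: measurable_funM; first exact: measurable_funTS (measurable_powR _).
  by apply: measurable_funTS; apply: measurableT_comp => //; exact: measurableT_comp.
have e2 : L2y (fun y => y `^ b * expR (- (kappa * y))).
  apply: (integrable_sq_L2 mRp mwy wy0 me).
  have := @integrable_powR_expR R (2 * b + a) (2 * kappa) ab ltac:(by rewrite mulr_gt0).
  apply: eq_integrable => // y /set_mem/RpP y0.
  have E1 : (y : R) `^ (2 * b + a) = y `^ a * y `^ b * y `^ b.
    by rewrite -!powRD ?(gt_eqF y0) ?implybT//; congr (_ `^ _); ring.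
  have E2 : expR (- (2 * kappa * y)) = expR (- (kappa * y)) * expR (- (kappa * y)).
    by rewrite -expRD; congr expR; ring.
  by congr EFin; rewrite /= E2 [X in X * _]E1; ring.
apply: (L2_le mRp mwy wy0 _ (L2Z mRp mwy wy0 K e2)).
  apply: measurable_funM; first exact: measurable_funTS (measurable_powR _).
  exact: measurable_bessel.
move=> y /RpP y0; rewrite [X in _ <= `|X|]mulrCA normrM [leRHS]normrM ler_wpM2l//.
rewrite (ger0_norm (bessel_ge0 _ _)); exact: le_trans (bK _ y0) (ler_norm _).
Qed.

Section swap.
Variables (f : W -> R) (h : V -> R) (b p : R).
Hypothesis f2 : L2w f.
Hypothesis h2 : L2Omega Omega h.
Hypothesis ip : mixing_integrable p.
Hypothesis bp2 : L2y (fun y => y `^ b * bessel p (c * y ^+ 2)).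
Hypothesis ab : -1 < 2 * b + a.

(** The integrand in (z, t) whose t-integral is a Bessel moment and whose z-integral is a Gaussian
    pairing with r = c / t; Fubini equates the two. *)
Definition superposition (z : W * measurableTypeR R) : R :=
  weight s z.1 * f z.1 * (h z.1.1 * z.1.2 `^ b) * mixing p (c * (z.1.2 : R) ^+ 2) z.2.

Let k (z : W) : R := weight s z * f z * (h z.1 * z.2 `^ b).

Let mk : measurable_fun C k.
Proof.
apply: measurable_funM.
  by apply: measurable_funM; [exact: mw|exact: (proj1 f2)].
apply: measurable_funM.
  by rewrite cylinderE; apply: measurable_fun_fst_setX => //; exact: (proj1 h2).
by apply: measurable_funTS; apply: measurableT_comp (measurable_powR _) _.
Qed.

Let CP (z : W) : C z -> 0 < z.2. Proof. by case. Qed.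

(** The kernel is nonnegative, so integrating the modulus in t first gives a weighted product of f
    with a tensor whose y-factor is the Bessel profile; both are in L^2. *)
Lemma integrable_superposition :
  nu.-integrable (C `*` Rp) (EFin \o superposition).
Proof.
apply: (integrable_setX12 mC mRp).
  apply: measurable_funM; first exact: (measurable_fun_fst_setX mC mk).
  apply: (measurable_mixing p (b := fun z : W * measurableTypeR R =>
    c * (z.1.2 : R) ^+ 2) (t := snd)).
  - exact: measurableX.
  - by move=> [z t] [_] /RpP.
  - apply: measurable_funM => //; apply: measurable_funX.
    by apply: measurable_funTS; exact: measurableT_comp measurable_snd measurable_fst.
  - exact: measurable_funTS measurable_snd.
have i1 := L2_integrableM mC mw w0 f2 (L2_tensor mOmega h2 bp2).
have /integrableP[_] := i1; apply: le_lt_trans; rewrite le_eqVlt; apply/orP; left.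
apply/eqP; apply: eq_integral => z /set_mem Cz.
transitivity (\int[mu]_(t in Rp) (`|k z|%:E * (mixing p (c * (z.2 : R) ^+ 2) t)%:E))%E.
  apply: eq_integral => t _; rewrite -EFinM; congr EFin.
  by rewrite /superposition normrM (ger0_norm (mixing_ge0 _ _ _)).
rewrite ge0_integralZl//=; last 2 first.
- by apply/measurable_EFinP; exact: measurable_mixing_half.
- by move=> t _; rewrite lee_fin mixing_ge0.
rewrite (EFin_bessel ip (CP Cz)) -EFinM; congr EFin.
rewrite -[X in _ * X](ger0_norm (bessel_ge0 p (c * z.2 ^+ 2))) -normrM.
by congr `| _ |; rewrite /k; ring.
Qed.

Lemma Rintegral_superposition12 :
  \int[nu]_(z in C `*` Rp) superposition z =
  innerw f (fun z => h z.1 * (z.2 `^ b * bessel p (c * z.2 ^+ 2))).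
Proof.
rewrite (Rintegral_setX12 mC mRp integrable_superposition).
apply: eq_Rintegral => z /set_mem Cz.
rewrite /superposition/= RintegralZl//; last exact: ip (CP Cz).
by rewrite -/(bessel p (c * z.2 ^+ 2)); ring.
Qed.

Lemma superposition_slice t : 0 < t ->
  lebW.-integrable C (EFin \o (fun z => superposition (z, t))) /\
  \int[lebW]_(z in C) superposition (z, t) =
  t `^ p * expR (- t) * innerw f (tgauss h b (c / t)).
Proof.
move=> t0; have ct : 0 < c / t by rewrite divr_gt0.
have i1 := L2_integrableM mC mw w0 f2 (L2_tgauss mOmega ab ct h2).
have E z : superposition (z, t) =
    (t `^ p * expR (- t)) * (weight s z * f z * tgauss h b (c / t) z).
  rewrite /superposition /mixing /tgauss /gauss/= (_ : c * z.2 ^+ 2 / t = c / t * z.2 ^+ 2).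
    by ring.
  by rewrite mulrAC.
split; first by apply: eq_integrable (integrable_EFinZ mC (t `^ p * expR (- t)) i1)
  => // z _ /=; rewrite E.
by rewrite -RintegralZl//; apply: eq_Rintegral => z _; rewrite E.
Qed.

End swap.

Lemma alpha_lt_bounds : [/\ -1 < 2 * - a + a, -1 < 2 * (1 - a) + a, -1 < 2 * 0 + a
  & -1 < 2 * 1 + a].
Proof. by have /andP[h1 h2] := alpha_bounds s01; split; lra. Qed.

Let mi p : -1 < p -> mixing_integrable p.
Proof. by move=> p1 y; exact: integrable_mixing. Qed.

Let mi' p : -1 < p -> mixing_integrable (- p - 2).
Proof. by move=> p1 y; exact: integrable_mixing_inv. Qed.

Let L2y_eq (f g : R -> R) : (forall y, 0 < y -> f y = g y) -> L2y g -> L2y f.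
Proof.
move=> fg g2; apply: (L2_le mRp mwy wy0 _ g2).
  apply: (@eq_measurable_fun _ _ _ _ _ g); last exact: (proj1 g2).
  by move=> y /set_mem/RpP y0; rewrite fg.
by move=> y /RpP y0; rewrite fg.
Qed.

Let inv_bessel p b b' : b + 2 * (- p - 1) = b' -> forall y, 0 < y ->
  y `^ b * bessel (- p - 2) (c * y ^+ 2) =
  c `^ (- p - 1) * (y `^ b' * bessel p (c * y ^+ 2)).
Proof.
move=> <- y y0; rewrite bessel_inv ?cy2// powRM ?(ltW c0) ?sqr_ge0//.
rewrite -(powR_mulrn 2 (ltW y0)) -powRrM [y `^ (b + _)]powRD; last first.
  by apply/implyP => _; rewrite gt_eqF.
by ring.
Qed.

Let innerw_Zr (f : W -> R) (h : V -> R) k (e e' : R -> R) :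
  (forall y, 0 < y -> e y = k * e' y) -> L2w f -> L2Omega Omega h -> L2y e' ->
  innerw f (fun z => h z.1 * e z.2) = k * innerw f (fun z => h z.1 * e' z.2).
Proof.
move=> ee f2 h2 e2; rewrite -RintegralZl//; last first.
  exact: (L2_integrableM mC mw w0 f2 (L2_tensor mOmega h2 e2)).
by apply: eq_Rintegral => z /set_mem[_ z0]; rewrite ee//; ring.
Qed.

(* Integrating the two Gaussian identities against [t^-s e^-t] and
   [t^(s-1) e^-t] produces the same two Bessel moments, by the inversion
   [t -> c y^2 / t]; eliminating them leaves [D] and [u]. *)
Lemma bessel_relation (w wn : W -> R) (h : V -> R) (D u : R) :
  L2w w -> L2w wn -> L2Omega Omega h ->
  (forall r, 0 < r -> trace_form Omega s w wn h r = - u) ->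
  (forall r, 0 < r -> 4 * c * innerw w (tgauss h 0 r) -
     2 * r * innerw wn (tgauss h 1 r) = D) ->
  Gamma s * D = 2 * c `^ s * Gamma (1 - s) * u.
Proof.
move=> w2 wn2 h2 Htr Htest; have [b1 b2 b3 b4] := alpha_lt_bounds.
have /andP[s0 s1] := s01.
have q1 : -1 < - s :> R by lra.
have q2 : -1 < s - 1 by lra.
have e3 : - s - 1 = - (s - 1) - 2 by ring.
have e4 : s - 2 = - (- s) - 2 by ring.
have L1 := L2_bessel q1 b1.
have L3 := L2_bessel q2 b3.
have inv2 := @inv_bessel (s - 1) (1 - a) 0 ltac:(rewrite /alpha; ring).
have inv4 := @inv_bessel (- s) 1 (- a) ltac:(rewrite /alpha; ring).
have L2' : L2y (fun y => y `^ (1 - a) * bessel (- s - 1) (c * y ^+ 2)).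
  rewrite e3; have l := L2Z mRp mwy wy0 (c `^ (- (s - 1) - 1)) L3.
  exact: (L2y_eq inv2 l).
have L4 : L2y (fun y => y `^ 1 * bessel (s - 2) (c * y ^+ 2)).
  rewrite e4; have l := L2Z mRp mwy wy0 (c `^ (- - s - 1)) L1.
  exact: (L2y_eq inv4 l).
have m2 : mixing_integrable (- s - 1) by rewrite e3; exact: mi'.
have m4 : mixing_integrable (s - 2) by rewrite e4; exact: mi'.
pose I1 := innerw wn (fun z => h z.1 * (z.2 `^ (- a) * bessel (- s) (c * z.2 ^+ 2))).
pose I2 := innerw w (fun z => h z.1 * (z.2 `^ 0 * bessel (s - 1) (c * z.2 ^+ 2))).
have J2 : innerw w (fun z => h z.1 *
    (z.2 `^ (1 - a) * bessel (- s - 1) (c * z.2 ^+ 2))) = c `^ (- s) * I2.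
  rewrite e3 (innerw_Zr inv2 w2 h2 L3); congr (_ `^ _ * _); ring.
have J4 : innerw wn (fun z => h z.1 *
    (z.2 `^ 1 * bessel (s - 2) (c * z.2 ^+ 2))) = c `^ (s - 1) * I1.
  rewrite e4 (innerw_Zr inv4 wn2 h2 L1); congr (_ `^ _ * _); ring.
(* The common shape of both superpositions: an identity between Gaussian pairings for all t,
   multiplied by e^(-t) and integrated over t. *)
have H k1 k2 (f1 f2 : W -> R) b b' p p' q K : -1 < q -> L2w f1 -> L2w f2 ->
    mixing_integrable p -> mixing_integrable p' ->
    L2y (fun y => y `^ b * bessel p (c * y ^+ 2)) ->
    L2y (fun y => y `^ b' * bessel p' (c * y ^+ 2)) ->
    -1 < 2 * b + a -> -1 < 2 * b' + a ->
    (forall t, 0 < t -> k1 * (t `^ p * innerw f1 (tgauss h b (c / t))) +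
      k2 * (t `^ p' * innerw f2 (tgauss h b' (c / t))) = t `^ q * K) ->
    k1 * innerw f1 (fun z => h z.1 * (z.2 `^ b * bessel p (c * z.2 ^+ 2))) +
    k2 * innerw f2 (fun z => h z.1 * (z.2 `^ b' * bessel p' (c * z.2 ^+ 2))) =
    Gamma (q + 1) * K.
  move=> q0 f12 f22 i1 i2 l1 l2 ab1 ab2 HK.
  rewrite -(Rintegral_superposition12 f12 h2 i1 l1).
  rewrite -(Rintegral_superposition12 f22 h2 i2 l2).
  have S1 := integrable_superposition f12 h2 i1 l1.
  have S2 := integrable_superposition f22 h2 i2 l2.
  have mX := measurableX mC mRp.
  rewrite -!RintegralZl// -RintegralD//; [|exact: integrable_EFinZ..].
  rewrite (Rintegral_setX21 mC mRp); last first.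
    by apply: integrable_EFinD => //; exact: integrable_EFinZ.
  have iq := @integrable_powR_expR R q 1 q0 ltr01.
  have iq' : mu.-integrable Rp (EFin \o (fun t => t `^ (q + 1 - 1) * expR (- t))).
    by apply: eq_integrable iq => // t _ /=; rewrite mul1r addrK.
  rewrite /Gamma -(RintegralZr K mRp iq').
  apply: eq_Rintegral => t /set_mem/RpP t0.
  have [T1 E1] := superposition_slice p f12 h2 ab1 t0.
  have [T2 E2] := superposition_slice p' f22 h2 ab2 t0.
  rewrite (RintegralD mC (integrable_EFinZ mC k1 T1) (integrable_EFinZ mC k2 T2)).
  rewrite (RintegralZl k1 mC T1) (RintegralZl k2 mC T2) E1 E2 addrK [RHS]mulrAC -HK//.
  move: (inner _ _ _ f1 _) (inner _ _ _ f2 _) => X Y; ring.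
(* The coefficient 2 r is 2 c / t, so the second exponent is one lower than the first. *)
have E1 := H 1 (- (2 * c)) wn w (- a) (1 - a) (- s) (- s - 1) (- s) (- u)
  q1 wn2 w2 (mi q1) m2 L1 L2' b1 b2.
have E2 := H (4 * c) (- (2 * c)) w wn 0 1 (s - 1) (s - 2) (s - 1) D
  q2 w2 wn2 (mi q2) m4 L3 L4 b3 b4.
have {}E1 : I1 - 2 * c * (c `^ (- s) * I2) = Gamma (1 - s) * - u.
  rewrite -J2 -mulNr -[X in X + _]mul1r E1 ?[_ + 1]addrC// => t t0.
  rewrite -(Htr _ (divr_gt0 c0 t0)) /trace_form.
  have -> : t `^ (- s - 1) = t `^ (- s) / t.
    rewrite powRB ?powRr1 ?(ltW t0)//.
    by apply/implyP => _; rewrite gt_eqF.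
  move: (inner _ _ _ wn _) (inner _ _ _ w _) => X Y.
  by field; rewrite gt_eqF.
have {}E2 : 4 * c * I2 - 2 * c * (c `^ (s - 1) * I1) = Gamma s * D.
  rewrite -J4 -mulNr E2 ?subrK// => t t0.
  rewrite -(Htest _ (divr_gt0 c0 t0)).
  have -> : t `^ (s - 2) = t `^ (s - 1) / t.
    rewrite (_ : s - 2 = s - 1 - 1); last by ring.
    rewrite [LHS]powRB ?powRr1 ?(ltW t0)//.
    by apply/implyP => _; rewrite gt_eqF.
  move: (inner _ _ _ wn _) (inner _ _ _ w _) => X Y.
  by field; rewrite gt_eqF.
have cs : c `^ s != 0 by rewrite gt_eqF// powR_gt0.
have c1 : c `^ (s - 1) = c `^ s / c.
  rewrite powRB ?powRr1 ?(ltW c0)//.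
  by apply/implyP => _; rewrite gt_eqF.
have cN0 : c != 0 by rewrite gt_eqF.
(* Substituting I1 cancels I2 too, because 2 c^s times 2 c c^(-s) I2 is 4 c I2. *)
rewrite -E2 c1; rewrite powRN in E1.
have -> : I1 = Gamma (1 - s) * - u + 2 * c * ((c `^ s)^-1 * I2).
  by rewrite -E1 subrK.
by field; rewrite cs cN0.
Qed.

End bessel_superposition.

(** * A cutoff in one variable; coordinates in the eigenbasis *)

Section cutoff.
Context {R : realType} {n : nat}.
Variables (Omega : set 'rV[R]_n).
Hypothesis mOmega : measurable Omega.
Hypothesis bOmega : exists2 M, 0 < M & forall x, Omega x -> `|x| <= M.

(** The approximants of a normalised h cannot all vanish, since their pairings with h tend to 1. One
    that is nonzero at x, restricted to a line through x and divided by its value there, is the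
    cutoff. *)
Lemma cutoff_exists h g (j : 'I_n) : H10 Omega h g -> innerOmega Omega h h = 1 ->
  exists2 e0 : R -> R, Ccinfty setT e0 & e0 0 = 1.
Proof.
move=> hg hh; have [_ [p hp]] := hg; have [cp _] := hp.
suff [k [x px]] : exists k x, p k x != 0.
  pose v : 'rV[R]_n := delta_mx ord0 j.
  have v0 : v != 0.
    by apply/eqP => /matrixP/(_ ord0 j)/eqP; rewrite !mxE !eqxx oner_eq0.
  have ce := CcinftyMr (Ccinfty_line x v0 (cp k)) (fun m => Ck_cst R m (p k x)^-1).
  exists ((fun y : R => p k (y *: v + x)) * cst (p k x)^-1) => //.
  by rewrite [LHS](_ : _ = p k (0 *: v + x) * (p k x)^-1)// scale0r add0r mulfV.
apply: contrapT => np; have p0 k : p k = cst 0.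
  apply/funext => x; apply: contrapT => /eqP px; apply: np; by exists k, x.
have h2 := H10_L2 hg.
have c := H1approx_inner mOmega (measurable_cst _) (fun x _ => ler01)
  (fun f cf => L2Omega_Ccinfty mOmega bOmega cf) h2 hp h2.
have c' : (0 : R) @[k --> \oo] --> innerOmega Omega h h.
  apply: cvg_trans c; apply: near_eq_cvg; apply: nearW => k.
  rewrite p0 /inner; symmetry; rewrite (_ : (fun x => _) = cst 0).
    by rewrite Rintegral_cst// mul0r.
  by apply/funext => x; rewrite mulr0 mul0r.
have : innerOmega Omega h h = 0 by exact: (cvg_unique _ c' (cvg_cst _)).
by rewrite hh => /eqP; rewrite oner_eq0.
Qed.

End cutoff.

Section orthonormal_coordinates.
Context {R : realType} {n : nat}.
Variables (Omega : set 'rV[R]_n) (s : R).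
Variables (lam : nat -> R) (phi : nat -> 'rV[R]_n -> R).
Hypothesis ortho : forall i j, innerOmega Omega (phi i) (phi j) = (i == j)%:R.

Lemma HH_eigenfunction k : L2Omega Omega (phi k) -> HH Omega lam phi s (phi k).
Proof.
move=> k2; split => //; apply: (@le_lt_trans _ _ (lam k `^ s)%:E); last exact: ltry.
apply: lime_le.
  by apply: is_cvg_nneseries => j _ _; rewrite lee_fin mulr_ge0 ?powR_ge0 ?sqr_ge0.
apply: nearW => m; rewrite /= (eq_bigr (fun j => if j == k then (lam k `^ s)%:E else 0%E)).
  rewrite -big_mkcond big_nat1_eq; case: ifP => // _.
  by rewrite lee_fin powR_ge0.
move=> j _; rewrite ortho eq_sym; case: eqP => [->|_].
  by rewrite expr1n mulr1.
by rewrite expr0n mulr0.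
Qed.

(** By orthonormality the partial sums are constant from index k + 1 on. *)
Lemma frac_power_eigenfunction u k :
  frac_power Omega lam phi s u (phi k) = lam k `^ s * innerOmega Omega u (phi k).
Proof.
apply: lim_near_cst => //; exists k.+1 => // m /= km.
rewrite /series/= (eq_bigr (fun j => if j == k then
  lam k `^ s * innerOmega Omega u (phi k) else 0)).
  by rewrite -big_mkcond big_nat1_eq/= km.
move=> j _; rewrite ortho eq_sym; case: eqP => [->|_]; first by rewrite mulr1.
by rewrite mulr0.
Qed.

(* The functions whose coordinates all vanish form the kernel of the seminorm
   bounding [f]. *)
Lemma HHdual_coef f v w : HHdual Omega lam phi s f -> HH Omega lam phi s v ->
  L2Omega Omega w ->
  (forall k, innerOmega Omega w (phi k) = 0) ->
  forall a, f (fun x => a * v x + w x) = a * f v.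
Proof.
move=> [flin [c fc]] v2 w2 w0 a.
have H0 : Hsqnorm Omega lam phi s w = 0%E.
  by apply: eseries0 => k _ _; rewrite w0 expr0n mulr0.
have wH : HH Omega lam phi s w by split; rewrite ?H0 ?ltry.
have fw : f w = 0.
  by apply/normr0_eq0/le_anti; have := fc _ wH; rewrite H0/= sqrtr0 mulr0 normr_ge0 => ->.
by rewrite flin// fw addr0.
Qed.

End orthonormal_coordinates.

(** Since l^s = (l/4)^s 2^(2s), this matches the power of 2 in [d_s] with the constant in
    [bessel_relation] for c = l / 4. *)
Lemma powR_d_s (R : realType) (s l : R) : 0 <= l ->
  2 `^ (1 - 2 * s) * l `^ s = 2 * (l / 4) `^ s.
Proof.
move=> l0; have -> : l `^ s = (l / 4) `^ s * 2 `^ (2 * s).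
  rewrite powRrM powR_mulrn ?ler0n// -powRM ?divr_ge0 ?ler0n ?exprn_ge0//.
  by congr (_ `^ _); field.
rewrite mulrCA -powRD; last by rewrite pnatr_eq0 implybT.
by rewrite subrK powRr1 ?ler0n// mulrC.
Qed.

(** * The trace of the extension solves the fractional problem *)

Section extension.
Context {R : realType} {n : nat}.
Variables (Omega : set 'rV[R]_n) (A : 'rV[R]_n -> 'M[R]_n) (qbar s : R).
Hypothesis pOmega : open_bounded_convex_polytope Omega.
Hypothesis s01 : 0 < s < 1.
Hypothesis aA : admissible_matrix Omega A.
Variable j0 : 'I_n.
Variable tr : ('rV[R]_n * measurableTypeR R -> R) -> 'rV[R]_n -> R.
Hypothesis trP : forall w g, H1L Omega s w g -> is_trace Omega s w (tr w).
Variables (q : 'rV[R]_n -> R) (lam : nat -> R) (phi : nat -> 'rV[R]_n -> R).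
Hypothesis cq : coefficients Omega qbar q.
Hypothesis eigen : is_eigensystem Omega A q lam phi.
Variable f : ('rV[R]_n -> R) -> R.
Hypothesis fdual : HHdual Omega lam phi s f.
Let mOmega := polytope_measurable pOmega.
Let bOmega := polytope_bounded pOmega.
Let neOmega : Omega !=set0. Proof. by case: pOmega. Qed.
Let m1 : measurable_fun Omega (cst 1 : 'rV[R]_n -> R) := measurable_cst _.
Let p1 (x : 'rV[R]_n) (_ : Omega x) : 0 <= cst (1 : R) x := ler01.

Let ortho i j : innerOmega Omega (phi i) (phi j) = (i == j)%:R.
Proof. by have [_ + _] := eigen; exact. Qed.

Let phi2 k : L2Omega Omega (phi k).
Proof. by have [/(_ k)[g kg _] _ _] := eigen; exact: H10_L2 kg. Qed.

Lemma eigensystem_gt0 k : 0 < lam k.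
Proof.
have [/(_ k)[g kg ke] _ _] := eigen.
apply: (eigenvalue_gt0 mOmega neOmega bOmega aA cq kg ke j0).
by have := ortho k k; rewrite eqxx.
Qed.

(** [tr] only selects some trace, so its value here need not be e(0) phi_k pointwise. The two have
    equal coordinates by [is_trace_unique], and f does not distinguish such functions. *)
Lemma dual_trace_tensor k g e : H10 Omega (phi k) g -> Ccinfty setT e ->
  f (tr (tensor (phi k) e)) = e 0 * f (phi k).
Proof.
move=> kg ce; have t1 := trP (H1L_tensor mOmega bOmega s01 kg ce).
have t2 := is_trace_tensor mOmega bOmega s01 kg ce.
have l1 := proj1 t1; have l2 := proj1 t2.
set t := tr _ in t1 l1 *.
pose w x := t x - e 0 * phi k x.
have w2 : L2Omega Omega w by exact: (L2B mOmega m1 p1 l1 l2).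
have w0 i : innerOmega Omega w (phi i) = 0.
  rewrite [LHS](innerBl mOmega m1 p1 l1 l2 (phi2 i)).
  have := is_trace_unique mOmega bOmega s01 t1 t2 (phi2 i).
  by rewrite /innerOmega => ->; rewrite subrr.
rewrite -(HHdual_coef fdual (HH_eigenfunction s lam ortho (phi2 k)) w2 w0).
by congr f; apply/funext => x; rewrite /w addrC subrK.
Qed.

(** With c = lam k / 4 the two hypotheses of [bessel_relation] come from [gauss_test] and
    [trace_form_is_trace], for the same gradient of E; the normalisation in [d_s] cancels both Gamma
    factors and the powers of 2. *)
Lemma extension_coef E k : is_extension Omega A s tr f q E ->
  f (phi k) = lam k `^ s * innerOmega Omega (tr E) (phi k).
Proof.
move=> [gE hE EP]; have [/(_ k)[g kg ke] _ _] := eigen.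
have kk : innerOmega Omega (phi k) (phi k) = 1 by rewrite ortho eqxx.
have lam0 := eigensystem_gt0 k.
have [e0 ce0 e01] := cutoff_exists mOmega bOmega j0 kg kk.
have Htest r : 0 < r -> 4 * (lam k / 4) *
    inner lebW (cylinder Omega) (@weight R n s) E (tgauss (phi k) 0 r) -
    2 * r * inner lebW (cylinder Omega) (@weight R n s)
      (fun z => gE z ord0 iy) (tgauss (phi k) 1 r) = d_s s * f (phi k).
  move=> r0; have -> : 4 * (lam k / 4) = lam k by field.
  apply: (gauss_test mOmega s01 (H1L_L2 hE) (H1L_L2y hE iy) (phi2 k) _ ce0 e01 r0).
  move=> e ce; have := EP _ _ (H1L_tensor mOmega bOmega s01 kg ce).
  rewrite (a_C_tensor mOmega neOmega bOmega s01 aA cq kg ke ce hE).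
  by rewrite (dual_trace_tensor kg ce) [_ * (e 0 * _)]mulrCA [RHS]mulrC.
have Htr r : 0 < r -> trace_form Omega s E (fun z => gE z ord0 iy) (phi k) r =
    - innerOmega Omega (tr E) (phi k).
  exact: (trace_form_is_trace mOmega bOmega s01 hE (trP hE) (phi2 k)).
have c0 : 0 < lam k / 4 by rewrite divr_gt0.
have := bessel_relation mOmega s01 c0 (H1L_L2 hE) (H1L_L2y hE iy) (phi2 k) Htr Htest.
have /andP[s0 s1] := s01.
have G1 : Gamma s != 0 by rewrite gt_eqF// Gamma_gt0.
have G2 : Gamma (1 - s) != 0 by rewrite gt_eqF// Gamma_gt0// subr_gt0.
rewrite -powR_d_s ?(ltW lam0)// /d_s => H.
have P0 : 2 `^ (1 - 2 * s) != 0 :> R by rewrite gt_eqF// powR_gt0.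
apply: (mulfI P0); apply: (mulfI G2).
transitivity (Gamma s * (2 `^ (1 - 2 * s) * Gamma (1 - s) / Gamma s * f (phi k))).
  by field.
by rewrite H; ring.
Qed.

(** Testing the fractional equation with phi_k gives u the same coordinates, as lam_k^s is nonzero;
    completeness of the eigensystem concludes. *)
Lemma extension_trace E u : is_extension Omega A s tr f q E ->
  is_fractional_solution Omega s lam phi f u ->
  {ae lebesgue_rV R n, forall x, Omega x -> tr E x = u x}.
Proof.
move=> hE [[u2 _] uP]; have [gE E1 _] := hE.
have t2 := proj1 (trP E1); have [_ _ complete] := eigen.
have : {ae lebesgue_rV R n, forall x, Omega x -> tr E x - u x = 0}.
  apply: complete; first exact: (L2B mOmega m1 p1 t2 u2).
  move=> k; rewrite [LHS](innerBl mOmega m1 p1 t2 u2 (phi2 k)).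
  apply/eqP; rewrite subr_eq0; apply/eqP.
  have L0 : lam k `^ s != 0 by rewrite gt_eqF// powR_gt0// eigensystem_gt0.
  apply: (mulfI L0); rewrite -[LHS](extension_coef k hE).
  rewrite -uP; first exact: frac_power_eigenfunction.
  exact: HH_eigenfunction.
by apply: filterS => x H /H /eqP; rewrite subr_eq0 => /eqP.
Qed.

End extension.

(** * Equivalence of the two identification problems *)

Lemma normOmega_ae_eq (R : realType) n (Omega : set 'rV[R]_n) (u v : 'rV[R]_n -> R) :
  measurable Omega -> measurable_fun Omega u -> measurable_fun Omega v ->
  {ae lebesgue_rV R n, forall x, Omega x -> u x = v x} ->
  normOmega Omega u = normOmega Omega v.
Proof.
move=> mO mu mv uv; congr (Num.sqrt (fine _)); apply: ae_eq_integral => //.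
- apply/measurable_EFinP; apply: measurable_funM => //; exact: measurable_funX.
- apply/measurable_EFinP; apply: measurable_funM => //; exact: measurable_funX.
- by apply: filterS uv => x uv Ox; rewrite uv.
Qed.

Theorem theorem3p3 (R : realType) (d : nat) (Omega : set 'rV[R]_d)
  (A : 'rV[R]_d -> 'M[R]_d) (qbar s rho : R)
  (lam : ('rV[R]_d -> R) -> nat -> R)
  (phi : ('rV[R]_d -> R) -> nat -> 'rV[R]_d -> R)
  (tr : ('rV[R]_d * measurableTypeR R -> R) -> 'rV[R]_d -> R)
  (f : ('rV[R]_d -> R) -> R)
  (U : ('rV[R]_d -> R) -> 'rV[R]_d -> R)
  (E : ('rV[R]_d -> R) -> 'rV[R]_d * measurableTypeR R -> R)
  (z qstar qd : 'rV[R]_d -> R) :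
  (d = 2 \/ d = 3)%N ->
  open_bounded_convex_polytope Omega ->
  admissible_matrix Omega A ->
  0 < qbar ->
  0 < s < 1 ->
  (forall q, coefficients Omega qbar q ->
     is_eigensystem Omega A q (lam q) (phi q)) ->
  (forall w g, H1L Omega s w g -> is_trace Omega s w (tr w)) ->
  (forall q, coefficients Omega qbar q ->
     HHdual Omega (lam q) (phi q) s f) ->
  (forall q, coefficients Omega qbar q ->
     is_fractional_solution Omega s (lam q) (phi q) f (U q)) ->
  (forall q, coefficients Omega qbar q ->
     is_extension Omega A s tr f q (E q)) ->
  L2Omega Omega z ->
  L2Omega Omega qstar ->
  0 < rho ->
  coefficients Omega qbar qd ->
  (local_solution Omega qbar
     (cost Omega z qstar rho (fun q => tr (E q))) qd <->
   local_solution Omega qbar (cost Omega z qstar rho U) qd) /\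
  {ae lebesgue_rV R d, forall x, Omega x -> tr (E qd) x = U qd x}.
Proof.
move=> d23 pO aA qbar0 s01 eigen trP fdual Usol Eext z2 qstar2 rho0 cqd.
have mO := polytope_measurable pO.
(* One coordinate direction must exist: positivity of the eigenvalues and the cutoff both rest on
   it. *)
have d0 : (0 < d)%N by case: d23 => ->.
have trEU q : coefficients Omega qbar q ->
    {ae lebesgue_rV R d, forall x, Omega x -> tr (E q) x = U q x}.
  move=> cq; exact: (extension_trace pO s01 aA (Ordinal d0) trP cq (eigen _ cq)
    (fdual _ cq) (Eext _ cq) (Usol _ cq)).
split; last exact: trEU.
have costE q : coefficients Omega qbar q ->
    cost Omega z qstar rho (fun q => tr (E q)) q = cost Omega z qstar rho U q.
  move=> cq; rewrite /cost; congr (_ * _ ^+ 2 + _).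
  have [gE hE _] := Eext _ cq; have [[[mU _] _] _] := Usol _ cq.
  apply: normOmega_ae_eq => //.
  - by apply: measurable_funB; [exact: (proj1 (proj1 (trP _ _ hE)))|exact: (proj1 z2)].
  - by apply: measurable_funB => //; exact: (proj1 z2).
  - by apply: filterS (trEU _ cq) => x H Ox; rewrite H.
(* The costs agree on admissible coefficients, so the same radius e serves both problems. *)
split=> -[_ [e e0 loc]]; split => //; exists e => // q cq qe.
  by rewrite -!costE//; exact: loc.
by rewrite !costE//; exact: loc.
Qed.
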